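(* Let $F(X,Y)$ be an irreducible binary form with integer coefficients of degree $t\ge4$, and let $$\Psi_F(x,y):=\#\{(a,b)\in\mathbb Z^2:\ 1\le a,b\le x,\ F(a,b)\ne0,\ P^+(|F(a,b)|)\le y\}.$$ Put $u:=\frac{\log x}{\log y}$. Then $$\Psi_F(x,y)\ \ge\ \{1-(t-2)u+o(1)\}\,x^2$$ as $x\to\infty$, in the domain $x^{t-2}\le y$, i.e. $u(t-2)\le1$.
   Context: $P^+(n)$ denotes the largest prime factor of $n\ge1$, with $P^+(1):=1$. A binary form is a homogeneous polynomial in two variables. The form $F$ is fixed as $x\to\infty$. *)

(* Defs.v *)
From mathcomp Require Import all_boot all_order all_algebra finmap.
From mathcomp Require Import boolp classical_sets functions cardinality reals.
From mathcomp Require Import mpoly.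

Set Implicit Arguments.
Unset Strict Implicit.
Unset Printing Implicit Defensive.

Import Order.TTheory GRing.Theory Num.Theory.
Local Open Scope classical_set_scope.
Local Open Scope ring_scope.

Definition irreducible_element (A : idomainType) (p : A) : Prop :=
  [/\ p != 0, p \isn't a GRing.unit &
      forall q r : A, p = q * r ->
        q \is a GRing.unit \/ r \is a GRing.unit].

(* Irreducibility of an integral form is understood over the rationals, so
   that a nontrivial content is allowed. *)
Definition irreducible_form (F : {mpoly int[2]}) : Prop :=
  irreducible_element (map_mpoly (intr : int -> rat) F).

Definition form_eval (F : {mpoly int[2]}) (a b : int) : int :=
  F.@[fun i : 'I_2 => [:: a; b]`_i].

(* [max_pdiv n] is the largest prime factor of n > 1, and max_pdiv 1 = 1. *)
Definition friable_pairs (R : realType) (F : {mpoly int[2]}) (x y : R) :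
    set (int * int) :=
  [set ab | [/\ 1 <= ab.1 /\ ab.1%:~R <= x,
                1 <= ab.2 /\ ab.2%:~R <= x,
                form_eval F ab.1 ab.2 != 0 &
                (max_pdiv `|form_eval F ab.1 ab.2|%N)%:R <= y]].

(* [fset_set] is the empty set on infinite sets; this lemma rules that out. *)
Lemma finite_friable_pairs (R : realType) (F : {mpoly int[2]}) (x y : R) :
  finite_set (friable_pairs F x y).
Proof.
have bnd (a : int) : 1 <= a -> a%:~R <= x ->
    exists2 n : nat, n \in iota 0 (Num.truncn x).+1 & a = n%:Z.
  case: a => [n _ nx|//]; exists n => //.
  by rewrite mem_iota /= add0n ltnS truncn_ge_nat // (le_trans _ nx) ?ler0n.
pose s : seq (int * int) :=
  [seq (m%:Z, n%:Z) | m <- iota 0 (Num.truncn x).+1,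
                      n <- iota 0 (Num.truncn x).+1].
apply: (@sub_finite_set _ _ [set` s]); last exact: finite_seq.
move=> [a b] [/= [a1 ax] [b1 bx] _ _].
have [m ms ->] := bnd _ a1 ax; have [n ns ->] := bnd _ b1 bx.
by apply/allpairsP; exists (m, n).
Qed.

Definition Psi (R : realType) (F : {mpoly int[2]}) (x y : R) : nat :=
  #|` fset_set (friable_pairs F x y)|%fset.

(* Main.v *)
Require Import Defs.
From HB Require Import structures.
From mathcomp Require Import all_boot all_order all_fingroup all_algebra all_field.
From mathcomp Require Import finmap reals.
From mathcomp Require classical_sets cardinality.
From mathcomp Require Import -(notations) sequences exp.
From mathcomp Require Import mpoly.
From mathcomp Require Import zify ring lra.

Set Implicit Arguments.
Unset Strict Implicit.
Unset Printing Implicit Defensive.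

Import Order.TTheory GRing.Theory Num.Theory.
Local Open Scope ring_scope.

(** Write N for the number of pairs (a, b) in [1, X]^2 whose value F(a, b) has a
    prime factor larger than y.  Since log |F(a, b)| <= t log X + O(1), and since
    a prime p <= X^2 is at most y,
      N log y <= t X^2 log X + O(X^2) - sum_(p <= X^2) log p #{(a, b) : p | F(a, b)},
    so it suffices to bound the last sum below by (2 - o(1)) X^2 log X.

    A root s of F(S, 1) modulo p confines (a, b) to a lattice of index p, which has
    (1 + o(1)) X^2 / p points in the box unless it contains a vector much shorter
    than sqrt p.  Such a vector (c, d) satisfies p | F(c, d) <> 0, so these lattices
    are few.  It remains to see that the number w(p) of roots satisfies
    sum_(p <= z) w(p) log p / p >= (1 - o(1)) log z.

    For a monic model g of F this comes from the norm form of Z[T]/(g), with no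
    ideal theory beyond lattices.  Average log |N(A)| over A in a box of side X: the
    mean is t log X + O(1).  Apart from a few exceptional A, a prime dividing N(A)
    does so once and comes from a common root of A and g modulo p.  The elements A
    vanishing at a given root form an ideal of index p; the multiples of a short
    element of it show that every class modulo the ideal has a representative of
    size O(p^(1/t)), whence at most (1 + o(1)) X^t / p of them lie in the box. *)

(** * Counting points of a lattice in a box *)

(** Both lattice counts are one-sided. The norm form needs upper bounds for primes up to the size
    X^t of the norms; the total of log |N(A)| then forces the weighted sum of w(p) to be large. The
    pairs need lower bounds, for p up to X^2 over a power of log X only.

    The splitting of primes is replaced by the kernel of multiplication by A modulo p: when the gcd
    of A and g modulo p is linear this kernel is a line, and if p^2 divides N(A) it lifts to a
    common root modulo p^2.

    The obstacle is the order of choices. Bounds for large p involve D = P0!, so only a later choice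
    of X can compensate them. Therefore the exceptional A are split at p = X: up to X the constant
    is free of D, and P0 is chosen against it; beyond X the constant involves D but multiplies a
    tail of size 1/X.

    Finally t >= 4 gives X^2 <= x^(t-2) <= y, so a prime factor above y is never one of the p <= X^2
    and its logarithm comes on top of theirs. About (t - 2) X^2 log X remains to be shared by pairs
    costing at least log y each, which is the origin of (t - 2) u. *)

(** By Cramer's rule [s *m \adj V / D] are the rational coordinates of [s] with respect to the rows
    of [V]. Rounding them leaves a combination of the rows with coefficients of absolute value below
    1. Everything is multiplied by [D] to stay in the integers. *)
Lemma lattice_reduction n (V : 'M[int]_n) (K : nat) (s : 'rV[int]_n) :
  \det V != 0 -> (forall i j, `|V i j| <= K%:Z) ->
  exists q : 'rV[int]_n, forall j, `|(s - q *m V) 0 j| <= (n * K)%:Z.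
Proof.
move=> dV bV; set D := \det V.
pose w := s *m \adj V.
exists (map_mx (fun a => (a %/ D)%Z) w) => j.
set q := map_mx _ _.
pose rho := map_mx (fun a => (a %% D)%Z) w.
have wE : w = D *: q + rho.
  by apply/rowP => k; rewrite !mxE mulrC -divz_eq.
have E : D *: (s - q *m V) = rho *m V.
  have -> : rho = w - D *: q by rewrite wE addrC addKr.
  rewrite mulmxBl /w -mulmxA mul_adj_mx scalerBr -scalemxAl.
  by rewrite mul_mx_scalar.
have Ej : D * (s - q *m V) 0 j = (rho *m V) 0 j by rewrite -E !mxE.
have D0 : 0 < `|D| by rewrite normr_gt0.
rewrite -(ler_pM2l D0) -normrM Ej [X in `|X|]mxE.
apply: le_trans (ler_norm_sum _ _ _) _.
have -> : `|D| * (n * K)%:Z = \sum_(i < n) `|D| * K%:Z.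
  by rewrite sumr_const card_ord -mulr_natr PoszM -mulrA [n%:Z * _]mulrC natz.
apply: ler_sum => k _; rewrite normrM; apply: ler_pM => //.
rewrite !mxE ger0_norm ?modz_ge0 //.
by apply: ltW; rewrite ltz_mod.
Qed.

Definition box_vec n X (B : {ffun 'I_n -> 'I_X}) : 'rV[int]_n :=
  \row_i (B i : nat)%:Z.

Lemma box_vec_inj n X : injective (@box_vec n X).
Proof.
move=> B B' E; apply/ffunP => i; apply/val_inj => /=.
by have := congr1 (fun v : 'rV_n => v 0 i) E; rewrite !mxE => -[].
Qed.

Lemma box_vecP n X (v : 'rV[int]_n) :
  (forall i, 0 <= v 0 i < X%:Z) -> exists B : {ffun 'I_n -> 'I_X}, box_vec B = v.
Proof.
move=> vX; have h i : (`|v 0%R i| < X)%N by have := vX i; lia.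
by exists [ffun i => Ordinal (h i)]; apply/rowP => i; rewrite mxE ffunE /=; have := vX i; lia.
Qed.

Section Fibers.
Variables (n : nat) (T : finZmodType) (phi : {additive 'rV[int]_n -> T}).
Variables (V : 'M[int]_n) (K : nat).
Hypotheses (phi_onto : forall tau, exists v, phi v = tau)
  (phiV : forall q : 'rV[int]_n, phi (q *m V) = 0)
  (detV : \det V != 0) (boundV : forall i j, `|V i j| <= K%:Z).

Lemma small_representative tau :
  exists v, phi v = tau /\ forall i, `|v 0 i| <= (n * K)%:Z.
Proof.
have [v <-] := phi_onto tau.
have [q hq] := lattice_reduction v detV boundV.
by exists (v - q *m V); rewrite raddfB phiV subr0.
Qed.

Lemma small_representative_fun : exists rep : T -> 'rV[int]_n, forall tau,
  phi (rep tau) = tau /\ forall i, `|rep tau 0 i| <= (n * K)%:Z.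
Proof.
have h tau : exists v, (phi v == tau) && [forall i, `|v 0 i| <= (n * K)%:Z].
  have [v [E b]] := small_representative tau; exists v; rewrite E eqxx /=.
  by apply/forallP.
exists (fun tau => xchoose (h tau)) => tau.
by have /andP[/eqP-> /forallP] := xchooseP (h tau).
Qed.

(* The translates of [S] by small representatives of all the classes are disjoint
   and lie in a slightly larger box. *)
Lemma card_fiber_le X (S : {set {ffun 'I_n -> 'I_X}}) :
  (forall B B', B \in S -> B' \in S -> phi (box_vec B) = phi (box_vec B')) ->
  (#|S| * #|T| <= (X + 2 * n * K) ^ n)%N.
Proof.
move=> hS.
have [rep hrep] := small_representative_fun.
pose Y := (X + 2 * n * K)%N.
have h (BT : {ffun 'I_n -> 'I_X} * T) : exists B' : {ffun 'I_n -> 'I_Y},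
    box_vec B' == box_vec BT.1 + rep BT.2 + const_mx (n * K)%:Z.
  have [|B' E] := @box_vecP n Y (box_vec BT.1 + rep BT.2 + const_mx (n * K)%:Z).
    move=> i; have [_ /(_ i)] := hrep BT.2; rewrite !mxE /Y -mulnA.
    by have := ltn_ord (BT.1 i); set m := (n * K)%N; move: (BT.1 i) (rep _ _ _); lia.
  by exists B'; rewrite E.
pose f BT := xchoose (h BT).
have fE BT : box_vec (f BT) = box_vec BT.1 + rep BT.2 + const_mx (n * K)%:Z.
  exact/eqP/(xchooseP (h BT)).
rewrite -cardsT -cardsX.
have <- : #|[set f BT | BT in setX S [set: T]]| = #|setX S [set: T]|.
  apply: card_in_imset => -[B t] [B' t'] /=; rewrite !inE /= !andbT => SB SB' E.
  have := congr1 (@box_vec _ _) E; rewrite !fE /= => /addIr E'.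
  have Et : t = t'.
    have := congr1 phi E'; rewrite !raddfD /= (hS _ _ SB SB') => /addrI.
    by rewrite (hrep t).1 (hrep t').1.
  by move: E'; rewrite Et => /addIr/box_vec_inj ->.
by apply: leq_trans (max_card _) _; rewrite card_ffun !card_ord.
Qed.

(** Each point of a smaller box placed in the middle is moved into the fibre of [tau] by the small
    representative of the class it lacks. The pair made of the new point and that class determines
    the old point. *)
Lemma card_fiber_ge X tau : (2 * n * K <= X)%N ->
  ((X - 2 * n * K) ^ n <=
     #|[set B : {ffun 'I_n -> 'I_X} | phi (box_vec B) == tau]| * #|T|)%N.
Proof.
move=> KX; set S := [set _ | _]; pose Y := (X - 2 * n * K)%N.
have [rep hrep] := small_representative_fun.
pose sh Q : 'rV_n := box_vec (Q : {ffun 'I_n -> 'I_Y}) + const_mx (n * K)%:Z.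
have h Q : exists B : {ffun 'I_n -> 'I_X},
    box_vec B == sh Q + rep (tau - phi (sh Q)).
  have [|B EB] := @box_vecP n X (sh Q + rep (tau - phi (sh Q))).
    move=> i; have [_ /(_ i)] := hrep (tau - phi (sh Q)).
    have : (Q i + 2 * (n * K) < X)%N by have := ltn_ord (Q i); rewrite /Y; lia.
    rewrite !mxE; set m := (n * K)%N.
    by move: (nat_of_ord (Q i)) (rep _ _ _); lia.
  by exists B; rewrite EB.
pose f Q := (xchoose (h Q), tau - phi (sh Q)).
have fE Q : box_vec (f Q).1 = sh Q + rep (f Q).2 by exact/eqP/(xchooseP (h Q)).
rewrite -/Y -cardsT -cardsX.
have <- : #|{ffun 'I_n -> 'I_Y}| = (Y ^ n)%N by rewrite card_ffun !card_ord.
rewrite -(@card_imset _ _ f).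
  apply/subset_leq_card/subsetP => _ /imsetP[Q _ ->]; rewrite !inE andbT.
  by rewrite fE raddfD /= (hrep _).1 addrC subrK.
move=> Q Q' E; have := congr1 (@box_vec _ _) (congr1 fst E).
by rewrite !fE E => /addIr/addIr/box_vec_inj.
Qed.
End Fibers.

Lemma pigeonhole (T T' : finType) (f : T -> T') :
  (#|T'| < #|T|)%N -> exists x y, x != y /\ f x = f y.
Proof.
move=> h; have /injectivePn[x [y xy E]] : ~~ injectiveb f.
  by apply/injectiveP => /leq_card; rewrite leqNgt h.
by exists x, y.
Qed.

(** * The companion matrix and multiplication in Z[X]/(g) *)

Section Companion.
Variables (R : comNzRingType) (n : nat).
Implicit Types (g p : {poly R}) (v : 'rV[R]_n.+1).

(** Acting on row vectors from the right, this is multiplication by X on coefficient vectors modulo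
    [g]. *)
Definition comp_mx g : 'M[R]_n.+1 :=
  \matrix_(i, j) if i == ord_max then - g`_j else (i.+1 == j)%:R.

Lemma rVpoly_comp g v : g \is monic -> size g = n.+2 ->
  rVpoly (v *m comp_mx g) = 'X * rVpoly v - v 0 ord_max *: g.
Proof.
move=> gm sg; apply/polyP => k; rewrite coefB coefXM coefZ.
have [kn|kn] := ltnP k n.+1; last first.
  rewrite nth_default ?(leq_trans (size_poly _ _)) //.
  move: kn; rewrite leq_eqVlt => /predU1P[<-|kn] /=.
    have -> : g`_n.+1 = 1 by have /monicP := gm; rewrite lead_coefE sg.
    by have /= -> := coef_rVpoly_ord v ord_max; rewrite mulr1 subrr.
  rewrite [g`_k]nth_default ?sg // mulr0 subr0.
  by case: k kn => //= k kn; rewrite nth_default // (leq_trans (size_poly _ _)).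
have /= -> := coef_rVpoly_ord (v *m comp_mx g) (Ordinal kn).
rewrite mxE (bigD1 ord_max) //=.
rewrite mxE eqxx /= mulrN addrC; congr (_ - _).
case: k kn => [|k] kn /=.
  by rewrite big1 // => i /negPf ni; rewrite mxE ni mulr0.
have kn' : (k < n.+1)%N by apply: leq_trans kn.
rewrite (bigD1 (Ordinal kn')) /=; last by rewrite -val_eqE /= neq_ltn -ltnS kn.
rewrite mxE -val_eqE /= eqn_leq [(n <= k)%N]leqNgt -[(k < n)%N]ltnS kn andbF eqxx mulr1.
rewrite big1 => [|i /andP[/negPf ni nk]].
  by have /= -> := coef_rVpoly_ord v (Ordinal kn'); rewrite addr0.
rewrite mxE ni eqSS; case: eqP => [E|]; last by rewrite mulr0.
by case/eqP: nk; apply/val_inj.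
Qed.

Lemma rVpoly_mul_comp g p v : g \is monic -> size g = n.+2 ->
  exists q, rVpoly (v *m horner_mx (comp_mx g) p) = rVpoly v * p + q * g.
Proof.
move=> gm sg; elim/poly_ind: p => [|p c [q IH]].
  by exists 0; rewrite raddf0 mulmx0 raddf0 mulr0 mul0r addr0.
have -> : horner_mx (comp_mx g) (p * 'X + c%:P) =
    horner_mx (comp_mx g) p *m comp_mx g + c%:M.
  by rewrite rmorphD rmorphM /= horner_mx_X horner_mx_C.
rewrite mulmxDr mulmxA mul_mx_scalar raddfD /= rVpoly_comp // IH [rVpoly (c *: v)]linearZ /=.
set a := _ 0 ord_max; exists ('X * q - a%:P).
rewrite -!mul_polyC; ring.
Qed.

Lemma monic_mul_eq0 g q : g \is monic -> (size (q * g)%R < size g)%N -> q = 0.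
Proof.
move=> gm; have [-> //|q0] := eqVneq q 0.
rewrite size_Mmonic // => H; have := size_poly_gt0 q; rewrite q0; lia.
Qed.

(** ['e_0] is the coefficient vector of 1. Both sides have degree below that of [g] and differ by a
    multiple of [g]. *)
Lemma horner_comp_e0 g p : g \is monic -> size g = n.+2 -> (size p <= n.+1)%N ->
  rVpoly ('e_0 *m horner_mx (comp_mx g) p) = p.
Proof.
move=> gm sg sp; have [q] := rVpoly_mul_comp p 'e_0 gm sg.
rewrite rVpoly_delta expr0 mul1r => E.
suff q0 : q = 0 by rewrite E q0 mul0r addr0.
apply: (monic_mul_eq0 gm).
have -> : q * g = rVpoly ('e_0 *m horner_mx (comp_mx g) p) - p.
  by rewrite E addrC addKr.
rewrite sg ltnS (leq_trans (size_polyD _ _)) // geq_max size_polyN sp andbT.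
exact: size_poly.
Qed.

Lemma horner_comp_row0 g v : g \is monic -> size g = n.+2 ->
  'e_0 *m horner_mx (comp_mx g) (rVpoly v) = v.
Proof.
move=> gm sg; apply: (can_inj rVpolyK).
by rewrite horner_comp_e0 // size_poly.
Qed.

Lemma delta_comp g (i : 'I_n.+1) : g \is monic -> size g = n.+2 ->
  'e_0 *m comp_mx g ^+ i = 'e_i :> 'rV_n.+1.
Proof.
move=> gm sg; rewrite -(horner_comp_row0 'e_i gm sg) rVpoly_delta.
by rewrite rmorphXn /= horner_mx_X.
Qed.

Lemma horner_comp_row g v (i : 'I_n.+1) : g \is monic -> size g = n.+2 ->
  row i (horner_mx (comp_mx g) (rVpoly v)) = v *m comp_mx g ^+ i.
Proof.
move=> gm sg; rewrite rowE -(delta_comp i gm sg) -{2}(horner_comp_row0 v gm sg).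
rewrite -!mulmxA; congr (_ *m _); rewrite !mulmxE; apply/commr_sym/commrX/commr_sym.
exact: comm_mx_horner.
Qed.

Lemma horner_comp_self g : g \is monic -> size g = n.+2 ->
  horner_mx (comp_mx g) g = 0.
Proof.
move=> gm sg; apply/row_matrixP => i; rewrite row0 rowE -(delta_comp i gm sg).
suff E : 'e_0 *m horner_mx (comp_mx g) g = 0 :> 'rV_n.+1.
  rewrite -mulmxA mulmxE (_ : _ * _ = horner_mx (comp_mx g) g * comp_mx g ^+ i).
    by rewrite -mulmxE mulmxA E mul0mx.
  by apply: commr_sym; apply: commrX; apply: commr_sym; exact: comm_mx_horner.
have [q] := rVpoly_mul_comp g 'e_0 gm sg.
rewrite rVpoly_delta expr0 mul1r -[X in X + _]mul1r -mulrDl => Eq.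
apply: (can_inj rVpolyK); rewrite Eq (_ : 1 + q = 0) ?mul0r ?raddf0 //.
by apply: (monic_mul_eq0 gm); rewrite -Eq sg ltnS size_poly.
Qed.

End Companion.

Lemma map_comp_mx (R S : comNzRingType) (f : {rmorphism R -> S}) n (g : {poly R}) :
  map_mx f (comp_mx n g) = comp_mx n (map_poly f g).
Proof.
apply/matrixP => i j; rewrite !mxE coef_map.
by case: ifP; rewrite ?rmorphN ?rmorph_nat.
Qed.

(** Evaluating a Bezout relation u g + v p = c at the companion matrix, which kills [g], inverts the
    matrix up to the nonzero scalar c. *)
Lemma det_horner_comp_coprime (F : fieldType) n (g p : {poly F}) :
  g \is monic -> size g = n.+2 -> coprimep g p ->
  \det (horner_mx (comp_mx n g) p) != 0.
Proof.
move=> gm sg /Bezout_coprimepP[[u v] /= /eqp_size]; rewrite size_poly1.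
move=> /eqP/size_poly1P[c c0 E].
have := congr1 (horner_mx (comp_mx n g)) E.
rewrite rmorphD !rmorphM /= horner_comp_self // mulr0 add0r horner_mx_C -mulmxE.
move=> /(congr1 determinant); rewrite det_mulmx det_scalar => Ed.
apply: contraNneq c0 => d0; move: Ed; rewrite d0 mulr0 => /esym/eqP.
by rewrite expf_eq0.
Qed.

(** * Lifting common roots from p to p^2 *)

Section ModPrimeSquare.
Variables (p : nat) (p_pr : prime p) (n : nat).

Lemma dvdz_Fp (a : int) : (p %| a)%Z = (a%:~R == 0 :> 'F_p).
Proof. exact/dvdz_pcharf/pchar_Fp. Qed.

Lemma Fp_lift (x : 'F_p) : ((val x)%:Z)%:~R = x.
Proof. exact: natr_Zp. Qed.

Lemma dvdz_cV_modp (u : 'cV[int]_n.+1) :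
  map_mx intr u = 0 :> 'cV['F_p]_n.+1 <-> forall i, (p %| u i 0%R)%Z.
Proof.
split => [E i|h].
  by rewrite dvdz_Fp; have := congr1 (fun v : 'cV_n.+1 => v i 0) E; rewrite !mxE => ->.
by apply/colP => i; rewrite !mxE; apply/eqP; rewrite -dvdz_Fp.
Qed.

Lemma dvdz_det_kernel (M : 'M[int]_n.+1) : (p %| \det M)%Z ->
  exists2 z : 'cV['F_p]_n.+1, z != 0 & map_mx intr M *m z = 0.
Proof.
rewrite dvdz_Fp -det_map_mx -det_tr => /det0P[v v0 E].
exists v^T; first by apply: contraNneq v0 => /(congr1 trmx); rewrite trmxK trmx0 => ->.
by apply: trmx_inj; rewrite trmx_mul trmxK E trmx0.
Qed.

Variable M : 'M[int]_n.+1.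
Hypothesis kerM : forall z : 'cV['F_p]_n.+1,
  map_mx intr M *m z = 0 -> z 0 0 = 0 -> z = 0.

(* Lifting a kernel vector of [M] from [p] to [p ^ 2]: replacing the first column of [M]
   by [M v / p] leaves a determinant still divisible by [p], and a kernel vector of
   the new matrix gives the correction to [v]. *)
Lemma kernel_mod_square : (p%:Z ^+ 2 %| \det M)%Z ->
  exists w : 'cV[int]_n.+1, w 0 0 = 1 /\ forall i, (p%:Z ^+ 2 %| (M *m w)%R i 0%R)%Z.
Proof.
move=> dM.
have p0 : p%:Z != 0 by have := prime_gt0 p_pr; lia.
have [z z0 Mz] : exists2 z : 'cV['F_p]_n.+1, z != 0 & map_mx intr M *m z = 0.
  by apply: dvdz_det_kernel; apply: dvdz_trans dM; rewrite dvdz_exp.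
have z00 : z 0 0 != 0 by apply: contraNneq z0 => /(kerM Mz) ->.
pose v : 'cV[int]_n.+1 := \col_i if i == 0 then 1 else (val (z i 0 / z 0 0))%:Z.
have redv : map_mx intr v = (z 0 0)^-1 *: z.
  apply/colP => i; rewrite !mxE; case: eqP => [->|_]; first by rewrite mulVf.
  by rewrite Fp_lift mulrC.
have /dvdz_cV_modp dMv : map_mx intr (M *m v) = 0 :> 'cV['F_p]_n.+1.
  by rewrite map_mxM redv -scalemxAr Mz scaler0.
have v0 : v 0 0 = 1 by rewrite mxE eqxx.
pose u := map_mx (fun a => (a %/ p)%Z) (M *m v).
have uE : M *m v = p%:Z *: u.
  by apply/colP => i; rewrite [RHS]mxE [u _ _]mxE mulrC divzK.
clearbody u; pose M' := \matrix_(i, j) if j == 0 then u i 0 else M i j.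
have dM' : \det M = p%:Z * \det M'.
  (* [P] is lower triangular with unit diagonal and first column [v], so [M *m P] is [M] with its
     first column replaced by M v = p u. *)
  pose P : 'M[int]_n.+1 := \matrix_(i, j) if j == 0 then v i 0 else (i == j)%:R.
  pose d : 'rV[int]_n.+1 := \row_j if j == 0 then p%:Z else 1.
  have dP : \det P = 1.
    rewrite det_trig; first by rewrite big1 // => i _; rewrite mxE eqxx; case: eqP => [->|].
    apply/is_trig_mxP => i j ij; rewrite mxE; case: eqP => [j0|_].
      by move: ij; rewrite j0.
    by rewrite -val_eqE /= ltn_eqF.
  have dd : \det (diag_mx d) = p%:Z.
    rewrite det_diag big_ord_recl mxE eqxx big1 ?mulr1 // => i _.
    by rewrite mxE.
  have E : M *m P = M' *m diag_mx d.
    apply/matrixP => i j; rewrite mul_mx_diag [LHS]mxE [RHS]mxE [d _ _]mxE [M' _ _]mxE.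
    have [->|j0] := eqVneq j 0.
      rewrite -[LHS]/(\sum_k M i k * P k 0).
      have -> : u i 0 * p%:Z = (M *m v) i 0 by rewrite uE [RHS]mxE mulrC.
      by rewrite mxE; apply: eq_bigr => k _; rewrite mxE eqxx. 
    rewrite mulr1 (bigD1 j) //= [P j j]mxE (negPf j0) eqxx mulr1 big1 ?addr0 // => k /negPf kj.
    by rewrite mxE (negPf j0) kj mulr0.
  by have := congr1 determinant E; rewrite !det_mulmx dP dd mulr1 mulrC.
have {}dM' : (p %| \det M')%Z.
  by move: dM; rewrite dM' expr2 dvdz_mul2l // (negPf p0).
have [y y0 M'y] := dvdz_det_kernel dM'.
pose yt : 'cV['F_p]_n.+1 := \col_i if i == 0 then 0 else y i 0.
have M'yE : map_mx intr M' *m y = y 0 0 *: map_mx intr u + map_mx intr M *m yt.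
  apply/colP => i; rewrite !mxE big_ord_recl [in RHS]big_ord_recl !mxE /= mulr0 add0r.
  rewrite mulrC; congr (_ + _); apply: eq_bigr => k _; by rewrite !mxE.
(* If this coordinate vanished, [y] would be a nonzero kernel vector of [M] itself with first
   coordinate 0, against [kerM]. *)
have y00 : y 0 0 != 0.
  apply: contraNneq y0 => y00; rewrite [y](_ : _ = yt).
    apply/eqP/kerM; last by rewrite mxE eqxx.
    by move: M'yE; rewrite M'y y00 scale0r add0r => <-.
  by apply/colP => i; rewrite mxE; case: eqP => [->|].
pose q : 'cV[int]_n.+1 := \col_i if i == 0 then 0 else (val (y i 0 / y 0 0))%:Z.
have redq : map_mx intr q = (y 0 0)^-1 *: yt.
  apply/colP => i; rewrite !mxE; case: eqP => _; first by rewrite mulr0.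
  by rewrite Fp_lift mulrC.
exists (v + p%:Z *: q); split => [|i]; first by rewrite !mxE eqxx mulr0 addr0.
rewrite mulmxDr uE -scalemxAr -scalerDr mxE expr2 dvdz_mul2l //.
move: i; apply/dvdz_cV_modp; rewrite map_mxD map_mxM redq -scalemxAr.
apply: (scalerI y00); rewrite scalerDr scalerA mulfV // scale1r scaler0.
by rewrite -M'yE M'y.
Qed.

End ModPrimeSquare.

Lemma comp_mx_col (R : comNzRingType) n (g : {poly R}) (z : 'cV[R]_n.+1) (i : 'I_n.+1)
    (j : 'I_n.+1) : i.+1 = j -> (comp_mx n g *m z) i 0 = z j 0.
Proof.
move=> ij; have ni : (i == ord_max) = false.
  by rewrite -val_eqE /=; have := ltn_ord j; lia.
rewrite mxE (bigD1 j) //= mxE ni ij eqxx mul1r big1 ?addr0 // => k kj.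
by rewrite mxE ni ij (_ : (j == k :> nat) = false) ?mul0r //; apply/negbTE; rewrite eq_sym.
Qed.

(** On columns the companion matrix shifts the coordinates, so an eigenvector for [r] is its first
    coordinate times (1, r, r^2, ...). *)
Lemma comp_mx_eigen (F : comNzRingType) n (g : {poly F}) (r : F) (z : 'cV[F]_n.+1) :
  comp_mx n g *m z = r *: z -> z 0 0 = 0 -> z = 0.
Proof.
move=> Cz z0; apply/colP => -[i lt_i]; rewrite [RHS]mxE.
elim: i lt_i => [|i IH] lt_i.
  by rewrite -[RHS]z0; congr (z _ _); apply/val_inj.
rewrite -(@comp_mx_col _ _ g z (Ordinal (ltnW lt_i))) // Cz mxE.
by rewrite IH mulr0.
Qed.

(** An eigenvector of [C] modulo [m] is one of every polynomial in [C]; the congruence is written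
    with an explicit multiple of [m]. *)
Lemma horner_mx_approx_eigen n (C : 'M[int]_n.+1) (m r : int) (w : 'cV[int]_n.+1) :
  (exists y, C *m w = r *: w + m *: y) ->
  forall q : {poly int}, exists y, horner_mx C q *m w = q.[r] *: w + m *: y.
Proof.
move=> [y Cw]; elim/poly_ind => [|q c [x IH]].
  by exists 0; rewrite raddf0 mul0mx hornerC scale0r scaler0 addr0.
have -> : horner_mx C (q * 'X + c%:P) = C *m horner_mx C q + c%:M.
  rewrite rmorphD rmorphM /= horner_mx_X horner_mx_C; congr (_ + _).
  by rewrite mulmxE; apply/commr_sym/comm_mx_horner.
exists (q.[r] *: y + C *m x).
rewrite mulmxDl -mulmxA IH mulmxDr -!scalemxAr Cw mul_scalar_mx hornerMXaddC.
by rewrite !scalerDr scalerDl !scalerA [m * _]mulrC -!addrA; congr (_ + _);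
  rewrite [RHS]addrC -addrA.
Qed.

Section Dichotomy.
Variables (n : nat) (g : {poly int}) (p : nat) (v : 'rV[int]_n.+2).
Hypotheses (p_pr : prime p) (gm : g \is monic) (sg : size g = n.+3).
Let C := comp_mx n.+1 g.
Let M := horner_mx C (rVpoly v).
Local Notation rd := (intr : int -> 'F_p).
Let gp := map_poly rd g.
Let vp := map_poly rd (rVpoly v).

Lemma map_intr_root (q : {poly int}) (r : 'F_p) :
  root (map_poly rd q) r = (p %| q.[(val r)%:Z])%Z.
Proof. by rewrite dvdz_Fp // -horner_map /= Fp_lift. Qed.

(** Since the gcd is linear, the kernel of [M] modulo p consists of eigenvectors of [C], so a kernel
    vector is determined by its first coordinate. This yields w with first coordinate 1 and M w = 0
    modulo p^2. The vector z = C w - s0 w has first coordinate 0, and M z = 0 modulo p^2 because M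
    commutes with C; using the kernel twice gives p^2 | z. Thus w is an eigenvector of [C] modulo
    p^2, and its eigenvalue is a root there of both g, as g(C) = 0, and v, as M = v(C). *)
Lemma norm_dvd_prime_square r : gcdp gp vp %= 'X - r%:P -> (p%:Z ^+ 2 %| \det M)%Z ->
  exists2 s : nat, (s < p ^ 2)%N &
    (p%:Z ^+ 2 %| g.[s%:Z])%Z /\ (p%:Z ^+ 2 %| (rVpoly v).[s%:Z])%Z.
Proof.
move=> gcd_r dM.
have p0 : p%:Z != 0 by have := prime_gt0 p_pr; lia.
have gpm : gp \is monic by exact: monic_map.
have sgp : size gp = n.+3 by rewrite size_map_poly_id0 // (monicP gm) oner_eq0.
have kerM (z : 'cV['F_p]_n.+2) : map_mx rd M *m z = 0 -> z 0 0 = 0 -> z = 0.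
  move=> Mz z0; have [[a b] /= E] := Bezoutp gp vp.
  have /eqpP[[c d] /= /andP[c0 d0] {}E] := eqp_trans E gcd_r.
  have := congr1 (horner_mx (comp_mx n.+1 gp)) E.
  rewrite !linearZ rmorphD !rmorphM /= horner_comp_self // mulr0 add0r.
  rewrite rmorphB /= horner_mx_X horner_mx_C => /(congr1 (mulmx^~ z)).
  have -> : horner_mx (comp_mx n.+1 gp) vp = map_mx rd M.
    by rewrite map_horner_mx map_comp_mx.
  rewrite -!scalemxAl -mulmxE -mulmxA Mz mulmx0 scaler0 => /esym/eqP.
  rewrite scaler_eq0 (negPf d0) /= mulmxBl mul_scalar_mx subr_eq0 => /eqP Cz.
  exact: comp_mx_eigen Cz z0.
have [w [w0 Mw]] := kernel_mod_square p_pr kerM dM.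
pose z := C *m w - (C *m w) 0 0 *: w.
have z0 : z 0 0 = 0 by rewrite !mxE w0 mulr1 subrr.
have dMz i : (p%:Z ^+ 2 %| (M *m z)%R i 0%R)%Z.
  have -> : M *m z = C *m (M *m w) - (C *m w) 0 0 *: (M *m w).
    rewrite mulmxBr -scalemxAr !mulmxA; congr (_ *m _ - _).
    by apply/commr_sym/comm_mx_horner.
  have dC : (p%:Z ^+ 2 %| (C *m (M *m w)) i 0%R)%Z.
    by rewrite mxE rpred_sum // => k _; rewrite dvdz_mull.
  by rewrite mxE rpredD // mxE rpredN mxE dvdz_mull.
have dvd_p i : (p %| (M *m z)%R i 0%R)%Z.
  by apply: dvdz_trans (dMz i); rewrite dvdz_exp.
have /(dvdz_cV_modp p_pr) dz : map_mx rd z = 0.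
  apply: kerM; last by rewrite mxE z0.
  by rewrite -map_mxM; apply/(dvdz_cV_modp p_pr).
pose z' := map_mx (fun a => (a %/ p)%Z) z.
have zE : z = p%:Z *: z'.
  by apply/colP => i; rewrite [RHS]mxE [z' _ _]mxE mulrC divzK.
have /(dvdz_cV_modp p_pr) dz' : map_mx rd z' = 0.
  apply: kerM; last by rewrite mxE [z' _ _]mxE z0 div0z.
  rewrite -map_mxM; apply/(dvdz_cV_modp p_pr) => i.
  by have := dMz i; rewrite zE -scalemxAr mxE expr2 dvdz_mul2l.
pose y := map_mx (fun a => (a %/ p)%Z) z'.
have z'E : z' = p%:Z *: y.
  by apply/colP => i; rewrite [RHS]mxE [y _ _]mxE mulrC divzK.
pose m : int := p%:Z ^+ 2; pose s0 := (C *m w) 0 0; pose s := (s0 %% m)%Z.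
have m0 : m != 0 by rewrite expf_neq0.
have sE : `|s|%N%:Z = s by rewrite gez0_abs ?modz_ge0.
have Cw : exists y, C *m w = s *: w + m *: y.
  exists ((s0 %/ m)%Z *: w + y).
  have -> : C *m w = s0 *: w + z by rewrite /z addrC subrK.
  rewrite {1}(divz_eq s0 m) -/s zE z'E scalerA -expr2 -/m scalerDr scalerA.
  by rewrite scalerDl [m * _]mulrC addrCA addrA.
exists `|s|%N.
  by rewrite -ltz_nat sE (_ : (p ^ 2)%N%:Z = `|m|) ?ltz_mod.
rewrite sE; split.
  have [x] := horner_mx_approx_eigen Cw g; rewrite horner_comp_self // mul0mx.
  move=> /(congr1 (fun u : 'cV_n.+2 => u 0 0)); rewrite !mxE w0 mulr1 => /esym/eqP.
  by rewrite addr_eq0 => /eqP ->; rewrite rpredN dvdz_mulr.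
have [x] := horner_mx_approx_eigen Cw (rVpoly v).
move=> /(congr1 (fun u : 'cV_n.+2 => u 0 0)).
rewrite [in RHS]mxE [in RHS]mxE w0 mulr1 => /eqP; rewrite -subr_eq => /eqP <-.
by rewrite rpredB // ?Mw // mxE dvdz_mulr.
Qed.

(** The gcd of [g] and [v] modulo p is not constant, for the determinant would otherwise be nonzero
    modulo p. Degree at least 2 is the first alternative. Degree 1 gives a root, and the second
    power of p is then controlled by [norm_dvd_prime_square]. *)
Lemma norm_dvd_prime : (p %| \det M)%Z ->
  (exists h : {poly 'F_p}, [/\ h \is monic, (2 < size h <= n.+3)%N, h %| gp & h %| vp]) \/
  (exists2 r : nat, (r < p)%N & (p %| g.[r%:Z])%Z /\ (p %| (rVpoly v).[r%:Z])%Z) /\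
  ((p%:Z ^+ 2 %| \det M)%Z -> exists2 s : nat, (s < p ^ 2)%N &
    (p%:Z ^+ 2 %| g.[s%:Z])%Z /\ (p%:Z ^+ 2 %| (rVpoly v).[s%:Z])%Z).
Proof.
move=> dM.
have gpm : gp \is monic by exact: monic_map.
have gp0 := monic_neq0 gpm.
have sgp : size gp = n.+3 by rewrite size_map_poly_id0 // (monicP gm) oner_eq0.
pose d := gcdp gp vp.
have d0 : d != 0 by rewrite gcdp_eq0 (negPf gp0).
pose h := (lead_coef d)^-1 *: d.
have hd : h %= d by rewrite eqp_scale // invr_eq0 lead_coef_eq0.
have hm : h \is monic by rewrite monicE lead_coefZ mulVf ?lead_coef_eq0.
have sh : size h = size d by rewrite size_scale // invr_eq0 lead_coef_eq0.
have hg : h %| gp by rewrite (eqp_dvdl _ hd) dvdp_gcdl.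
have hv : h %| vp by rewrite (eqp_dvdl _ hd) dvdp_gcdr.
have [h2|h2] := ltnP 2 (size h).
  by left; exists h; split; rewrite ?h2 // -sgp dvdp_leq.
right.
have h1 : size h != 1%N.
  apply: contraL dM; rewrite sh => cop; rewrite dvdz_Fp // -det_map_mx.
  rewrite map_horner_mx map_comp_mx; exact: det_horner_comp_coprime.
have h0 : (0 < size h)%N by rewrite size_poly_gt0 monic_neq0.
have {h0 h1}h2 : size h = 2 by clear -h0 h1 h2; lia.
have hE : h = 'X - (- h`_0)%:P.
  have h11 : h`_1 = 1 by have := monicP hm; rewrite lead_coefE h2.
  apply/polyP => -[|[|k]]; rewrite coefB coefX coefC /=.
  - by rewrite sub0r opprK.
  - by rewrite h11 subr0.
  - by rewrite subr0 nth_default ?h2.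
set r := - h`_0 in hE.
split; last by apply: (@norm_dvd_prime_square r); rewrite -hE eqp_sym.
have lt_r : (val r < p)%N by have := ltn_ord r; rewrite [X in (_ < X)%N]Fp_cast.
exists (val r) => //; rewrite -!map_intr_root !root_factor_theorem.
by rewrite -hE.
Qed.

End Dichotomy.

(** * The norm form and the ideals of Z[X]/(g) *)

Lemma det_le n (M : 'M[int]_n) (L : nat) : (forall i j, `|M i j| <= L%:Z) ->
  `|\det M| <= Posz (n`! * L ^ n).
Proof.
move=> bM; apply: le_trans (ler_norm_sum _ _ _) _.
have -> : Posz (n`! * L ^ n) = \sum_(s : perm.perm_of 'I_n) Posz (L ^ n).
  by rewrite sumr_const card_Sn -mulr_natl natz PoszM.
apply: ler_sum => s _; rewrite normrM normr_sign mul1r normr_prod.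
have -> : Posz (L ^ n) = \prod_(i < n) L%:Z.
  by rewrite prodr_const card_ord -!natz natrX.
by apply: ler_prod => i _; rewrite normr_ge0 bM.
Qed.

Section NormMatrix.
Variables (n : nat) (g : {poly int}).
Hypotheses (gm : g \is monic) (sg : size g = n.+2).
Hypothesis irr_g : forall q : {poly rat}, q != 0 -> (size q <= n.+1)%N ->
  coprimep (map_poly intr g) q.
Implicit Types v : 'rV[int]_n.+1.

(** Row i holds the coefficients of v X^i modulo [g]; the rows span the principal ideal of v, and
    the determinant is the norm of v. *)
Definition mul_mx v : 'M[int]_n.+1 := horner_mx (comp_mx n g) (rVpoly v).

Lemma det_mul_mx_neq0 v : v != 0 -> \det (mul_mx v) != 0.
Proof.
move=> v0; rewrite -(intr_eq0 rat) -det_map_mx map_horner_mx map_comp_mx.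
apply: det_horner_comp_coprime.
- exact: monic_map.
- by rewrite size_map_poly_id0 // (monicP gm) oner_eq0.
apply: irr_g.
  rewrite -size_poly_eq0 size_map_inj_poly ?size_poly_eq0 //; last exact: intr_inj.
  by apply: contraNneq v0 => E; rewrite -(rVpolyK v) E raddf0.
by apply: leq_trans (size_poly _ _) _; exact: size_poly.
Qed.

(** Row i of [mul_mx v] is v C^i, whose entries are bounded by a column sum of |C^i|. Adding all
    entries of all these powers bounds every such sum at once. *)
Definition mul_mx_const : nat :=
  \sum_(i < n.+1) \sum_(k < n.+1) \sum_(j < n.+1) `|(comp_mx n g ^+ i) k j|%N.

Lemma mul_mx_entry_le v (K : nat) : (forall i, `|v 0 i| <= K%:Z) ->
  forall i j, `|mul_mx v i j| <= (mul_mx_const * K)%:Z.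
Proof.
move=> bv i j.
have -> : mul_mx v i j = (v *m comp_mx n g ^+ i) 0 j.
  by rewrite -horner_comp_row // [RHS]mxE.
rewrite mxE; apply: le_trans (ler_norm_sum _ _ _) _.
apply: (@le_trans _ _ (\sum_(k < n.+1) `|(comp_mx n g ^+ i) k j|%N * K)%N%:Z).
  rewrite -natz natr_sum; apply: ler_sum => k _.
  by rewrite normrM natz PoszM mulrC; apply: ler_pM; rewrite ?normr_ge0 ?abszE.
rewrite lez_nat -big_distrl leq_mul2r; apply/orP; right.
rewrite /mul_mx_const [X in (_ <= X)%N](bigD1 i) //=; apply: leq_trans (leq_addr _ _).
by apply: leq_sum => k _; rewrite (bigD1 j) //= leq_addr.
Qed.

Section Ideal.
Variables (T : finZmodType) (phi : {additive 'rV[int]_n.+1 -> T}).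
Hypotheses (phi_onto : forall tau, exists v, phi v = tau)
  (phi_stable : forall v, phi v = 0 -> phi (v *m comp_mx n g) = 0).

(** A kernel stable under multiplication by X is an ideal, so it contains all multiples of each of
    its elements. *)
Lemma mul_mx_ideal v (q : 'rV[int]_n.+1) : phi v = 0 -> phi (q *m mul_mx v) = 0.
Proof.
move=> v0; rewrite mulmx_sum_row raddf_sum big1 // => i _.
have phiZ (z : int) w : phi w = 0 -> phi (z *: w) = 0.
  by move=> w0; rewrite -[z]intz scaler_int raddfMz w0 mul0rz.
apply: phiZ; rewrite horner_comp_row //.
elim: (i : nat) => [|k IH]; first by rewrite expr0 mulmx1.
by rewrite exprSr -mulmxE mulmxA phi_stable.
Qed.

Variable D : nat.
Hypothesis D_inj : forall x : T, x *+ D = 0 -> x = 0.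

(* The elements [1 + D B]: their norms are prime to [D], which later removes all the
   primes up to any fixed bound. *)
Definition shifted_vec X (B : {ffun 'I_n.+1 -> 'I_X}) : 'rV[int]_n.+1 :=
  'e_0 + box_vec B *+ D.

Lemma shifted_vecE X (B : {ffun 'I_n.+1 -> 'I_X}) i :
  shifted_vec B 0 i = ((i == 0%R) + D * B i)%N%:Z.
Proof.
rewrite mxE mulmxnE !mxE eqxx /= PoszD; congr (_ + _).
  by rewrite -natz.
by rewrite -mulr_natr natz -PoszM mulnC.
Qed.

Let S X := [set B : {ffun 'I_n.+1 -> 'I_X} | phi (shifted_vec B) == 0].

(** The condition reads phi(e_0) + D phi(B) = 0, which determines phi(B) as multiplication by [D] is
    injective on [T]. *)
Let S_fiber X B B' : B \in S X -> B' \in S X -> phi (box_vec B) = phi (box_vec B').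
Proof.
rewrite !inE => /eqP E /eqP; rewrite -E => /eqP.
rewrite !raddfD /= (inj_eq (addrI _)) !raddfMn /= eq_sym -subr_eq0 -mulrnBl => /eqP.
by move/D_inj/eqP; rewrite subr_eq0 => /eqP.
Qed.

(** The short element is the difference of two vectors with entries in [0, L] in the same class,
    found by pigeonhole. Its norm is nonzero, so its multiples form a lattice of full rank inside
    the ideal. *)
Lemma ideal_count_le X L : (#|T| < L.+1 ^ n.+1)%N ->
  (#|S X| * #|T| <= (X + 2 * n.+1 * (mul_mx_const * L)) ^ n.+1)%N.
Proof.
move=> TL; have [|B [B' [BB' E]]] :=
  @pigeonhole {ffun 'I_n.+1 -> 'I_L.+1} T (fun B => phi (box_vec B)).
  by rewrite card_ffun !card_ord.
pose v := box_vec B - box_vec B'.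
have v0 : v != 0 by rewrite subr_eq0; apply: contraNneq BB' => /box_vec_inj ->.
apply: (@card_fiber_le _ _ phi (mul_mx v)) => //.
- by move=> q; apply: mul_mx_ideal; rewrite raddfB /= E subrr.
- exact: det_mul_mx_neq0.
- apply: mul_mx_entry_le => i; rewrite !mxE.
  by have := ltn_ord (B i); have := ltn_ord (B' i);
    move: (nat_of_ord (B i)) (nat_of_ord (B' i)) => a b; lia.
- exact: S_fiber.
Qed.

(* An element of the set itself serves as the short vector. *)
Lemma ideal_count_le_crude X :
  (#|S X| * #|T| <= (X + 2 * n.+1 * (mul_mx_const * (D * X + 1))) ^ n.+1)%N.
Proof.
have [->|[B SB]] := set_0Vmem (S X); first by rewrite cards0 mul0n.
apply: (@card_fiber_le _ _ phi (mul_mx (shifted_vec B))) => //.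
- by move=> q; apply: mul_mx_ideal; move: SB; rewrite inE => /eqP.
- apply: det_mul_mx_neq0; apply/eqP => /rowP/(_ 0).
  by rewrite shifted_vecE eqxx mxE => -[].
- apply: mul_mx_entry_le => i; rewrite shifted_vecE.
  by rewrite ger0_norm // lez_nat addnC leq_add ?leq_b1 // leq_mul // ltnW.
- exact: S_fiber.
Qed.

End Ideal.
End NormMatrix.

(** * Ideals attached to roots and factors of g modulo p *)

Lemma dvdz_Zp (q : nat) (a : int) : (1 < q)%N -> (q %| a)%Z = (a%:~R == 0 :> 'Z_q).
Proof.
move=> q1; have q0 : q%:Z != 0 by lia.
rewrite {2}(divz_eq a q) intrD intrM -[(Posz q)%:~R]/(q%:R) pchar_Zp // mulr0 add0r.
have -> : (a %% q)%Z = `|(a %% q)%Z|%N%:Z by rewrite gez0_abs ?modz_ge0.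
rewrite -[_%:~R]/(_%:R) -val_eqE /= val_Zp_nat // modn_small; last first.
  by rewrite -ltz_nat gez0_abs ?modz_ge0 //; have := ltz_mod a q0; lia.
by rewrite absz_eq0; apply/dvdz_mod0P/eqP.
Qed.

Section EvalMod.
Variables (n q : nat) (r : int).
(** When [q] divides g(r), the kernel is the ideal generated by q and X - r, of index q. It serves
    for q = p and for q = p^2. *)
Definition eval_mod (v : 'rV[int]_n.+1) : 'Z_q := ((rVpoly v).[r])%:~R.
Lemma eval_mod_is_additive : zmod_morphism eval_mod.
Proof. by move=> u v; rewrite /eval_mod raddfB /= hornerD hornerN intrB. Qed.
HB.instance Definition _ := GRing.isZmodMorphism.Build _ _ eval_mod eval_mod_is_additive.
End EvalMod.

Section RemMod.
Variables (n p : nat) (h : {poly 'F_p}).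
(** When [h] divides g modulo p, the kernel is the ideal generated by p and h, of index p to the
    degree of h. *)
Definition rem_mod (v : 'rV[int]_n.+1) : 'rV['F_p]_(size h).-1 :=
  poly_rV (map_poly intr (rVpoly v) %% h).
Lemma rem_mod_is_additive : zmod_morphism rem_mod.
Proof. by move=> u v; rewrite /rem_mod !raddfB /= modpD modpN raddfB. Qed.
HB.instance Definition _ := GRing.isZmodMorphism.Build _ _ rem_mod rem_mod_is_additive.
End RemMod.

Section Counts.
Variables (n : nat) (g : {poly int}).
Hypotheses (gm : g \is monic) (sg : size g = n.+2).
Hypothesis irr_g : forall q : {poly rat}, q != 0 -> (size q <= n.+1)%N ->
  coprimep (map_poly intr g) q.
Variables (D X : nat).
Let c := mul_mx_const n g.

Section Eval.
Variables (q : nat) (r : int).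
Hypotheses (q1 : (1 < q)%N) (qD : coprime q D) (q_g : (q %| g.[r])%Z).

Definition eval_count : nat :=
  #|[set B : {ffun 'I_n.+1 -> 'I_X} | (q %| (rVpoly (shifted_vec D B)).[r])%Z]|.

Let phi : {additive 'rV[int]_n.+1 -> 'Z_q} := @eval_mod n q r.

Let phi_onto tau : exists v, phi v = tau.
Proof.
exists ((val tau)%:Z *: 'e_0); rewrite /phi /= /eval_mod linearZ /= rVpoly_delta.
by rewrite expr0 hornerZ hornerC mulr1; exact: natr_Zp.
Qed.

Let phi_stable v : phi v = 0 -> phi (v *m comp_mx n g) = 0.
Proof.
move=> /eqP; rewrite -dvdz_Zp // => dv; apply/eqP; rewrite -dvdz_Zp //.
by rewrite rVpoly_comp // !hornerE rpredB // dvdz_mull.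
Qed.

Let D_inj (x : 'Z_q) : x *+ D = 0 -> x = 0.
Proof.
rewrite -mulr_natr => E; have uD : D%:R \is a @GRing.unit 'Z_q by rewrite unitZpE.
by rewrite -[x](mulrK uD) E mul0r.
Qed.

Let eval_countE : eval_count = #|[set B : {ffun 'I_n.+1 -> 'I_X} | phi (shifted_vec D B) == 0]|.
Proof. by apply: eq_card => B; rewrite !inE dvdz_Zp. Qed.

Let cardT : #|'Z_q| = q. Proof. by rewrite card_ord Zp_cast. Qed.

Lemma eval_count_le L : (q < L.+1 ^ n.+1)%N ->
  (eval_count * q <= (X + 2 * n.+1 * (c * L)) ^ n.+1)%N.
Proof.
have := ideal_count_le gm sg irr_g phi_onto phi_stable D_inj X.
by rewrite eval_countE cardT; apply.
Qed.

Lemma eval_count_le_crude :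
  (eval_count * q <= (X + 2 * n.+1 * (c * (D * X + 1))) ^ n.+1)%N.
Proof.
have := ideal_count_le_crude gm sg irr_g phi_onto phi_stable D_inj X.
by rewrite eval_countE cardT.
Qed.
End Eval.

Section Rem.
Variables (p : nat) (h : {poly 'F_p}).
Hypotheses (p_pr : prime p) (pD : coprime p D) (hm : h \is monic)
  (h_g : h %| map_poly intr g).

Definition rem_count : nat := #|[set B : {ffun 'I_n.+1 -> 'I_X} |
  h %| map_poly intr (rVpoly (shifted_vec D B))]|.

Let phi : {additive 'rV[int]_n.+1 -> 'rV['F_p]_(size h).-1} := @rem_mod n p h.

Let sh : (size h <= n.+2)%N.
Proof.
have gp0 : map_poly (intr : int -> 'F_p) g != 0 by rewrite monic_neq0 ?monic_map.
apply: leq_trans (dvdp_leq gp0 h_g) _.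
by rewrite -sg; apply: size_poly.
Qed.

Let h0 : (0 < size h)%N. Proof. by rewrite size_poly_gt0 monic_neq0. Qed.

Let phi_eq0 v : (phi v == 0) = (h %| map_poly intr (rVpoly v)).
Proof.
rewrite /phi /= /rem_mod; apply/eqP/modp_eq0P => [E|->]; last by rewrite raddf0.
rewrite -[_ %% _](@poly_rV_K _ (size h).-1) ?E ?raddf0 //.
by rewrite -ltnS prednK // ltn_modp monic_neq0.
Qed.

Let phi_onto tau : exists v, phi v = tau.
Proof.
exists (\row_i (val (rVpoly tau)`_i)%:Z); apply: (can_inj rVpolyK).
rewrite /phi /= /rem_mod poly_rV_K; last by rewrite -ltnS prednK // ltn_modp monic_neq0.
have st : (size (rVpoly tau) < size h)%N.
  by rewrite -[X in (_ < X)%N]prednK // ltnS size_poly.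
rewrite -[RHS](modp_small st); congr (_ %% _); apply/polyP => i.
rewrite coef_map; have [lt_i|le_i] := ltnP i n.+1.
  have /= -> := coef_rVpoly_ord (\row_i (val (rVpoly tau)`_i)%:Z) (Ordinal lt_i).
  by rewrite mxE Fp_lift.
have le_t : (size (rVpoly tau) <= i)%N.
  by rewrite -ltnS; apply: leq_trans st (leq_trans sh _).
by rewrite (nth_default _ le_t) nth_default ?raddf0 // (leq_trans (size_poly _ _)).
Qed.

Let phi_stable v : phi v = 0 -> phi (v *m comp_mx n g) = 0.
Proof.
move=> /eqP; rewrite phi_eq0 => dv; apply/eqP; rewrite phi_eq0.
rewrite rVpoly_comp // rmorphB rmorphM /= map_polyZ dvdp_sub ?dvdp_mull //.
by rewrite -mul_polyC dvdp_mull.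
Qed.

Let D_inj (x : 'rV['F_p]_(size h).-1) : x *+ D = 0 -> x = 0.
Proof.
rewrite -scaler_nat => /eqP; rewrite scaler_eq0 => /orP[|/eqP//].
rewrite -[D%:R]/((Posz D)%:~R) -dvdz_Fp // dvdzE /= => pd.
by move: pD; rewrite prime_coprime // pd.
Qed.

Let rem_countE : rem_count = #|[set B : {ffun 'I_n.+1 -> 'I_X} | phi (shifted_vec D B) == 0]|.
Proof. by apply: eq_card => B; rewrite !inE phi_eq0. Qed.

Let cardT : #|'rV['F_p]_(size h).-1| = (p ^ (size h).-1)%N.
Proof. by rewrite card_mx mul1n card_Fp. Qed.

Lemma rem_count_le L : (p ^ (size h).-1 < L.+1 ^ n.+1)%N ->
  (rem_count * p ^ (size h).-1 <= (X + 2 * n.+1 * (c * L)) ^ n.+1)%N.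
Proof.
move=> qL; rewrite rem_countE -cardT.
by apply: (ideal_count_le gm sg irr_g phi_onto phi_stable D_inj); rewrite cardT.
Qed.

Lemma rem_count_le_crude :
  (rem_count * p ^ (size h).-1 <= (X + 2 * n.+1 * (c * (D * X + 1))) ^ n.+1)%N.
Proof.
rewrite rem_countE -cardT.
exact: (ideal_count_le_crude gm sg irr_g phi_onto phi_stable D_inj).
Qed.
End Rem.
End Counts.

(** * Roots and monic divisors of g modulo p *)

(** Over an algebraic closure a monic divisor is the product of X - z over a sublist of the roots of
    [G]. *)
Lemma monic_divisors_count (F : countFieldType) (G : {poly F}) (s : seq {poly F}) :
  G \is monic -> uniq s -> (forall h, h \in s -> h \is monic /\ h %| G) ->
  (size s <= 2 ^ (size G).-1)%N.
Proof.
move=> Gm us hs; have [K [f _]] := countable_algebraic_closure F.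
have fGm : map_poly f G \is monic by rewrite monic_map.
have [r Er] := closed_field_poly_normal (map_poly f G).
rewrite (monicP fGm) scale1r in Er.
have sr : size r = (size G).-1.
  by rewrite -(size_map_poly f G) Er size_prod_XsubC.
pose prods := [seq \prod_(z <- mask (m : (size r).-tuple bool) r) ('X - z%:P) | m <- enum {:
  (size r).-tuple bool}].
have sp : size prods = (2 ^ (size G).-1)%N.
  by rewrite size_map -cardE card_tuple card_bool sr.
rewrite -sp -(size_map (map_poly f)); apply: uniq_leq_size.
  by rewrite map_inj_uniq //; exact: map_poly_inj.
move=> _ /mapP[h /hs[hm hG] ->].
have : map_poly f h %| \prod_(z <- r) ('X - z%:P) by rewrite -Er dvdp_map.
case/dvdp_prod_XsubC => m; rewrite eqp_monic ?monic_map ?monic_prod_XsubC // => /eqP ->.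
have /subseqP[m' sm' ->] : subseq (mask m r) r by exact: mask_subseq.
have sm'' : size m' == size r by rewrite sm'.
apply/mapP; exists (Tuple sm'') => //; by rewrite mem_enum.
Qed.

Lemma card_le_cover (I : eqType) (T : finType) (E : {set T}) (s : seq I)
    (Q : I -> {set T}) (W : nat) :
  (forall x, x \in E -> has (fun i => x \in Q i) s) ->
  (forall i, i \in s -> (#|Q i| <= W)%N) -> (#|E| <= size s * W)%N.
Proof.
elim: s E => [|i s IH] E cov W_.
  by rewrite leqn0 cards_eq0; apply/eqP/setP => x; rewrite inE; apply/negP => /cov.
rewrite -(cardsID (Q i)) mulSn leq_add //.
  by apply: leq_trans (W_ i (mem_head _ _)); apply/subset_leq_card/subsetIr.
apply: IH => [x /setDP[/cov /= /orP[->|]]|j js] //.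
by rewrite W_ // inE js orbT.
Qed.

Lemma horner_taylor1 (R : comNzRingType) (g : {poly R}) (x h : R) :
  exists c, g.[x + h] = g.[x] + h * g^`().[x] + h ^+ 2 * c.
Proof.
elim/poly_ind: g => [|g c [d IH]].
  by exists 0; rewrite deriv0 !horner0 !mulr0 !addr0.
exists (g^`().[x] + d * (x + h)).
by rewrite derivD derivC derivM derivX !hornerE IH; ring.
Qed.

Section RootsMod.
Variables (p : nat) (g : {poly int}).
Hypotheses (p_pr : prime p) (gm : g \is monic).
Let gp : {poly 'F_p} := map_poly intr g.

Lemma roots_le (q : nat) (S : {set 'I_q}) :
  (forall s : 'I_q, s \in S -> (p %| g.[(s : nat)%:Z])%Z) ->
  {in S &, injective (fun s : 'I_q => (s : nat)%:R : 'F_p)} -> (#|S| <= (size g).-1)%N.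
Proof.
move=> rS inj; have gpm : gp \is monic by exact: monic_map.
pose rs := image (fun s : 'I_q => (nat_of_ord s)%:R : 'F_p) (mem S).
have sgp : size gp = size g by rewrite size_map_poly_id0 // (monicP gm) oner_eq0.
have -> : #|S| = size rs by rewrite size_image.
rewrite -ltnS -sgp prednK ?size_poly_gt0 ?monic_neq0 //.
apply: max_poly_roots; first by rewrite monic_neq0.
  apply/allP => _ /imageP[s /rS ds ->].
  rewrite /root /gp (_ : (s : nat)%:R = (Posz s)%:~R) // horner_map /=.
  by rewrite -dvdz_Fp.
by move/dinjectiveP: inj.
Qed.

Lemma roots_prime_le : (#|[set r : 'I_p | (p %| g.[(r : nat)%:Z])%Z]| <= (size g).-1)%N.
Proof.
apply: roots_le => [s|s s' _ _ /eqP]; first by rewrite inE.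
rewrite -val_eqE /= !val_Fp_nat // !modn_small // => /eqP E; exact/val_inj.
Qed.

(** This is the uniqueness in Hensel's lemma. If s = s' + k p are roots modulo p^2, Taylor expansion
    gives p | k g'(s'); separability makes g'(s') a unit modulo p, so p | k and s = s'. Roots modulo
    p^2 are thus no more numerous than roots modulo p. *)
Lemma roots_square_le : coprimep gp gp^`() ->
  (#|[set s : 'I_(p ^ 2) | (p%:Z ^+ 2 %| g.[(s : nat)%:Z])%Z]| <= (size g).-1)%N.
Proof.
move=> sep; have p0 : p%:Z != 0 by have := prime_gt0 p_pr; lia.
apply: roots_le => [s|s s']; rewrite !inE; first by apply: dvdz_trans; rewrite dvdz_exp.
move=> ds ds' /eqP; rewrite -subr_eq0.
rewrite -[s%:R]/((Posz s)%:~R) -[s'%:R]/((Posz s')%:~R) -intrB -dvdz_Fp // => /dvdzP[k E].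
have {}E : s%:Z = s'%:Z + k * p by rewrite -E addrC subrK.
have [c] := horner_taylor1 g s'%:Z (k * p); rewrite -E => Eg.
have : (p %| k * g^`().[s'])%Z.
  rewrite -(dvdz_mul2l p0) -expr2.
  have -> : p%:Z * (k * g^`().[s'%:Z]) = g.[s%:Z] - g.[s'%:Z] - (k * p%:Z) ^+ 2 * c.
    by rewrite Eg; ring.
  by rewrite !rpredB // exprMn -mulrA mulrCA dvdz_mulr.
rewrite dvdz_Fp // intrM mulf_eq0 => /orP[|d'0]; last first.
  have r0 : root gp s'%:R.
    rewrite /root -[s'%:R]/((Posz s')%:~R) horner_map /= -dvdz_Fp //.
    by apply: dvdz_trans ds'; rewrite dvdz_exp.
  have r1 : root gp^`() s'%:R.
    by rewrite /root -[s'%:R]/((Posz s')%:~R) /gp deriv_map horner_map.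
  by have := coprimep_root sep r0; rewrite -/(root _ _) r1.
rewrite -dvdz_Fp // => /dvdzP[l El].
have pp : (p ^ 2)%N = p%:Z * p%:Z :> int by rewrite -PoszM mulnn.
have {}E : s%:Z = s'%:Z + l * (p ^ 2)%N%:Z by rewrite pp E El mulrA.
have uniq_rem (a b m : nat) : a%:Z = b%:Z + l * m%:Z -> (a < m)%N -> (b < m)%N -> a = b.
  move=> Eab la lb; have [l0|[l1|l1]] : l = 0 \/ (1 <= l) \/ (l <= -1) by lia.
  - by move: Eab; rewrite l0 mul0r addr0 => -[].
  - have : m%:Z <= l * m%:Z by rewrite -{1}[m%:Z]mul1r ler_wpM2r.
    by move: Eab; set z := l * _; lia.
  - have : l * m%:Z <= - m%:Z by rewrite -mulN1r ler_wpM2r.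
    by move: Eab; set z := l * _; lia.
by apply/val_inj; apply: uniq_rem E _ _; apply: ltn_ord.
Qed.
End RootsMod.

(** Clearing denominators in a Bezout relation between g and g' leaves a nonzero integer, which
    stays invertible modulo every larger prime. *)
Lemma separable_mod_large_primes (g : {poly int}) :
  coprimep (map_poly intr g : {poly rat}) (map_poly intr g)^`() ->
  exists P0 : nat, forall p, prime p -> (P0 < p)%N ->
    coprimep (map_poly intr g : {poly 'F_p}) (map_poly intr g)^`().
Proof.
move=> /Bezout_coprimepP[[u v] /= /eqp_size]; rewrite size_poly1.
move=> /eqP/size_poly1P[a a0 E].
have [U [x x0 EU]] := rat_poly_scale u; have [V [y y0 EV]] := rat_poly_scale v.
pose W := (y *: U) * g + (x *: V) * g^`().
have EW : map_poly (intr : int -> rat) W = (x%:~R * y%:~R * a)%:P.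
  rewrite rmorphD !rmorphM /= !map_polyZ -deriv_map.
  apply: (@etrans _ _ ((x%:~R * y%:~R) *: a%:P)); last first.
    by rewrite -mul_polyC rmorphM.
  rewrite -E EU EV -!scalerAl scalerDr !scalerA.
  by rewrite mulfK ?intr_eq0 // [x%:~R * _]mulrC mulfK ?intr_eq0.
have : size W == 1%N.
  rewrite -(@size_map_inj_poly _ _ (intr : int -> rat)) // ?EW; last exact: intr_inj.
  by rewrite size_polyC !mulf_neq0 ?intr_eq0.
case/size_poly1P => b b0 {}EW.
exists `|b|%N => p p_pr bp; apply/Bezout_coprimepP.
exists (map_poly intr (y *: U), map_poly intr (x *: V)) => /=.
rewrite deriv_map -!rmorphM -rmorphD /= -/W EW map_polyC /=.
rewrite -size_poly_eq1 size_polyC (_ : b%:~R != 0) // -dvdz_Fp // dvdzE /=.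
by apply: contraL bp => /dvdn_leq; rewrite absz_gt0 b0 -leqNgt => ->.
Qed.

(** * Elements of small norm *)

Lemma card_bounded_gaps X m (S : {set 'I_X}) :
  (forall a b : 'I_X, a \in S -> b \in S -> (a <= b)%N -> (b - a < m)%N) -> (#|S| <= m)%N.
Proof.
move=> hS; have [->|[b0 Sb0]] := set_0Vmem S; first by rewrite cards0.
case: (@arg_minnP _ b0 (mem S) val Sb0) => a Sa amin.
have m0 : (0 < m)%N by have := hS a a Sa Sa (leqnn _); rewrite subnn.
pose f (b : 'I_X) : 'I_m := insubd (Ordinal m0) (b - a)%N.
rewrite -[X in (_ <= X)%N]card_ord -(@card_in_imset _ _ f S); last first.
  move=> b b' Sb Sb' /(congr1 val); rewrite /f !insubdK -?topredE /= ?hS ?amin //.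
  have := amin _ Sb; have := amin _ Sb'; rewrite /= => le1 le2 E; apply/val_inj => /=; lia.
exact: max_card.
Qed.

(** Over the complex algebraic numbers [chi] is a product of d factors x - z, so a value below H^d
    puts x at distance less than H from some root. Two such x near the same root differ by less than
    2 H, which leaves at most 2 H values of b. *)
Lemma monic_small_values (chi : {poly int}) d X D H (S : {set 'I_X}) :
  chi \is monic -> size chi = d.+1 -> (0 < D)%N ->
  (forall b : 'I_X, b \in S -> `|chi.[(1 + b * D)%N%:Z]| < (H ^ d)%N%:Z) ->
  (#|S| <= d * (2 * H))%N.
Proof.
move=> cm sc D0 hS.
pose chiC : {poly algC} := map_poly intr chi.
have cCm : chiC \is monic by rewrite monic_map.
have [r Er] := closed_field_poly_normal chiC.
rewrite (monicP cCm) scale1r in Er.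
have sr : size r = d.
  apply/eqP; rewrite -eqSS -sc -(size_prod_XsubC r id) -Er /chiC.
  by rewrite size_map_poly_id0 // (monicP cm) oner_eq0.
pose Q (z : algC) := [set b : 'I_X | `|(1 + b * D)%N%:R - z| < H%:R].
rewrite -sr; apply: (@card_le_cover _ _ _ _ Q) => [b /hS hb|z _].
  apply/negPn/negP => /hasPn hr.
  have : `|chiC.[(1 + b * D)%N%:R]| < (H ^ d)%:R.
    rewrite -[(1 + b * D)%N%:R]/((Posz (1 + b * D))%:~R) horner_map /= -intr_norm.
    by rewrite -[(H ^ d)%:R]/((Posz (H ^ d))%:~R) ltr_int.
  rewrite Er horner_prod normr_prod; apply/negP; rewrite -real_leNgt ?realn //; last first.
    by rewrite rpred_prod // => i _; rewrite normr_real.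
  have -> : (H ^ d)%:R = \prod_(z <- r) H%:R :> algC.
    by rewrite big_const_seq count_predT sr iter_mulr_1 natrX.
  rewrite big_seq [X in _ <= X]big_seq; apply: ler_prod => z /hr.
  rewrite inE ler0n /= hornerXsubC real_ltNge ?realn ?normr_real // negbK.
  by [].
apply: card_bounded_gaps => a b; rewrite !inE => ha hb ab.
have : `|(1 + b * D)%N%:R - (1 + a * D)%N%:R : algC| < (2 * H)%:R.
  have -> : (1 + b * D)%N%:R - (1 + a * D)%N%:R =
    ((1 + b * D)%N%:R - z) - ((1 + a * D)%N%:R - z) :> algC by ring.
  by apply: le_lt_trans (ler_normB _ _) _; rewrite mul2n -addnn [(H + H)%:R]natrD ltrD.
rewrite -natrB ?normr_nat ?ltr_nat; last by rewrite leq_add2l leq_mul2r ab orbT.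
by rewrite subnDl -mulnBl; apply: leq_ltn_trans; rewrite leq_pmulr.
Qed.

Lemma horner_char_poly (R : comNzRingType) n (M : 'M[R]_n) a :
  (char_poly M).[a] = \det (a%:M - M).
Proof.
rewrite -[LHS]/(horner_eval a (char_poly M)) -det_map_mx; congr (\det _).
by apply/matrixP => i j; rewrite !mxE /= /horner_eval hornerD hornerN hornerC hornerMn hornerX.
Qed.

Section SmallNorms.
Variables (n : nat) (g : {poly int}) (X D H : nat).
Hypothesis D_gt0 : (0 < D)%N.

(** With all coordinates of B but the first fixed, the element is x + v with v fixed and x = 1 + D
    B_0. Its norm is the characteristic polynomial of multiplication by -v at x, which is monic, and
    small values of a monic polynomial are rare. This is what bounds the mean of log |N(A)| from
    below. *)
Lemma small_norm_count :
  (#|[set B : {ffun 'I_n.+1 -> 'I_X} |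
      (`|\det (mul_mx g (shifted_vec D B))| < Posz (H ^ n.+1))%R]| <= X ^ n * (n.+1 * (2 * H)))%N.
Proof.
set E := [set _ | _].
pose rest (B : {ffun 'I_n.+1 -> 'I_X}) := [ffun i => B (lift ord0 i)] : {ffun 'I_n -> 'I_X}.
have -> : (X ^ n)%N = size (enum {: {ffun 'I_n -> 'I_X}}).
  by rewrite -cardE card_ffun !card_ord.
apply: (@card_le_cover _ _ _ _ (fun y => [set B in E | rest B == y])) => [B EB|y _].
  by apply/hasP; exists (rest B); rewrite ?mem_enum // inE EB eqxx.
set Ey := [set _ in _ | _].
have inj0 : {in Ey &, injective (fun B : {ffun 'I_n.+1 -> 'I_X} => B ord0)}.
  move=> B B'; rewrite !inE => /andP[_ /eqP Ey1] /andP[_ /eqP Ey2] E0.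
  apply/ffunP => i; case: (unliftP ord0 i) => [j ->|-> //].
  have := congr1 (fun z : {ffun 'I_n -> 'I_X} => z j) (etrans Ey1 (esym Ey2)).
  by rewrite !ffunE.
rewrite -(card_in_imset inj0).
pose v : 'rV[int]_n.+1 := \row_i if unlift ord0 i is Some j then (Posz (y j)) *+ D else 0.
pose chi := char_poly (- mul_mx g v).
apply: (@monic_small_values chi n.+1 X D H) => //.
- exact: char_poly_monic.
- exact: size_char_poly.
move=> b /imsetP[B]; rewrite !inE => /andP[EB /eqP yB] ->.
rewrite horner_char_poly opprK.
suff -> : (1 + B ord0 * D)%N%:Z%:M + mul_mx g v = mul_mx g (shifted_vec D B) by [].
have -> : shifted_vec D B = (1 + B ord0 * D)%N%:Z *: 'e_0 + v.
  apply/rowP => i; rewrite shifted_vecE !mxE eqxx /=.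
  case: (unliftP ord0 i) => [j ->|->] /=.
    rewrite mulr0 add0r -yB ffunE -mulr_natr natz -PoszM add0n mulnC.
    by [].
  by rewrite mulr1 addr0 mulnC.
rewrite /mul_mx raddfD /= linearZ /= rVpoly_delta expr0 rmorphD /= -[_ *: 1]mul_polyC mulr1.
by rewrite horner_mx_C.
Qed.
End SmallNorms.

(** * Exceptional elements for a prime *)

Section Exceptional.
Variables (n : nat) (g : {poly int}).
Hypotheses (gm : g \is monic) (sg : size g = n.+3).
Variables (D X : nat).
Local Notation box := {ffun 'I_n.+2 -> 'I_X}.
Implicit Type B : box.

Definition common_factor_set p := [set B : box |
  (2 < size (gcdp (map_poly intr g : {poly 'F_p})
                  (map_poly intr (rVpoly (shifted_vec D B)))))%N].

Definition common_root_set p := [set B : box | [exists s : 'I_(p ^ 2),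
  (p%:Z ^+ 2 %| g.[(s : nat)%:Z])%Z &&
  (p%:Z ^+ 2 %| (rVpoly (shifted_vec D B)).[(s : nat)%:Z])%Z]].

(* The [B] for which a prime [p] may divide the norm in another way than once, through
   a single common root; there are O(X^t / p^2) of them. *)
Definition exceptional_set p := common_factor_set p :|: common_root_set p.

Definition root_set p := [set r : 'I_p | (p %| g.[(r : nat)%:Z])%Z].

Definition box_norm B := `|\det (mul_mx g (shifted_vec D B))|%N.

Definition common_root_count p B :=
  #|[set r in root_set p | (p %| (rVpoly (shifted_vec D B)).[(r : nat)%:Z])%Z]|.

(** The common factor is one of at most 2^t monic divisors h of g modulo p, each defining an ideal
    of index at least p^2; the common roots modulo p^2 number at most t. The bound [W] on each ideal
    is left abstract so that the sharp and the crude counts can both be inserted. *)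
Lemma exceptional_count p (W : nat) : prime p -> coprime p D ->
  coprimep (map_poly intr g : {poly 'F_p}) (map_poly intr g)^`() ->
  (forall h : {poly 'F_p}, h \is monic -> h %| map_poly intr g -> (2 < size h)%N ->
     (rem_count n.+1 D X h * p ^ (size h).-1 <= W)%N) ->
  (forall s : int, (p%:Z ^+ 2 %| g.[s])%Z -> (eval_count n.+1 D X (p ^ 2) s * p ^ 2 <= W)%N) ->
  (#|exceptional_set p| * p ^ 2 <= (2 ^ n.+2 + n.+2) * W)%N.
Proof.
move=> p_pr pD sep hrem hev.
have p2 : (0 < p ^ 2)%N by rewrite expn_gt0 prime_gt0.
have gpm : (map_poly intr g : {poly 'F_p}) \is monic by exact: monic_map.
have gp0 := monic_neq0 gpm.
have sgp : size (map_poly intr g : {poly 'F_p}) = n.+3.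
  by rewrite size_map_poly_id0 // (monicP gm) oner_eq0.
(* Dividing first turns the hypotheses into the single integer bound [W %/ p ^ 2] for every ideal of
   the cover. *)
rewrite -leq_divRL //.
apply: leq_trans (_ : ((2 ^ n.+2 + n.+2) * (W %/ p ^ 2) <= _)%N); last first.
  by rewrite leq_divRL // -mulnA leq_mul2l leq_trunc_div orbT.
rewrite mulnDl; apply: leq_trans (leq_card_setU _ _) _; apply: leq_add.
  pose hB B : {poly 'F_p} := let d := gcdp (map_poly intr g) (map_poly intr (rVpoly (shifted_vec
    D B)))
    in (lead_coef d)^-1 *: d.
  pose s := undup [seq hB B | B in common_factor_set p].
  have sP h : h \in s -> [/\ h \is monic, h %| map_poly intr g & (2 < size h)%N].
    rewrite mem_undup => /imageP[B]; rewrite inE => sB ->.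
    have l0 : lead_coef (gcdp (map_poly intr g : {poly 'F_p}) (map_poly intr (rVpoly
      (shifted_vec D B)))) != 0.
      by rewrite lead_coef_eq0 gcdp_eq0 (negPf gp0).
    split; first by rewrite monicE lead_coefZ mulVf.
      by rewrite dvdpZl ?invr_eq0 // dvdp_gcdl.
    by rewrite size_scale ?invr_eq0.
  have ss : (size s <= 2 ^ n.+2)%N.
    have -> : n.+2 = (size (map_poly intr g : {poly 'F_p})).-1 by rewrite sgp.
    apply: monic_divisors_count => //; first exact: undup_uniq.
    by move=> h /sP[].
  apply: leq_trans (_ : (size s * (W %/ p ^ 2) <= _)%N); last by rewrite leq_mul2r ss orbT.
  apply: (@card_le_cover _ _ _ _ (fun h => [set B : box | h %| map_poly intr (rVpoly
    (shifted_vec D B))])).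
    move=> B EB; apply/hasP; exists (hB B).
      by rewrite mem_undup; apply/imageP; exists B.
    rewrite inE dvdpZl ?dvdp_gcdr // invr_eq0 lead_coef_eq0 gcdp_eq0.
    by rewrite (negPf gp0).
  move=> h /sP[hm hg h2]; rewrite leq_divRL //; apply: leq_trans (hrem h hm hg h2).
  by rewrite leq_mul // leq_pexp2l ?prime_gt0 //; move: h2; case: (size h) => [|[]].
pose rts := [set s : 'I_(p ^ 2) | (p%:Z ^+ 2 %| g.[(s : nat)%:Z])%Z].
have sr : (size (enum rts) <= n.+2)%N.
  by rewrite -cardE -[n.+2]/(n.+3.-1) -sg; apply: roots_square_le.
apply: leq_trans (_ : (size (enum rts) * (W %/ p ^ 2) <= _)%N); last by rewrite leq_mul2r sr orbT.
have pp : p%:Z ^+ 2 = (p ^ 2)%N by rewrite expr2 -PoszM mulnn.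
apply: (@card_le_cover _ _ _ _ (fun s : 'I_(p ^ 2) => [set B : box | 
  (p%:Z ^+ 2 %| (rVpoly (shifted_vec D B)).[(s : nat)%:Z])%Z])).
  move=> B; rewrite inE => /existsP[s /andP[s1 s2]].
  by apply/hasP; exists s; rewrite ?mem_enum inE.
move=> s; rewrite mem_enum inE => s1; rewrite leq_divRL // pp.
exact: hev s1.
Qed.

(** Modulo a prime dividing [D] the element is 1 and so is its norm. For any other prime,
    [norm_dvd_prime] shows that outside the exceptional set p^2 cannot divide the norm. *)
Lemma norm_prime_factor p B : (0 < D)%N -> prime p -> (p %| box_norm B)%N ->
  ~~ (p %| D)%N /\
  (B \in exceptional_set p \/ logn p (box_norm B) = 1%N /\ (0 < common_root_count p B)%N).
Proof.
move=> D0 p_pr pN; have dN : (p %| \det (mul_mx g (shifted_vec D B)))%Z by rewrite dvdzE.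
split.
  apply/negP => pD; move: dN; rewrite dvdz_Fp // -det_map_mx.
  have -> : mul_mx g (shifted_vec D B) = 1%:M + D%:R *: mul_mx g (box_vec B).
    rewrite /mul_mx raddfD /= rVpoly_delta expr0 rmorphD rmorph1; congr (_ + _).
    by rewrite raddfMn /= raddfMn /= scaler_nat.
  rewrite map_mxD map_mx1 map_mxZ rmorph_nat.
  have -> : D%:R = 0 :> 'F_p.
    by apply/eqP; rewrite -[D%:R]/((Posz D)%:~R) -dvdz_Fp.
  by rewrite scale0r addr0 det1 oner_eq0.
have [[h [hm /andP[h2 _] hg hv]]|[[r rp [rg rv]] sq]] := norm_dvd_prime p_pr gm sg dN.
  left; rewrite !inE; apply/orP; left; apply: leq_trans h2 _.
  apply: dvdp_leq; last by rewrite dvdp_gcd hg.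
  by rewrite gcdp_eq0 negb_and monic_neq0 ?monic_map.
have [/sq[s sp [s1 s2]]|nsq] := boolP (p%:Z ^+ 2 %| \det (mul_mx g (shifted_vec D B)))%Z.
  left; rewrite !inE; apply/orP; right; apply/existsP; exists (Ordinal sp).
  by rewrite s1.
right; split; last by apply/card_gt0P; exists (Ordinal rp); rewrite !inE rg.
have N0 : (0 < box_norm B)%N.
  rewrite absz_gt0; apply: contraNneq nsq => ->; exact: dvdz0.
apply/eqP; rewrite eqn_leq -!pfactor_dvdn // expn1 pN andbT.
rewrite leqNgt -pfactor_dvdn //; apply: contra nsq.
Qed.
End Exceptional.

(** * Logarithms of natural numbers and sums over primes *)

Section LogNat.
Variable R : realType.
Implicit Types (m n N X : nat).

(* [natln 0 = 0]. *)
Definition natln n : R := ln n%:R.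
Local Notation lnn := natln.

Lemma lnn1 : lnn 1 = 0. Proof. by rewrite /natln ln1. Qed.

Lemma lnn_le m n : (0 < m)%N -> (m <= n)%N -> lnn m <= lnn n.
Proof.
move=> m0 mn; rewrite /natln ler_ln ?ler_nat // posrE ltr0n //.
exact: leq_trans mn.
Qed.

Lemma lnn_ge0 n : 0 <= lnn n.
Proof.
case: n => [|n]; first by rewrite /natln ln0.
by rewrite -lnn1; apply: lnn_le.
Qed.

Lemma lnnM m n : (0 < m)%N -> (0 < n)%N -> lnn (m * n) = lnn m + lnn n.
Proof. by move=> m0 n0; rewrite /natln natrM lnM // posrE ltr0n. Qed.

Lemma lnnX n k : (0 < n)%N -> lnn (n ^ k) = k%:R * lnn n.
Proof. by move=> n0; rewrite /natln natrX lnXn ?ltr0n // mulr_natl. Qed.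

Lemma lnn_unbounded (C : R) : exists X0, forall X, (X0 <= X)%N -> C <= lnn X.
Proof.
exists (Num.truncn (expR C)).+1 => X XX.
rewrite -[C]expRK /natln ler_ln ?posrE ?expR_gt0 ?ltr0n ?(leq_trans _ XX) //.
apply/ltW/(lt_le_trans (truncnS_gt _)); by rewrite ler_nat.
Qed.

Lemma lnn_factor n : (0 < n)%N ->
  lnn n = \sum_(0 <= p < n.+1) (logn p n)%:R * lnn p.
Proof.
move=> n0; rewrite -{1}(partnT n0) /partn.
have pos (s : seq nat) : (0 < \prod_(p <- s | p \in predT) p ^ logn p n)%N.
  rewrite big_seq_cond; apply: prodn_cond_gt0 => p _; rewrite expn_gt0.
  by case: p => //; rewrite logn0 orbT.
elim: (index_iota 0 n.+1) => [|p s IH]; first by rewrite !big_nil lnn1.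
have pp : (0 < p ^ logn p n)%N by case: p => [|p]; rewrite ?expn_gt0.
rewrite !big_cons /= lnnM ?pos // IH; congr (_ + _).
case: p pp => [|p] pp; last by rewrite lnnX.
by rewrite lognE /= expn0 lnn1 mul0r.
Qed.

Lemma sum_lnn_dvd n (P : pred nat) m : (0 < n)%N ->
  (forall p, P p -> prime p && (p %| n)%N) ->
  \sum_(0 <= p < m | P p) lnn p <= lnn n.
Proof.
move=> n0 hP; rewrite [leRHS](lnn_factor n0).
have pos p : 0 <= (logn p n)%:R * lnn p by rewrite mulr_ge0 ?lnn_ge0 ?ler0n.
have h0 (a b : nat) : 0 <= \sum_(a <= p < b) (logn p n)%:R * lnn p by rewrite sumr_ge0.
have hle (a b : nat) : \sum_(a <= p < b | P p) lnn p <= \sum_(a <= p < b) (logn p n)%:R * lnn p.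
  rewrite big_mkcond; apply: ler_sum => p _; case: ifP => [/hP/andP[p_pr dp]|_ //].
  by rewrite ler_peMl ?lnn_ge0 // ler1n logn_gt0 mem_primes p_pr n0.
have [le_mn|lt_nm] := leqP m n.+1.
  by rewrite [leRHS](@big_cat_nat _ _ _ m) //= ler_wpDr.
rewrite [leLHS](@big_cat_nat _ _ _ n.+1) //=; last exact: ltnW.
rewrite [X in _ + X]big_nat_cond [X in _ + X]big1 ?addr0 // => p /andP[/andP[np _] /hP/andP[_
  /dvdn_leq]].
by move=> /(_ n0); rewrite leqNgt np.
Qed.

Lemma prime_dvd_central_bin N p : prime p -> (N < p <= 2 * N)%N -> (p %| 'C(2 * N, N))%N.
Proof.
move=> p_pr /andP[Np pN].
have pf : (p %| (2 * N)`!)%N by rewrite dvdn_fact // prime_gt0.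
have E : 'C(2 * N, N) * (N`! * N`!) = (2 * N)`!.
  by rewrite -(@bin_fact (2 * N) N) ?mul2n -?addnn ?leq_addr // addnK.
have pN' : ~~ (p %| N`!)%N.
  elim: N Np {pN pf E} => [|N IH] Np; first by rewrite fact0 gtnNdvd // prime_gt1.
  rewrite factS Euclid_dvdM // negb_or IH ?(ltnW Np) // andbT.
  by rewrite gtnNdvd.
by move: pf; rewrite -E !Euclid_dvdM // (negPf pN') /= orbF.
Qed.

Lemma central_bin_le N : ('C(2 * N, N) <= 2 ^ (2 * N))%N.
Proof.
rewrite -[2%N in X in (_ <= X)%N]/(1 + 1)%N expnDn.
have lt : (N < (2 * N).+1)%N by lia.
by rewrite (bigD1 (Ordinal lt)) //= !exp1n !muln1 leq_addr.
Qed.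

(** Chebyshev's argument: these primes all divide the binomial coefficient C(2N, N), which is at
    most 4^N. *)
Lemma chebyshev_dyadic N : (0 < N)%N ->
  \sum_(N.+1 <= p < (2 * N).+1 | prime p) lnn p <= (2 * N)%:R * lnn 2.
Proof.
move=> N0; rewrite -lnnX //.
apply: le_trans (lnn_le _ (central_bin_le N)); last by rewrite bin_gt0; lia.
have -> : \sum_(N.+1 <= p < (2 * N).+1 | prime p) lnn p =
  \sum_(N.+1 <= p < (2 * N).+1 | prime p && (N < p <= 2 * N)%N) lnn p.
  rewrite big_nat_cond [RHS]big_nat_cond; apply: eq_bigl => p.
  by rewrite ltnS; case: (prime p) => //=; rewrite ?andbT ?andbF // andbb.
apply: le_trans (_ : \sum_(0 <= p < (2 * N).+1 | prime p && (N < p <= 2 * N)%N) lnn p <= _).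
  rewrite [leRHS](@big_cat_nat _ _ _ N.+1) //=; last by rewrite ltnS; lia.
  by rewrite ler_wpDl // sumr_ge0 // => p _; apply: lnn_ge0.
apply: sum_lnn_dvd => [|p /andP[p_pr pN]]; first by rewrite bin_gt0; lia.
by rewrite p_pr prime_dvd_central_bin.
Qed.

(** Each dyadic block contributes at most 2 log 2. The primes between the two bounds on the norms
    fill boundedly many blocks, so a crude count suffices for them. *)
Lemma mertens_tail w k : (0 < w)%N ->
  \sum_(w.+1 <= p < (2 ^ k * w).+1 | prime p) lnn p / p%:R <= k%:R * (2%:R * lnn 2).
Proof.
move=> w0; elim: k => [|k IH]; first by rewrite mul1n big_geq // mul0r.
set W := (2 ^ k * w)%N in IH.
have W0 : (0 < W)%N by rewrite muln_gt0 expn_gt0.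
rewrite expnS -mulnA -/W (@big_cat_nat _ _ _ W.+1) /=; last 2 first.
- by rewrite ltnS leq_pmull // expn_gt0.
- by rewrite ltnS; lia.
rewrite -natr1 mulrDl mul1r lerD //.
apply: (@le_trans _ _ (\sum_(W.+1 <= p < (2 * W).+1 | prime p) lnn p / W%:R)).
  rewrite big_nat_cond [leRHS]big_nat_cond; apply: ler_sum => p /andP[/andP[Wp _] _].
  rewrite ler_wpM2l ?lnn_ge0 // lef_pV2 ?posrE ?ltr0n //; last by lia.
  by rewrite ler_nat ltnW.
rewrite -mulr_suml ler_pdivrMr ?ltr0n //.
by apply: le_trans (chebyshev_dyadic W0) _; rewrite natrM mulrAC.
Qed.

Lemma sum_inv_square_le (a b : nat) : (0 < a)%N ->
  \sum_(a.+1 <= p < b | prime p) (p%:R ^+ 2)^-1 <= a%:R^-1 :> R.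
Proof.
move=> a0; have a0' : 0 < a%:R :> R by rewrite ltr0n.
have tele k : \sum_(a.+1 <= p < a.+1 + k) (p%:R ^+ 2)^-1 <= a%:R^-1 - (a + k)%:R^-1 :> R.
  elim: k => [|k IH]; first by rewrite addn0 big_geq // addn0 subrr.
  rewrite addnS big_nat_recr ?leq_addr //=.
  apply: (le_trans (lerD IH (lexx _))); rewrite -addrA lerD2l addrC -lerBrDr opprK.
  have x0 : 0 < (a + k)%:R :> R by rewrite ltr0n addn_gt0 a0.
  rewrite addSn addnS -natr1; move: (a + k)%:R x0 => x x0.
  have x1 : 0 < x + 1 by rewrite addr_gt0.
  rewrite [leRHS]addrC -subr_ge0.
  have -> : x^-1 - (x + 1)^-1 - ((x + 1) ^+ 2)^-1 = (x * (x + 1) ^+ 2)^-1.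
    by field; rewrite !lt0r_neq0.
  by rewrite invr_ge0 mulr_ge0 ?exprn_ge0 // ltW.
have [ba|ab] := leqP b a.+1; first by rewrite big_geq // invr_ge0 ltW.
rewrite big_mkcond; apply: (@le_trans _ _ (\sum_(a.+1 <= p < b) (p%:R ^+ 2)^-1)).
  by apply: ler_sum => p _; case: ifP => // _; rewrite invr_ge0 exprn_ge0.
rewrite -(subnKC (ltnW ab)); apply: le_trans (tele _) _.
by rewrite gerBl invr_ge0.
Qed.

Lemma harmonic_le N : (0 < N)%N -> \sum_(1 <= c < N.+1) c%:R^-1 <= 1 + lnn N.
Proof.
case: N => // N _; elim: N => [|N IH]; first by rewrite big_nat1 invr1 lnn1 addr0.
rewrite big_nat_recr //=; apply: le_trans (lerD IH (lexx _)) _.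
have n1 : 0 < N.+1%:R :> R by rewrite ltr0n.
have n2 : 0 < N.+2%:R :> R by rewrite ltr0n.
have : lnn N.+1 - lnn N.+2 <= - N.+2%:R^-1.
  rewrite /natln -ln_div ?posrE //.
  have -> : N.+1%:R / N.+2%:R = 1 + (- N.+2%:R^-1) :> R.
    by move: n2; rewrite -[N.+2%:R]natr1; move: N.+1%:R => y y0; field; rewrite lt0r_neq0.
  by apply: le_ln1Dx; rewrite ltrN2 invf_lt1 // ltr1n.
by rewrite lerNr opprB lerBrDl -addrA lerD2l.
Qed.
End LogNat.

(** * The norm-form inequality *)

Lemma sum_subrange_le (R : numDomainType) (a b a' b' : nat) (P : pred nat) (f : nat -> R) :
  (forall p, 0 <= f p) ->
  \sum_(a <= p < b | P p && (a' <= p < b')%N) f p <= \sum_(a' <= p < b' | P p) f p.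
Proof.
move=> f0; pose M := maxn b b'.
rewrite (@big_nat_widenl _ _ _ a 0%N b) // (@big_nat_widenl _ _ _ a' 0%N b') //.
rewrite (@big_nat_widen _ _ _ _ b M) ?leq_maxl // (@big_nat_widen _ _ _ _ b' M) ?leq_maxr //.
rewrite big_mkcond [leRHS]big_mkcond; apply: ler_sum => p _.
case: ifP => [/andP[/andP[/andP[-> /andP[-> ->]]]] //|_]; by case: ifP.
Qed.

Section ExplicitInequality.
Variables (R : realType) (n : nat) (g : {poly int}).
Hypotheses (gm : g \is monic) (sg : size g = n.+3).
Hypothesis irr_g : forall q : {poly rat}, q != 0 -> (size q <= n.+2)%N ->
  coprimep (map_poly intr g) q.
Variable P0 : nat.
Hypothesis sep_g : forall p, prime p -> (P0 < p)%N ->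
  coprimep (map_poly intr g : {poly 'F_p}) (map_poly intr g)^`().
Variables (X H : nat).
Hypotheses (X_gt0 : (0 < X)%N) (H_gt0 : (0 < H)%N).

Local Notation t := n.+2.
Local Notation box := {ffun 'I_t -> 'I_X}.
Let c := mul_mx_const n.+1 g.
Let D := P0`!.
(** [Z] bounds every norm. [W1], [W2], [W3] are the ideal counts with a short element of size [H],
    with an element of the set itself, and with a short element of size [X]. [e] is the number of
    ideals covering an exceptional set. *)
Let Z := (t`! * (c * (D * X + 1)) ^ t)%N.
Let W1 := ((X + 2 * t * (c * H)) ^ t)%N.
Let W2 := ((X + 2 * t * (c * (D * X + 1))) ^ t)%N.
Let W3 := ((X + 2 * t * (c * X)) ^ t)%N.
Let e := (2 ^ t + t)%N.
Local Notation lnn := (@natln R).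
Local Notation om p := #|root_set g p|.
Local Notation nrm := (box_norm g D).
Local Notation cr p B := (common_root_count g D p B).

Let D_gt0 : (0 < D)%N. Proof. exact: fact_gt0. Qed.

Let coprimeD p : prime p -> (P0 < p)%N -> coprime p D.
Proof.
move=> p_pr; rewrite /D prime_coprime //.
elim: P0 => [|k IH] kp; first by rewrite fact0 gtnNdvd // prime_gt1.
by rewrite factS Euclid_dvdM // negb_or IH ?(ltnW kp) // andbT gtnNdvd.
Qed.

Let dvdD p : prime p -> (p <= P0)%N -> (p %| D)%N.
Proof. by move=> p_pr pP; rewrite dvdn_fact // prime_gt0. Qed.

Let norm_gt0 (B : box) : (0 < nrm B)%N.
Proof.
rewrite absz_gt0; apply: (det_mul_mx_neq0 gm sg irr_g).
by apply/eqP => /rowP/(_ 0); rewrite shifted_vecE eqxx mxE => -[].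
Qed.

Let norm_le (B : box) : (nrm B <= Z)%N.
Proof.
rewrite -lez_nat abszE; apply: det_le; apply: (mul_mx_entry_le gm sg) => i.
by rewrite shifted_vecE ger0_norm // lez_nat addnC leq_add ?leq_b1 // leq_mul // ltnW.
Qed.

(** Primes up to [P0] divide [D], hence not the norm. If B is exceptional at p, the whole power of p
    in the norm is charged at most log Z; otherwise p occurs once and is paid for by a common
    root. *)
Let lnn_norm_le (B : box) : lnn (nrm B) <=
  \sum_(P0.+1 <= p < Z.+1 | prime p)
     ((cr p B)%:R * lnn p + (B \in exceptional_set n g D X p)%:R * lnn Z).
Proof.
rewrite lnn_factor // (bigID prime) /= [X in _ + X]big1 ?addr0; last first.
  by move=> p np; rewrite lognE (negPf np) mul0r.
rewrite (bigID (fun p => p %| nrm B)%N) /= [X in _ + X]big1 ?addr0; last first.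
  by move=> p /andP[_ np]; rewrite lognE (negPf np) !andbF mul0r.
have h p : prime p && (p %| nrm B)%N -> (P0 < p)%N.
  move=> /andP[p_pr dp]; have [nD _] := norm_prime_factor gm sg D_gt0 p_pr dp.
  by rewrite ltnNge; apply: contra nD; apply: dvdD.
have h' p : prime p && (p %| nrm B)%N -> (logn p (nrm B))%:R * lnn p <=
    (cr p B)%:R * lnn p + (B \in exceptional_set n g D X p)%:R * lnn Z.
  move=> /andP[p_pr dp]; have [_ [BE|[-> cr0]]] := norm_prime_factor gm sg D_gt0 p_pr dp.
    rewrite BE mul1r -lnnX ?prime_gt0 //.
    apply: ler_wpDl; first by rewrite mulr_ge0 ?lnn_ge0 ?ler0n.
    apply: lnn_le; first by rewrite expn_gt0 prime_gt0.
    by apply: leq_trans (norm_le B); apply: dvdn_leq => //; apply: pfactor_dvdnn.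
  apply: ler_wpDr; first by rewrite mulr_ge0 ?lnn_ge0 ?ler0n.
  by rewrite ler_wpM2r ?lnn_ge0 // ler_nat.
apply: le_trans (ler_sum _ (fun p hp => h' p hp)) _.
apply: le_trans (_ : \sum_(0 <= p < (nrm B).+1 | prime p && (P0.+1 <= p < Z.+1)%N)
  ((cr p B)%:R * lnn p + (B \in exceptional_set n g D X p)%:R * lnn Z) <= _).
  rewrite big_nat_cond [leRHS]big_nat_cond big_mkcond [leRHS]big_mkcond.
  apply: ler_sum => p _; case: ifP => [/andP[/andP[_ pN] hp]|_].
    have /andP[-> _] := hp; rewrite pN (h p hp) /= ltnS ifT //.
    by rewrite -ltnS (leq_trans pN) // ltnS norm_le.
  by case: ifP => // _; rewrite addr_ge0 ?mulr_ge0 ?lnn_ge0 ?ler0n.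
by apply: sum_subrange_le => p; rewrite addr_ge0 ?mulr_ge0 ?lnn_ge0 ?ler0n.
Qed.

Let sum_common_roots p W : prime p ->
  (forall r : int, (p %| g.[r])%Z -> (eval_count n.+1 D X p r * p <= W)%N) ->
  (\sum_(B : box) (cr p B)%:R) * lnn p <= W%:R * ((om p)%:R * lnn p / p%:R).
Proof.
move=> p_pr hW; have p0 := prime_gt0 p_pr.
have -> : W%:R * ((om p)%:R * lnn p / p%:R) = (W%:R * (om p)%:R / p%:R) * lnn p.
  by rewrite -!mulrA [lnn p * _]mulrC.
rewrite ler_wpM2r ?lnn_ge0 // ler_pdivlMr ?ltr0n // -natr_sum -!natrM ler_nat.
have -> : (\sum_(B : box) cr p B = \sum_(r in root_set g p) eval_count n.+1 D X p (r : nat)%:Z)%N.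
  pose Q (r : 'I_p) (B : box) := (p %| (rVpoly (shifted_vec D B)).[(r : nat)%:Z])%Z.
  transitivity (\sum_(B : box) \sum_(r in root_set g p | Q r B) 1)%N.
    by apply: eq_bigr => B _; rewrite sum1dep_card; apply: eq_card => r; rewrite !inE.
  rewrite (exchange_big_dep (mem (root_set g p))) /=; last by move=> B r _ /andP[].
  apply: eq_bigr => r rr; rewrite sum1dep_card; apply: eq_card => B.
  by rewrite !inE; rewrite !inE in rr; rewrite rr.
rewrite big_distrl /= mulnC -sum_nat_const; apply: leq_sum => r.
by rewrite inE => /hW.
Qed.

(** For p <= X the index of every ideal involved is at most X^t, so a short element with entries at
    most [X] exists and the bound [W3] is free of [D]. *)
Let bound_small p : prime p -> (P0 < p)%N -> (p <= X)%N ->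
  (#|exceptional_set n g D X p| * p ^ 2 <= e * W3)%N.
Proof.
move=> p_pr Pp pX; apply: (exceptional_count gm sg p_pr (coprimeD p_pr Pp) (sep_g p_pr Pp)).
  move=> h hm hg h2; apply: (rem_count_le gm sg irr_g) => //; first exact: coprimeD.
  have sgp : size (map_poly intr g : {poly 'F_p}) = n.+3.
    by rewrite size_map_poly_id0 // (monicP gm) oner_eq0.
  have hs : ((size h).-1 <= t)%N.
    rewrite -ltnS prednK ?(leq_trans _ h2) // -sgp; apply: dvdp_leq => //.
    by rewrite monic_neq0 // monic_map.
  apply: leq_ltn_trans (_ : (X ^ t < _)%N); last by rewrite ltn_exp2r.
  by apply: leq_trans (leq_pexp2l _ hs); rewrite ?leq_exp2r // -ltnS prednK ?(leq_trans _ h2).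
move=> s ds; apply: (eval_count_le gm sg irr_g).
- by rewrite -[1%N](exp1n 2) ltn_exp2r // prime_gt1.
- by rewrite coprime_pexpl // coprimeD.
- by rewrite -mulnn PoszM -expr2.
apply: leq_ltn_trans (_ : (X ^ 2 < _)%N); first by rewrite leq_exp2r.
by apply: leq_ltn_trans (_ : (X ^ t < _)%N); rewrite ?leq_pexp2l // ltn_exp2r.
Qed.

Let bound_large p : prime p -> (P0 < p)%N ->
  (#|exceptional_set n g D X p| * p ^ 2 <= e * W2)%N.
Proof.
move=> p_pr Pp; apply: (exceptional_count gm sg p_pr (coprimeD p_pr Pp) (sep_g p_pr Pp)).
  move=> h hm hg h2; apply: (rem_count_le_crude gm sg irr_g) => //; exact: coprimeD.
move=> s ds; apply: (eval_count_le_crude gm sg irr_g).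
- by rewrite -[1%N](exp1n 2) ltn_exp2r // prime_gt1.
- by rewrite coprime_pexpl // coprimeD.
- by rewrite -mulnn PoszM -expr2.
Qed.

Let sum_norms_ge : ((X ^ t)%:R - (X ^ n.+1 * (t * (2 * H)))%:R) * (t%:R * lnn H) <=
  \sum_(B : box) lnn (nrm B).
Proof.
pose S := [set B : box | (`|\det (mul_mx g (shifted_vec D B))| < Posz (H ^ t))%R].
have cS : (#|S| <= X ^ n.+1 * (t * (2 * H)))%N by exact: small_norm_count.
apply: le_trans (_ : \sum_(B : box | B \notin S) t%:R * lnn H <= _).
  rewrite sumr_const -[_ *+ #|_|]mulr_natl ler_wpM2r ?mulr_ge0 ?ler0n ?lnn_ge0 //.
  have -> : (X ^ t)%N = #|{: box}| by rewrite card_ffun !card_ord.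
  rewrite lerBlDr -natrD ler_nat -(cardC (mem S)) addnC leq_add //.
rewrite [leRHS](bigID (mem S)) /= ler_wpDl ?sumr_ge0 //.
  by move=> B _; apply: lnn_ge0.
apply: ler_sum => B; rewrite inE -leNgt => hB; rewrite -lnnX //.
apply: lnn_le; first by rewrite expn_gt0 H_gt0.
by rewrite -lez_nat abszE.
Qed.

(** The total of log |N(A)| over the box, bounded below by discarding small norms and above prime by
    prime: the roots of p <= H^t with the sharp count [W1], those of larger p with the crude count
    and at most t roots, and the exceptional elements with [W3] up to [X] and [W2] beyond. *)
Lemma explicit_inequality :
  ((X ^ t)%:R - (X ^ n.+1 * (t * (2 * H)))%:R) * (t%:R * lnn H) <=
  W1%:R * (\sum_(P0.+1 <= p < (H ^ t).+1 | prime p) (om p)%:R * lnn p / p%:R) +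
  W2%:R * (t%:R * \sum_((H ^ t).+1 <= p < Z.+1 | prime p) lnn p / p%:R) +
  lnn Z * (e%:R * (W3%:R * (\sum_(P0.+1 <= p < X.+1 | prime p) (p%:R ^+ 2)^-1) +
                   W2%:R * (\sum_(X.+1 <= p < Z.+1 | prime p) (p%:R ^+ 2)^-1))).
Proof.
apply: le_trans sum_norms_ge _.
apply: le_trans (ler_sum _ (fun B _ => lnn_norm_le B)) _.
rewrite exchange_big /=; under eq_bigr do rewrite big_split /=.
pose a p : R := W1%:R * ((om p)%:R * lnn p / p%:R).
pose b p : R := W2%:R * (t%:R * (lnn p / p%:R)).
pose u p : R := lnn Z * (e%:R * (W3%:R * (p%:R ^+ 2)^-1)).
pose v p : R := lnn Z * (e%:R * (W2%:R * (p%:R ^+ 2)^-1)).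
have pos p : [/\ 0 <= a p, 0 <= b p, 0 <= u p & 0 <= v p].
  by split; rewrite !mulr_ge0 ?invr_ge0 ?exprn_ge0 ?ler0n ?lnn_ge0.
have main p : prime p && (P0.+1 <= p < Z.+1)%N ->
    \sum_(B : box) (cr p B)%:R * lnn p +
    \sum_(B : box) (B \in exceptional_set n g D X p)%:R * lnn Z <=
    (if (P0.+1 <= p < (H ^ t).+1)%N then a p else 0) +
    (if ((H ^ t).+1 <= p < Z.+1)%N then b p else 0) +
    ((if (P0.+1 <= p < X.+1)%N then u p else 0) +
     (if (X.+1 <= p < Z.+1)%N then v p else 0)).
  move=> /andP[p_pr /andP[Pp pZ]]; rewrite Pp pZ /= !andbT.
  have p0 : 0 < p%:R :> R by rewrite ltr0n prime_gt0.
  apply: lerD.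
    rewrite -mulr_suml !ltnS; case: (leqP p (H ^ t)) => pH.
      rewrite addr0; apply: sum_common_roots => // r dr.
      apply: (eval_count_le gm sg irr_g) => //; rewrite ?prime_gt1 ?coprimeD //.
      by apply: leq_ltn_trans pH _; rewrite ltn_exp2r.
    rewrite add0r; apply: le_trans (_ : W2%:R * ((om p)%:R * lnn p / p%:R) <= _).
      apply: sum_common_roots => // r dr.
      by apply: (eval_count_le_crude gm sg irr_g) => //; rewrite ?prime_gt1 ?coprimeD.
    rewrite /b -mulrA ler_wpM2l ?ler0n // ler_wpM2r ?divr_ge0 ?lnn_ge0 ?ler0n // ler_nat.
    by have := roots_prime_le p_pr gm; rewrite sg.
  have -> : \sum_(B : box) (B \in exceptional_set n g D X p)%:R * lnn Z =
      lnn Z * #|exceptional_set n g D X p|%:R.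
    rewrite -mulr_suml mulrC -sum1_card natr_sum [in RHS]big_mkcond.
    by congr (_ * _); apply: eq_bigr => B _; case: (B \in _).
  have EW W : (#|exceptional_set n g D X p| * p ^ 2 <= e * W)%N ->
      lnn Z * #|exceptional_set n g D X p|%:R <= lnn Z * (e%:R * (W%:R * (p%:R ^+ 2)^-1)).
    move=> h; rewrite ler_wpM2l ?lnn_ge0 // mulrA ler_pdivlMr ?exprn_gt0 //.
    by rewrite -natrX -!natrM ler_nat.
  rewrite !ltnS; case: (leqP p X) => pX.
    by rewrite addr0; apply: EW; apply: bound_small.
  by rewrite add0r; apply: EW; apply: bound_large.
apply: le_trans (_ : \sum_(P0.+1 <= p < Z.+1 | prime p)
    ((if (P0.+1 <= p < (H ^ t).+1)%N then a p else 0) +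
    (if ((H ^ t).+1 <= p < Z.+1)%N then b p else 0) +
    ((if (P0.+1 <= p < X.+1)%N then u p else 0) +
     (if (X.+1 <= p < Z.+1)%N then v p else 0))) <= _).
  rewrite big_nat_cond [leRHS]big_nat_cond; apply: ler_sum => p /andP[pp p_pr].
  by apply: main; rewrite p_pr.
rewrite !big_split /= -!big_mkcondr.
have sub f x y : (forall p, 0 <= f p) ->
  \sum_(P0.+1 <= p < Z.+1 | prime p && (x <= p < y)%N) f p <= \sum_(x <= p < y | prime p) f p :> R.
  exact: sum_subrange_le.
rewrite mulrDr mulrDr; apply: lerD; first apply: lerD.
- by rewrite mulr_sumr; apply: sub => p; case: (pos p).
- by rewrite !mulr_sumr; apply: sub => p; case: (pos p).
by apply: lerD; rewrite !mulr_sumr; apply: sub => p; case: (pos p).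
Qed.
End ExplicitInequality.

(** * A lower Mertens bound for the roots of g *)

Section Mertens.
Variables (R : realType) (n : nat) (g : {poly int}).
Hypotheses (gm : g \is monic) (sg : size g = n.+3).
Hypothesis irr_g : forall q : {poly rat}, q != 0 -> (size q <= n.+2)%N ->
  coprimep (map_poly intr g) q.

Local Notation t := n.+2.
Local Notation lnn := (@natln R).
Local Notation om p := #|root_set g p|.

Definition root_log_sum (a b : nat) : R :=
  \sum_(a.+1 <= p < b.+1 | prime p) (om p)%:R * lnn p / p%:R.

Lemma root_log_sum_ge0 a b : 0 <= root_log_sum a b.
Proof. by apply: sumr_ge0 => p _; rewrite divr_ge0 ?mulr_ge0 ?lnn_ge0 ?ler0n. Qed.

Lemma sum_widen_le (a b b' : nat) (P : pred nat) (f : nat -> R) :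
  (forall p, 0 <= f p) -> (b <= b')%N ->
  \sum_(a <= p < b | P p) f p <= \sum_(a <= p < b' | P p) f p.
Proof.
move=> f0 bb'; rewrite (@big_nat_widen _ _ _ _ b b') //.
rewrite big_mkcond [leRHS]big_mkcond; apply: ler_sum => p _.
by case: (P p) => //=; case: ifP.
Qed.

Lemma root_log_sum_le a b b' : (b <= b')%N -> root_log_sum a b <= root_log_sum a b'.
Proof.
move=> bb'; apply: sum_widen_le => // p.
by rewrite divr_ge0 ?mulr_ge0 ?lnn_ge0 ?ler0n.
Qed.

Lemma separable_g : exists P0 : nat, forall p, prime p -> (P0 < p)%N ->
  coprimep (map_poly intr g : {poly 'F_p}) (map_poly intr g)^`().
Proof.
apply: separable_mod_large_primes.
have sgp : size (map_poly intr g : {poly rat}) = n.+3.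
  by rewrite size_map_poly_id0 // (monicP gm) oner_eq0.
have gpm : map_poly intr g \is @monic rat by exact: monic_map.
apply: irr_g; last by rewrite -ltnS -sgp lt_size_deriv // -size_poly_gt0 sgp.
apply/eqP => /(congr1 (fun q : {poly rat} => q`_n.+1)); rewrite coef_deriv coef0.
have /monicP := gpm; rewrite lead_coefE sgp /= => ->.
by move/eqP; rewrite pnatr_eq0.
Qed.

Lemma expr1D_le (y : R) k : 0 <= y <= 1 -> (1 + y) ^+ k <= 1 + (3 ^ k)%:R * y.
Proof.
move=> /andP[y0 y1]; elim: k => [|k IH]; first by rewrite expr0 lerDl mulr_ge0.
rewrite exprS expnS natrM.
apply: le_trans (_ : (1 + y) * (1 + (3 ^ k)%:R * y) <= _).
  by rewrite ler_wpM2l ?addr_ge0.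
have : 1 <= (3 ^ k)%:R :> R by rewrite ler1n expn_gt0.
set z : R := (3 ^ k)%:R => z1.
have h1 : 0 <= y * (z - 1) by rewrite mulr_ge0 // subr_ge0.
have h2 : 0 <= z * y * (1 - y) by rewrite !mulr_ge0 // subr_ge0.
by move: h1 h2; clearbody z; lra.
Qed.

Lemma exists_nat_ge (x : R) : exists2 N : nat, (0 < N)%N & x <= N%:R.
Proof.
exists (Num.truncn x).+1 => //; exact/ltW/truncnS_gt.
Qed.

(** [P0] stays free above [P1] because the count of pairs will impose further lower bounds on it.
    Each step loses a multiple of [d] in [explicit_inequality], divided by the volume X^t of the
    box. *)
Lemma mertens_lower (eps : R) : 0 < eps ->
  exists P1, forall P0, (P1 <= P0)%N -> exists X0, forall X, (X0 <= X)%N ->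
    (1 - eps) * (t%:R * lnn X) <= root_log_sum P0 (X ^ t).
Proof.
move=> eps0; pose d := Num.min eps 1 / 8%:R.
have m0 : 0 < Num.min eps 1 by rewrite lt_min eps0 ltr01.
have d0 : 0 < d by rewrite divr_gt0.
have d1 : d <= 1 / 8%:R by rewrite /d ler_wpM2r ?invr_ge0 ?ler0n // ge_min lexx orbT.
have deps : 5%:R * d <= eps.
  have : Num.min eps 1 <= eps by rewrite ge_min lexx.
  rewrite /d; lra.
have [P1 sep] := separable_g.
pose c := mul_mx_const n.+1 g; pose e := (2 ^ t + t)%N.
(* [Q] is the ratio of [X] to [H]. The three summands ensure that small norms take at most a
   proportion [d] of the box, that W1 <= (1 + d) X^t, and that the auxiliary [y] is at most 1. *)
have [Q Q0 hQ] := exists_nat_ge (((2 * t)%:R + (2 * t * c)%:R * (3 ^ t)%:R + (2 * t * c)%:R) / d).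
pose w3 := ((1 + 2 * t * c) ^ t)%N.
(* As [w3] does not involve [D], this choice can precede that of [P0], on which [D] depends. *)
have [P2 P20 hP2] := exists_nat_ge ((e * w3)%:R / d).
exists (maxn P1 P2) => P0; rewrite geq_max => /andP[P01 P02].
have P00 : (0 < P0)%N by apply: leq_trans P02.
pose D := P0`!; pose w2 := ((1 + 2 * t * (c * (D + 1))) ^ t)%N.
(* Norms are at most z0 X^t <= k H^t <= 2^k H^t, so the primes above H^t lie in [k] dyadic blocks.
   The added 1 keeps [z0] positive. *)
pose z0 := (t`! * (c * (D + 1)) ^ t + 1)%N.
pose k := (z0 * (2 * Q) ^ t)%N.
(* [K] gathers the terms that stay bounded as X grows; [X2] makes it at most [d * lnn X]. *)
pose K : R := t%:R * lnn (2 * Q) + w2%:R * (t%:R * (k%:R * (2%:R * lnn 2))) + 2%:R * d * lnn z0.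
have [X1 X10 hX1] := exists_nat_ge ((e * w2)%:R / d).
have [X2 hX2] := lnn_unbounded (K / d).
exists (maxn (maxn Q X1) X2) => X; rewrite !geq_max => /andP[/andP[QX X1X] X2X].
have X0 : (0 < X)%N by apply: leq_trans QX.
pose H := (X %/ Q)%N.
have H0 : (0 < H)%N by rewrite divn_gt0.
have HQ : (H * Q <= X)%N by exact: leq_trunc_div.
have XH : (X <= 2 * Q * H)%N.
  by have := ltn_ceil X Q0; rewrite -/H; clear -H0; nia.
have HX : (H <= X)%N by exact: leq_div.
have := @explicit_inequality R n g gm sg irr_g P0 (fun p pp pP => sep p pp (leq_ltn_trans P01
  pP)) X H X0 H0.
rewrite -/c -/D -/e -/(root_log_sum P0 (H ^ t)).
set Z := (t`! * _)%N; set W1 := ((X + 2 * t * (c * H)) ^ t)%N.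
set W2 := ((X + 2 * t * (c * (D * X + 1))) ^ t)%N; set W3 := ((X + 2 * t * (c * X)) ^ t)%N.
set S := root_log_sum P0 (H ^ t); set T1 := \sum_(_ <= p < _ | _) lnn p / _.
set U1 := \sum_(P0.+1 <= p < _ | _) _; set U2 := \sum_(X.+1 <= p < _ | _) _ => main.
pose N : R := (X ^ t)%:R.
have N0 : 0 < N by rewrite ltr0n expn_gt0 X0.
have DX : (D * X + 1 <= (D + 1) * X)%N by rewrite mulnDl mul1n leq_add2l.
have aux a b : (a <= b * X -> (X + 2 * t * (c * a)) ^ t <= X ^ t * (1 + 2 * t * (c * b)) ^ t)%N.
  move=> ab; rewrite -expnMn leq_exp2r // [leqRHS]mulnDr muln1 leq_add2l.
  apply: leq_trans (_ : 2 * t * (c * (b * X)) <= _)%N; first by rewrite !leq_mul.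
  by rewrite (mulnCA X) (mulnCA X c) (mulnC X b).
have bW2 : W2%:R <= N * w2%:R by rewrite /N -natrM ler_nat aux.
have bW3 : W3%:R <= N * w3%:R.
  by rewrite /N -natrM ler_nat; have := @aux X 1%N; rewrite mul1n muln1; apply.
have Qd : (2 * t)%:R + (2 * t * c)%:R * (3 ^ t)%:R + (2 * t * c)%:R <= Q%:R * d.
  by rewrite -ler_pdivrMr.
have QR : 0 < Q%:R :> R by rewrite ltr0n.
have XR : 0 < X%:R :> R by rewrite ltr0n.
pose y : R := (2 * t * c)%:R / Q%:R.
have y0 : 0 <= y by rewrite divr_ge0.
have y3 : (3 ^ t)%:R * y <= d.
  rewrite /y mulrA ler_pdivrMr // mulrC [d * _]mulrC; apply: le_trans Qd.
  by rewrite -addrA [X in _ + X]addrC addrA lerDr addr_ge0.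
have y1 : y <= 1.
  rewrite /y ler_pdivrMr // mul1r; apply: (@le_trans _ _ (Q%:R * d)).
    by apply: le_trans Qd; rewrite lerDr addr_ge0 ?mulr_ge0.
  by rewrite ler_piMr ?ler0n //; apply: le_trans d1 _; lra.
have hR : H%:R * Q%:R <= X%:R :> R by rewrite -natrM ler_nat.
have bW1 : W1%:R <= N * (1 + d).
  apply: le_trans (_ : (X%:R * (1 + y)) ^+ t <= _); last first.
    rewrite exprMn /N natrX ler_wpM2l ?exprn_ge0 //.
    by apply: le_trans (expr1D_le _ _) _; rewrite ?y0 ?y1 // lerD2l.
  rewrite natrX lerXn2r ?nnegrE ?ler0n ?mulr_ge0 ?addr_ge0 //.
  rewrite mulrDr mulr1 natrD lerD2l mulnA natrM.
  by rewrite /y mulrCA ler_wpM2l // ler_pdivlMr.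
have bA : (X ^ n.+1 * (t * (2 * H)))%:R <= N * d.
  rewrite /N [(X ^ t)%N]expnS [(X * _)%N]mulnC !natrM -!mulrA ler_wpM2l ?ler0n //.
  have Qd1 : (2 * t)%:R <= Q%:R * d.
    by apply: le_trans Qd; rewrite -addrA lerDl addr_ge0 ?mulr_ge0.
  have : (2 * t)%:R * H%:R <= Q%:R * d * H%:R by rewrite ler_wpM2r.
  have : d * (H%:R * Q%:R) <= d * X%:R by rewrite ler_wpM2l // ltW.
  rewrite natrM; lra.
have X1R : X1%:R <= X%:R :> R by rewrite ler_nat.
have P2R : P2%:R <= P0%:R :> R by rewrite ler_nat.
have P0R : 0 < P0%:R :> R by rewrite ltr0n.
have bE3 : (e * w3)%:R * U1 <= d.
  apply: le_trans (_ : (e * w3)%:R * P0%:R^-1 <= _).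
    by rewrite ler_wpM2l ?ler0n // sum_inv_square_le.
  by rewrite ler_pdivrMr // mulrC -ler_pdivrMr // (le_trans hP2).
have bE2 : (e * w2)%:R * U2 <= d.
  apply: le_trans (_ : (e * w2)%:R * X%:R^-1 <= _).
    by rewrite ler_wpM2l ?ler0n // sum_inv_square_le.
  by rewrite ler_pdivrMr // mulrC -ler_pdivrMr // (le_trans hX1).
have U10 : 0 <= U1 by apply: sumr_ge0 => p _; rewrite invr_ge0 exprn_ge0.
have U20 : 0 <= U2 by apply: sumr_ge0 => p _; rewrite invr_ge0 exprn_ge0.
have Zz : (Z <= z0 * X ^ t)%N.
  rewrite /Z /z0 mulnDl -mulnA -expnMn; apply: leq_trans (leq_addr _ _).
  by rewrite leq_mul // leq_exp2r // -mulnA leq_mul.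
have Hk : (z0 * X ^ t <= k * H ^ t)%N.
  by rewrite /k -mulnA -expnMn leq_mul // leq_exp2r.
have bT : T1 <= k%:R * (2%:R * lnn 2).
  apply: le_trans (mertens_tail R k (_ : (0 < H ^ t)%N)); last by rewrite expn_gt0 H0.
  apply: sum_widen_le => [p|]; first by rewrite divr_ge0 ?lnn_ge0.
  rewrite ltnS; apply: leq_trans Zz (leq_trans Hk _).
  by rewrite leq_mul // ltnW // ltn_expl.
have bL : lnn X <= lnn (2 * Q) + lnn H.
  by rewrite -lnnM ?muln_gt0 // lnn_le.
have z00 : (0 < z0)%N by rewrite /z0 addn1.
have bZ : lnn Z <= lnn z0 + t%:R * lnn X.
  rewrite -lnnX // -lnnM ?expn_gt0 ?X0 //.
  have [Z0|Z0] := posnP Z; last exact: lnn_le.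
  by rewrite Z0 {1}/natln ln0 ?lnn_ge0.
have K0 : K <= d * lnn X by rewrite mulrC -ler_pdivrMr // hX2.
have S0 : 0 <= S by exact: root_log_sum_ge0.
have L0 : 0 <= lnn X by exact: lnn_ge0.
have LH0 : 0 <= lnn H by exact: lnn_ge0.
have LZ0 : 0 <= lnn Z by exact: lnn_ge0.
have q0 : 0 <= lnn (2 * Q) by exact: lnn_ge0.
have t1 : 1 <= t%:R :> R by rewrite ler1n.
have dle : d <= 1 by apply: le_trans d1 _; rewrite ler_pdivrMr ?mul1r ?ler1n.
apply: le_trans (root_log_sum_le P0 (_ : (H ^ t <= X ^ t)%N)); last by rewrite leq_exp2r.
rewrite -/S.
have lhs : N * ((1 - d) * (t%:R * (lnn X - lnn (2 * Q)))) <=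
    ((X ^ t)%:R - (X ^ n.+1 * (t * (2 * H)))%:R) * (t%:R * lnn H).
  apply: le_trans (_ : (N * (1 - d)) * (t%:R * lnn H) <= _).
    by rewrite -[leRHS]mulrA !ler_wpM2l ?subr_ge0 ?ler0n // lerBlDl.
  rewrite ler_wpM2r ?mulr_ge0 ?ler0n // mulrBr mulr1 lerD2l lerN2.
  exact: bA.
have rhs : W1%:R * S + W2%:R * (t%:R * T1) + lnn Z * (e%:R * (W3%:R * U1 + W2%:R * U2)) <=
    N * ((1 + d) * S + w2%:R * (t%:R * (k%:R * (2%:R * lnn 2))) +
         (lnn z0 + t%:R * lnn X) * (2%:R * d)).
  rewrite !mulrDr; apply: lerD; first apply: lerD.
  - by rewrite mulrA ler_wpM2r.
  - rewrite [leRHS]mulrA ler_pM ?mulr_ge0 ?ler0n //.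
      by apply: sumr_ge0 => p _; rewrite divr_ge0 ?lnn_ge0.
    by rewrite ler_wpM2l ?ler0n.
  have -> : e%:R * (W3%:R * U1) = (e%:R * U1) * W3%:R by rewrite -mulrA [U1 * _]mulrC.
  have -> : e%:R * (W2%:R * U2) = (e%:R * U2) * W2%:R by rewrite -mulrA [U2 * _]mulrC.
  rewrite -mulrDr mulrCA; apply: ler_pM => //.
    by rewrite addr_ge0 ?mulr_ge0 ?ler0n.
  have h3 : e%:R * U1 * W3%:R <= N * d.
    apply: le_trans (_ : (e%:R * U1) * (N * w3%:R) <= _); first by rewrite ler_wpM2l ?mulr_ge0.
    rewrite mulrCA ler_wpM2l ?ler0n //; apply: le_trans bE3; by rewrite natrM mulrAC.
  have h2 : e%:R * U2 * W2%:R <= N * d.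
    apply: le_trans (_ : (e%:R * U2) * (N * w2%:R) <= _); first by rewrite ler_wpM2l ?mulr_ge0.
    rewrite mulrCA ler_wpM2l ?ler0n //; apply: le_trans bE2; by rewrite natrM mulrAC.
  by apply: le_trans (lerD h3 h2) _; rewrite [2%:R * d]mulr_natl mulrDr.
have := le_trans lhs (le_trans main rhs); rewrite ler_pM2l // => {lhs rhs main} fin.
have tq : (1 - d) * (t%:R * lnn (2 * Q)) <= t%:R * lnn (2 * Q).
  by rewrite ler_piMl ?mulr_ge0 ?ler0n // gerBl ltW.
have tL : d * lnn X <= d * (t%:R * lnn X).
  by rewrite ler_pM2l // ler_peMl.
have tL0 : 0 <= t%:R * lnn X by rewrite mulr_ge0.
rewrite /K in K0; move: fin tq tL K0 tL0 S0.
set L := t%:R * lnn X; set q := t%:R * lnn (2 * Q); set M := w2%:R * _; set z := lnn z0.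
rewrite mulrBr -/L -/q => fin tq tL K0 tL0 S0.
have fin2 : (1 - 4%:R * d) * L <= (1 + d) * S.
  move: fin tq tL K0. by clearbody L q M z S d; move: (lnn X) => lx; lra.
(* (1 + d)(1 - 5 d) <= 1 - 4 d, so one more [d] removes the factor 1 + d. *)
have : (1 + d) * ((1 - 5%:R * d) * L) <= (1 + d) * S.
  apply: le_trans fin2; have d0' := ltW d0.
  have : 0 <= d * d * L by rewrite mulr_ge0 // mulr_ge0.
  by clearbody L d; lra.
rewrite ler_pM2l ?addr_gt0 //; apply: le_trans; rewrite ler_wpM2r // lerD2l lerN2.
exact: deps.
Qed.
End Mertens.

(** * Pairs on a line modulo p *)

Lemma det_mx2 (R : comNzRingType) (M : 'M[R]_2) :
  \det M = M 0 0 * M 1 1 - M 0 1 * M 1 0.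
Proof.
rewrite (expand_det_row _ 0) !big_ord_recl big_ord0 /cofactor !det_mx11 !mxE /=.
have -> : lift 0 0 = 1 :> 'I_2 by apply/val_inj.
have -> : lift 1 0 = 0 :> 'I_2 by apply/val_inj.
by rewrite /= expr0 expr1; ring.
Qed.

Section LineMod.
Variables (p : nat) (c r : int).
(** With [c] the leading coefficient of F(S, 1) and [r] a root of its monic model, r / c is a root
    of F(S, 1) modulo p. The kernel is the lattice of pairs (a, b) with c a = r b, which avoids
    dividing by c. *)
Definition line_mod (v : 'rV[int]_2) : 'Z_p := (c * v 0 0 - r * v 0 1)%:~R.
Lemma line_mod_is_additive : zmod_morphism line_mod.
Proof. by move=> u v; rewrite /line_mod -intrB; congr (_%:~R); rewrite !mxE; ring. Qed.
HB.instance Definition _ := GRing.isZmodMorphism.Build _ _ line_mod line_mod_is_additive.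

Hypotheses (p1 : (1 < p)%N) (cp : coprimez c p).

Lemma line_mod_onto tau : exists v, line_mod v = tau.
Proof.
have [u [v E]] := Bezoutz c p.
move: cp; rewrite /coprimez => /eqP c1; rewrite c1 in E.
exists (\row_j if j == 0 then u * (val tau)%:Z else 0).
rewrite /line_mod !mxE /= mulr0 subr0 mulrA [c * u]mulrC.
have -> : u * c = 1 - v * p%:Z by rewrite -E addrK.
rewrite mulrBl mul1r intrB !intrM -[(Posz p)%:~R]/(p%:R) pchar_Zp // mulr0 mul0r subr0.
exact: natr_Zp.
Qed.

Lemma line_mod_eq0 v : (line_mod v == 0) = (p %| (c * v 0%R 0%R - r * v 0%R 1%R)%R)%Z.
Proof. by rewrite dvdz_Zp. Qed.

(** Thue's lemma for a rectangle. *)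
Lemma line_pigeonhole a b : (p < a.+1 * b.+1)%N ->
  exists v : 'rV[int]_2, [/\ v != 0, line_mod v = 0, `|v 0 0| <= a%:Z & `|v 0 1| <= b%:Z].
Proof.
move=> pab.
pose vec (u : 'I_a.+1 * 'I_b.+1) : 'rV[int]_2 :=
  \row_j if j == 0 then (u.1 : nat)%:Z else (u.2 : nat)%:Z.
have [|[i j] [[i' j'] [ne E]]] := @pigeonhole _ _ (fun u => line_mod (vec u)).
  by rewrite card_prod !card_ord Zp_cast.
exists (vec (i, j) - vec (i', j')); split.
- apply: contraNneq ne => /eqP; rewrite subr_eq0 => /eqP /rowP h.
  have := h 0; have := h 1; rewrite !mxE /= => -[e1] [e2].
  by rewrite xpair_eqE -!val_eqE /= e1 e2 !eqxx.
- by rewrite raddfB /= E subrr.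
- rewrite !mxE /=; have := ltn_ord i; have := ltn_ord i'; move: (i : nat) (i' : nat) => x y; lia.
- rewrite !mxE /=; have := ltn_ord j; have := ltn_ord j'; move: (j : nat) (j' : nat) => x y; lia.
Qed.

Variables (X Q : nat).
Hypothesis Q0 : (0 < Q)%N.

(* No nonzero vector of the lattice has sup norm at most [sqrt p / Q]. *)
Definition no_short_vector := forall v : 'rV[int]_2, v != 0 -> line_mod v = 0 ->
  forall M : nat, `|v 0 0| <= M%:Z -> `|v 0 1| <= M%:Z -> (p < (M * Q) ^ 2)%N.

(** Let L be the integer part of sqrt p / Q, and A that of p / (L + 1). Thue's lemma in the
    rectangles A by L and L by A gives v and w; as neither is short, |v_0| > L and |w_1| > L, so
    their determinant is nonzero. They span a sublattice with entries at most A, where A < Q sqrt p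
    <= X / Q, to which [card_fiber_ge] applies. *)
Lemma line_count_ge tau : no_short_vector -> (4 <= Q)%N -> (p * Q ^ 4 <= X ^ 2)%N ->
  exists2 A : nat, (A * Q <= X)%N &
  ((X - 4 * A) ^ 2 <= #|[set B : {ffun 'I_2 -> 'I_X} | line_mod (box_vec B) == tau]| * p)%N.
Proof.
move=> ns Q4 pX; have p0 : (0 < p)%N by apply: ltnW.
have [L LQ Lmax] : exists2 L : nat, ((L * Q) ^ 2 <= p)%N & (p < (L.+1 * Q) ^ 2)%N.
  have ex0 : exists L, ((L * Q) ^ 2 <= p)%N by exists 0%N.
  have bnd L : ((L * Q) ^ 2 <= p)%N -> (L <= p)%N.
    apply: leq_trans; apply: leq_trans (leq_pmulr L Q0) _.
    by case: (L * Q)%N => // k; rewrite -mulnn leq_pmulr.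
  case: (ex_maxnP ex0 bnd) => L h1 h2; exists L => //.
  by rewrite ltnNge; apply/negP => /h2; rewrite ltnn.
pose A := (p %/ L.+1)%N.
have AL : (A * L.+1 <= p)%N by exact: leq_trunc_div.
have AL' : (p < A.+1 * L.+1)%N by rewrite ltn_ceil.
have big_coord (v : 'rV[int]_2) : v != 0 -> line_mod v = 0 ->
    ~~ ((`|v 0 0| <= L%:Z) && (`|v 0 1| <= L%:Z)).
  move=> v0 lv; apply/negP => /andP[h1 h2].
  by have := ns v v0 lv L h1 h2; rewrite ltnNge LQ.
have [v [v0 lv va vb]] := line_pigeonhole AL'.
have [w [w0 lw wa wb]] : exists v : 'rV[int]_2,
    [/\ v != 0, line_mod v = 0, `|v 0 0| <= L%:Z & `|v 0 1| <= A%:Z].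
  by apply: line_pigeonhole; rewrite mulnC.
have va' : L%:Z < `|v 0 0| by have := big_coord v v0 lv; rewrite vb andbT -ltNge.
have wb' : L%:Z < `|w 0 1| by have := big_coord w w0 lw; rewrite wa /= -ltNge.
have LA : (L <= A)%N by rewrite -lez_nat ltW // (lt_le_trans va').
pose V : 'M[int]_2 := \matrix_(i, j) if i == 0 then v 0 j else w 0 j.
have dV : \det V != 0.
  rewrite det_mx2 !mxE /= subr_eq0; apply/eqP => E.
  have := congr1 (fun x => `|x|) E; rewrite !normrM.
  have h1 : `|v 0 1| * `|w 0 0| <= L%:Z * L%:Z by apply: ler_pM.
  have h2 : L%:Z * L%:Z < `|v 0 0| * `|w 0 1| by apply: ltr_pM.
  by move=> E'; move: (le_lt_trans h1 h2); rewrite E' ltxx.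
have bV i j : `|V i j| <= A%:Z.
  rewrite mxE; have LA' : L%:Z <= A%:Z by rewrite lez_nat.
  have -> : j = if j == 0 then 0 else 1 by case: j => -[|[|//]] ?; apply/val_inj.
  by case: ifP => _; case: ifP => _ //; apply: (le_trans _ LA').
have AQ : (A * Q < X)%N.
  rewrite -(ltn_sqr (A * Q)) expnMn; apply: leq_trans pX.
  have : (A ^ 2 * L.+1 ^ 2 < p * Q ^ 2 * L.+1 ^ 2)%N.
    rewrite -expnMn; apply: (@leq_ltn_trans (p ^ 2)); first by rewrite leq_sqr.
    by rewrite -mulnn -mulnA ltn_pmul2l // -expnMn mulnC.
  by rewrite ltn_pmul2r ?expn_gt0 // -[4%N]/(2 + 2)%N expnD mulnA ltn_pmul2r ?expn_gt0 ?Q0.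
exists A; first exact: ltnW.
have cardT : #|'Z_p| = p by rewrite card_ord Zp_cast.
have h : (2 * 2 * A <= X)%N by nia.
have rowV (q : 'rV[int]_2) : line_mod (q *m V) = 0.
  apply/eqP; rewrite line_mod_eq0 // !mxE !big_ord_recl !big_ord0 !mxE /= !addr0.
  have {}lv : (p %| (c * v 0%R 0%R - r * v 0%R 1%R)%R)%Z by rewrite -line_mod_eq0 lv.
  have {}lw : (p %| (c * w 0%R 0%R - r * w 0%R 1%R)%R)%Z by rewrite -line_mod_eq0 lw.
  set q0 := q 0 _; set q1 := q 0 _.
  set E := (X in (_ %| X)%Z);
    have -> : E = q0 * (c * v 0 0 - r * v 0 1) + q1 * (c * w 0 0 - r * w 0 1).
    by rewrite /E; ring.
  by rewrite rpredD // dvdz_mull.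
by have := @card_fiber_ge 2 'Z_p line_mod V A line_mod_onto rowV dV bV X tau h; rewrite cardT.
Qed.

End LineMod.

Lemma ord_dvd_sub_inj p (r1 r2 : 'I_p) : (p %| Posz r1 - Posz r2)%Z -> r1 = r2.
Proof.
rewrite dvdzE /= => h; apply/val_inj/eqP; apply: contraLR h => /= ne.
have := ltn_ord r1; have := ltn_ord r2; move: ne.
move: (r1 : nat) (r2 : nat) => x y ne ly lx.
by rewrite gtnNdvd //; lia.
Qed.

(** * Pairs whose value is divisible by p *)

Section PairCounts.
Variables (g : {poly int}) (c : int) (F : int -> int -> int) (t C P0 : nat).
Hypotheses (F_neq0 : forall a b : int, (a != 0) || (b != 0) -> F a b != 0)
  (F_le : forall (M : nat) (a b : int), `|a| <= M%:Z -> `|b| <= M%:Z -> (`|F a b|%N <= C * M ^ t)%N)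
  (F_dvd : forall (p : nat) (s a b : int), prime p -> (P0 < p)%N -> (p %| g.[s])%Z ->
     (p %| c * a - s * b)%Z -> (p %| F a b)%Z)
  (c_coprime : forall p, prime p -> (P0 < p)%N -> coprimez c p).
Variables (X Q : nat).
Hypotheses (X0 : (0 < X)%N) (Q4 : (4 <= Q)%N).
Let Q0 : (0 < Q)%N. Proof. exact: leq_trans Q4. Qed.

Local Notation box := {ffun 'I_2 -> 'I_X}.
Local Notation sbox := {ffun 'I_2 -> 'I_(2 * X).+1}.

(** Ordinals start at 0, so the successors of the coordinates run over [1, X]. *)
Definition pair_hits p : nat :=
  #|[set B : box | (p %| F (B 0%R).+1 (B 1%R).+1)%Z]|.

Let on_line (p : nat) (r : int) (B : box) := (p %| c * Posz (B 0%R).+1 - r * Posz (B 1%R).+1)%Z.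

(** Requiring that p does not divide b makes the lines of distinct roots disjoint, so their counts
    may be added. *)
Let good_count (p : nat) (r : int) : nat :=
  #|[set B : box | ~~ (p %| (B 1%R).+1)%N && on_line p r B]|.

Lemma sum_good_count_le p : prime p -> (P0 < p)%N ->
  (\sum_(r in root_set g p) good_count p (r : nat)%:Z <= pair_hits p)%N.
Proof.
move=> p_pr Pp.
pose T (r : 'I_p) (B : box) := ~~ (p %| (B 1%R).+1)%N && on_line p (r : nat)%:Z B.
have -> : (\sum_(r in root_set g p) good_count p (r : nat)%:Z =
    \sum_(B : box) #|[set r in root_set g p | T r B]|)%N.
  transitivity (\sum_(r in root_set g p) \sum_(B : box | T r B) 1)%N.
    by apply: eq_bigr => r _; rewrite sum1dep_card.
  rewrite (exchange_big_dep predT) //=; apply: eq_bigr => B _.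
  by rewrite sum1dep_card; apply: eq_card => r; rewrite !inE.
rewrite /pair_hits -sum1_card [X in (_ <= X)%N]big_mkcond /=; apply: leq_sum => B _.
have [->|[r]] := set_0Vmem [set r in root_set g p | T r B]; first by rewrite cards0.
rewrite !inE => /andP[gr /andP[nB lB]]; rewrite (F_dvd p_pr Pp gr lB).
apply/card_le1_eqP => r1 r2; rewrite !inE => /andP[_ /andP[_ l1]] /andP[_ /andP[_ l2]].
have : (p %| (Posz r1 - Posz r2) * Posz (B 1%R).+1)%Z.
  have -> : (Posz r1 - Posz r2) * Posz (B 1).+1 =
    (c * Posz (B 0).+1 - Posz r2 * Posz (B 1).+1) - (c * Posz (B 0).+1 - Posz r1 * Posz (B 1).+1).
    by ring.
  by rewrite rpredB.
rewrite dvdzE /= abszM Euclid_dvdM // (negPf nB) orbF => h.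
by apply/esym/ord_dvd_sub_inj; rewrite dvdzE.
Qed.

Lemma both_divisible_count p : (0 < p)%N ->
  (#|[set B : box | (p %| (B 0%R).+1)%N && (p %| (B 1%R).+1)%N]| <= (X %/ p) ^ 2)%N.
Proof.
move=> p0; set S := [set _ | _].
have h (B : box) i : (((B i).+1 %/ p).-1 < X %/ p)%N || ((B i).+1 %/ p == 0)%N.
  have : ((B i).+1 %/ p <= X %/ p)%N by rewrite leq_div2r.
  by case: (_ %/ p)%N => [|k ->] //=; rewrite orbT.
have hS B i : B \in S -> (p %| (B i).+1)%N.
  rewrite inE => /andP[h0 h1]; have -> // : i = if i == 0 then 0 else 1.
    by case: i => -[|[|//]] ?; apply/val_inj.
  by case: ifP.
case: (posnP (X %/ p)) => [z|Xp0].
  rewrite z; rewrite leqn0 cards_eq0; apply/eqP/setP => B; rewrite [RHS]inE; apply/negP => BS.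
  have /dvdnP[k E] := hS B 0 BS; have := leq_div2r p (ltn_ord (B 0)).
  by rewrite z leqn0 E mulnK // => /eqP k0; move: E; rewrite k0.
pose G' : box -> {ffun 'I_2 -> 'I_(X %/ p)} :=
  fun B => [ffun i => insubd (Ordinal Xp0) ((B i).+1 %/ p).-1].
have inj : {in S &, injective G'}.
  move=> B B' BS BS' /ffunP E; apply/ffunP => i; apply/val_inj/eqP; rewrite -eqSS; apply/eqP.
  have /dvdnP[k Ek] := hS B i BS; have /dvdnP[k' Ek'] := hS B' i BS'.
  have := congr1 val (E i); rewrite !ffunE !insubdK -?topredE /= ?Ek ?Ek' ?mulnK //.
  - have : (0 < k)%N by case: k Ek. have : (0 < k')%N by case: k' Ek'. by move=> ? ? ?;
    congr (_ * _)%N; lia.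
  - by have := h B' i; rewrite Ek' mulnK //; case: k' Ek' => // k' _; rewrite orbF.
  - by have := h B i; rewrite Ek mulnK //; case: k Ek => // k _; rewrite orbF.
rewrite -(card_in_imset inj); apply: leq_trans (max_card _) _.
by rewrite card_ffun !card_ord.
Qed.

(** Subtracting X from a box of side 2 X + 1 enumerates the vectors of sup norm at most X. All short
    vectors are among them, since p Q^4 <= X^2. *)
Definition short_vec (u : sbox) : 'rV[int]_2 := box_vec u - const_mx X%:Z.
Definition short_len (u : sbox) : nat := maxn `|short_vec u 0%R 0%R|%N `|short_vec u 0%R 1%R|%N.

Definition is_short (p : nat) (r : int) (u : sbox) := [&& short_vec u != 0,
   (p %| c * short_vec u 0%R 0%R - r * short_vec u 0%R 1%R)%Z & ((short_len u * Q) ^ 2 <= p)%N].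

Definition is_short_hit (p : nat) (u : sbox) := [&& short_vec u != 0,
   (p %| F (short_vec u 0%R 0%R) (short_vec u 0%R 1%R))%Z & ((short_len u * Q) ^ 2 <= p)%N].

Definition has_short (p : nat) (r : int) := [exists u : sbox, is_short p r u].

Lemma no_short p r : prime p -> (p * Q ^ 4 <= X ^ 2)%N -> ~~ has_short p r ->
  no_short_vector p c r Q.
Proof.
move=> p_pr pX /existsPn ns v v0 lv M h0 h1; rewrite ltnNge; apply/negP => hM.
have p1 := prime_gt1 p_pr.
have MX : (M <= X)%N.
  rewrite -leq_sqr; apply: leq_trans pX; apply: leq_trans (_ : (M * Q) ^ 2 <= _)%N.
    by rewrite leq_sqr leq_pmulr.
  by apply: leq_trans hM _; rewrite leq_pmulr // expn_gt0 Q0.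
have vi (i : 'I_2) : `|v 0 i| <= M%:Z.
  have -> : i = if i == 0 then 0 else 1 by case: i => -[|[|//]] ?; apply/val_inj.
  by case: ifP.
have [|u Eu] := @box_vecP 2 (2 * X).+1 (v + const_mx X%:Z).
  by move=> i; have := vi i; rewrite !mxE; move: (v 0 i) => x; lia.
have E : short_vec u = v by rewrite /short_vec Eu addrK.
have /negP := ns u; apply; rewrite /is_short /short_len E v0 /=.
move/eqP: lv; rewrite line_mod_eq0 // => -> /=.
apply: leq_trans hM; rewrite leq_sqr leq_mul2r; apply/orP; right.
by rewrite geq_max -!lez_nat !abszE h0 h1.
Qed.

(** A point of the line with p | b also has p | a, as c is prime to p; this bounds what [good_count]
    leaves out. *)
Lemma good_count_ge p r : prime p -> (P0 < p)%N -> (p * Q ^ 4 <= X ^ 2)%N ->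
  ~~ has_short p r -> exists2 A : nat, (A * Q <= X)%N &
  ((X - 4 * A) ^ 2 <= (good_count p r + (X %/ p) ^ 2) * p)%N.
Proof.
move=> p_pr Pp pX ns; have p1 := prime_gt1 p_pr.
(* The class of (-1, -1) accounts for the shift from [B] to its successors. *)
have [A AX hA] := line_count_ge p1 (c_coprime p_pr Pp) Q0
  (line_mod p c r (const_mx (-1))) (no_short p_pr pX ns) Q4 pX.
exists A => //; apply: leq_trans hA _; rewrite leq_mul2r; apply/orP; right.
apply: leq_trans (leq_add (leqnn _) (both_divisible_count (prime_gt0 p_pr))).
rewrite -(cardsID [set B : box | (p %| (B 1%R).+1)%N]) addnC leq_add //.
  apply/subset_leq_card/subsetP => B; rewrite !inE => /andP[-> /=].
  rewrite -subr_eq0 -raddfB line_mod_eq0 // !mxE !opprK /on_line.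
  by rewrite -!PoszD !addn1.
apply/subset_leq_card/subsetP => B; rewrite !inE => /andP[lB dB]; rewrite dB andbT.
move: lB; rewrite -subr_eq0 -raddfB line_mod_eq0 // !mxE !opprK -!PoszD !addn1 => lB.
have : (p %| c * Posz (B 0%R).+1)%Z.
  have -> : c * Posz (B 0).+1 = (c * Posz (B 0).+1 - r * Posz (B 1).+1) + r * Posz (B 1).+1.
    by rewrite subrK.
  by rewrite rpredD // dvdz_mull.
by rewrite Gauss_dvdzr // coprimez_sym c_coprime.
Qed.

(** A short vector has entries below p, so p | y would give y = 0, then p | x and x = 0. Hence y is
    invertible modulo p and the vector lies on the line of one root only. *)
Lemma short_count_le p u : prime p -> (P0 < p)%N ->
  (\sum_(r in root_set g p) is_short p (r : nat)%:Z u <= is_short_hit p u)%N.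
Proof.
move=> p_pr Pp; rewrite /is_short_hit; set x := short_vec u 0 0; set y := short_vec u 0 1.
have -> : (\sum_(r in root_set g p) is_short p (r : nat)%:Z u =
    #|[set r in root_set g p | is_short p (r : nat)%:Z u]|)%N.
  rewrite -sum1_card [RHS](eq_bigl (fun r => (r \in root_set g p) && is_short p (r : nat)%:Z u)).
    by rewrite -big_mkcondr.
  by move=> r; rewrite !inE.
have [->|[r]] := set_0Vmem [set r in root_set g p | is_short p (r : nat)%:Z u];
  first by rewrite cards0.
rewrite !inE => /andP[gr /and3P[u0 lu uQ]].
rewrite (F_dvd p_pr Pp gr lu) u0 uQ /=.
apply/card_le1_eqP => r1 r2; rewrite !inE => /andP[_ /and3P[_ l1 _]] /andP[_ /and3P[_ l2 _]].
have Mp : (short_len u < p)%N.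
  case: (posnP (short_len u)) => [->|M0]; first exact: prime_gt0.
  apply: leq_trans uQ; rewrite expnMn -[X in (X < _)%N]muln1.
  by rewrite -mulnn -mulnA ltn_pmul2l // -mulnn; nia.
have xM : (`|x| <= short_len u)%N by exact: leq_maxl.
have yM : (`|y| <= short_len u)%N by exact: leq_maxr.
have : (p %| (Posz r1 - Posz r2) * y)%Z.
  have -> : (Posz r1 - Posz r2) * y = (c * x - Posz r2 * y) - (c * x - Posz r1 * y) by ring.
  by rewrite rpredB.
have y0 : ~~ (p %| `|y|)%N.
  apply/negP => py; move: u0 => /negP; apply.
  have yz : y = 0.
    apply/eqP; rewrite -absz_eq0; apply: contraLR py => ny.
    by rewrite gtnNdvd ?lt0n // (leq_ltn_trans yM).
  have px : (p %| x)%Z.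
    move: l1; rewrite -/x -/y yz mulr0 subr0 Gauss_dvdzr // coprimez_sym; exact: c_coprime.
  have xz : x = 0.
    apply/eqP; rewrite -absz_eq0; apply: contraLR px => nx.
    by rewrite dvdzE /= gtnNdvd ?lt0n // (leq_ltn_trans xM).
  apply/eqP/rowP => j; rewrite [RHS]mxE.
  have -> : j = if j == 0 then 0 else 1 by case: j => -[|[|//]] ?; apply/val_inj.
  by case: ifP => _; [exact: xz|exact: yz].
rewrite dvdzE /= abszM Euclid_dvdM // (negPf y0) orbF => h.
by apply/esym/ord_dvd_sub_inj; rewrite dvdzE.
Qed.

Variable R : realType.
Local Notation lnn := (@natln R).

Lemma sum_inv_dist_le : \sum_(j < (2 * X).+1) (maxn 1 `|Posz j - X|%N)%:R^-1 <= 3%:R + 2%:R * lnn X.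
Proof.
pose f j : R := (maxn 1 `|Posz j - X|%N)%:R^-1.
rewrite -(big_mkord predT f) (@big_cat_nat _ _ _ X) /= ?leq0n //; last by lia.
rewrite [X in _ + X]big_ltn; last by lia.
have left_part : \sum_(0 <= j < X) f j <= 1 + lnn X.
  apply: le_trans (harmonic_le R X0); rewrite big_nat_rev /= [leRHS]big_add1 /=.
  rewrite big_nat_cond [leRHS]big_nat_cond; apply: ler_sum => i /andP[/andP[_ iX] _].
  by rewrite /f (_ : maxn _ _ = i.+1) //; lia.
have right_part : \sum_(X.+1 <= j < (2 * X).+1) f j <= 1 + lnn X.
  apply: le_trans (harmonic_le R X0).
  rewrite (_ : X.+1 = 1 + X)%N // (_ : (2 * X).+1 = X.+1 + X)%N; last by lia.
  rewrite big_addn addnK big_nat_cond [leRHS]big_nat_cond; apply: ler_sum => i /andP[/andP[i1 _] _].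
  by rewrite /f (_ : maxn _ _ = i) //; lia.
have mid : f X = 1 by rewrite /f subrr /= maxn0 invr1.
rewrite mid; lra.
Qed.

Lemma short_len_gt0 u : short_vec u != 0 -> (0 < short_len u)%N.
Proof.
move=> u0; rewrite lt0n; apply: contraNneq u0 => M0; apply/eqP/rowP => j; rewrite [RHS]mxE.
have h i : (`|short_vec u 0%R i| <= short_len u)%N.
  have -> : i = if i == 0 then 0 else 1 by case: i => -[|[|//]] ?; apply/val_inj.
  by case: ifP => _; [exact: leq_maxl|exact: leq_maxr].
by have := h j; rewrite M0 leqn0 absz_eq0 => /eqP.
Qed.

(** The square of max(|x|, |y|) is at least max(1, |x|) max(1, |y|), so the sum factors into two
    harmonic sums. The resulting square of log X is harmless because [Q] will be a power of log
    X. *)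
Lemma sum_inv_short_len_le :
  \sum_(u : sbox | short_vec u != 0) ((short_len u)%:R ^+ 2)^-1 <= (3%:R + 2%:R * lnn X) ^+ 2 :> R.
Proof.
pose f (j : 'I_(2 * X).+1) : R := (maxn 1 `|Posz j - X|%N)%:R^-1.
have f0 j : 0 <= f j by rewrite invr_ge0 ler0n.
apply: le_trans (_ : \sum_(u : sbox) \prod_(i < 2) f (u i) <= _).
  rewrite big_mkcond; apply: ler_sum => u _; case: ifP => [u0|_]; last exact: prodr_ge0.
  rewrite !big_ord_recl big_ord0 mulr1 /f -invfM -natrM -natrX.
  have -> : lift 0 0 = 1 :> 'I_2 by apply/val_inj.
  have e i : short_vec u 0 i = Posz (u i) - Posz X by rewrite !mxE.
  have M0 := short_len_gt0 u0.
  rewrite lef_pV2 ?posrE ?ltr0n ?expn_gt0 ?M0 ?muln_gt0 ?leq_max // ler_nat -mulnn.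
  by rewrite leq_mul // geq_max M0 -e ?leq_maxl ?leq_maxr.
rewrite -(bigA_distr_bigA (fun _ j => f j)) /= prodr_const card_ord.
rewrite lerXn2r ?nnegrE ?sumr_ge0 ?addr_ge0 ?mulr_ge0 ?lnn_ge0 //.
exact: sum_inv_dist_le.
Qed.

(** For a fixed short vector u of length M, log p / p <= log p / (M Q)^2, and the primes involved
    divide F(u) <> 0, so their logarithms add up to at most log |F(u)|. It remains to sum 1 / M^2
    over u. *)
Lemma short_sum_le z : (z * Q ^ 4 <= X ^ 2)%N ->
  \sum_(P0.+1 <= p < z.+1 | prime p) \sum_(r in root_set g p)
     (has_short p (r : nat)%:Z)%:R * (lnn p / p%:R) <=
  (lnn C + t%:R * lnn X) * (3%:R + 2%:R * lnn X) ^+ 2 / Q%:R ^+ 2.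
Proof.
move=> zX; have QR : 0 < Q%:R :> R by rewrite ltr0n.
have lp (p : nat) : 0 <= lnn p / p%:R by rewrite divr_ge0 ?lnn_ge0.
apply: le_trans (_ : \sum_(P0.+1 <= p < z.+1 | prime p)
    \sum_(u : sbox) (is_short_hit p u)%:R * (lnn p / p%:R) <= _).
  rewrite big_nat_cond [leRHS]big_nat_cond; apply: ler_sum => p /andP[/andP[Pp _] p_pr].
  rewrite -!mulr_suml ler_wpM2r // -!natr_sum ler_nat.
  apply: leq_trans (_ : (\sum_(u : sbox) \sum_(r in root_set g p) is_short p (r : nat)%:Z u <=
    _)%N).
    rewrite exchange_big /=; apply: leq_sum => r _.
    case: (boolP (has_short p _)) => // /existsP[u su].
    by rewrite (bigD1 u) //= su.
  by apply: leq_sum => u _; apply: short_count_le.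
rewrite exchange_big /=.
apply: le_trans (_ : \sum_(u : sbox | short_vec u != 0)
   (lnn C + t%:R * lnn X) / Q%:R ^+ 2 * ((short_len u)%:R ^+ 2)^-1 <= _); last first.
  rewrite -mulr_sumr [leRHS]mulrAC ler_wpM2l ?sum_inv_short_len_le //.
  by rewrite divr_ge0 ?addr_ge0 ?mulr_ge0 ?lnn_ge0 ?exprn_ge0.
rewrite [leRHS]big_mkcond; apply: ler_sum => u _; case: (boolP (short_vec u != 0)) => u0;
  last first.
  by rewrite big1 // => p _; rewrite /is_short_hit (negPf u0) mul0r.
set M := short_len u; set x := short_vec u 0 0; set y := short_vec u 0 1.
have M0 : (0 < M)%N by exact: short_len_gt0.
have MQ : 0 < (M%:R * Q%:R) ^+ 2 :> R by rewrite exprn_gt0 // mulr_gt0 ?ltr0n.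
have [xM yM] : `|x| <= M%:Z /\ `|y| <= M%:Z.
  by rewrite -!abszE !lez_nat; split; [exact: leq_maxl|exact: leq_maxr].
have MX : (M <= X)%N.
  have h i : (`|short_vec u 0%R i| <= X)%N.
    by rewrite !mxE; have := ltn_ord (u i); move: (u i : nat) => j; lia.
  by rewrite /M /short_len geq_max !h.
have xy0 : (x != 0) || (y != 0).
  apply: contraLR u0; rewrite negb_or !negbK => /andP[/eqP x0 /eqP y0].
  apply/eqP/rowP => j; rewrite [RHS]mxE.
  have -> : j = if j == 0 then 0 else 1 by case: j => -[|[|//]] ?; apply/val_inj.
  by case: ifP => _; [exact: x0|exact: y0].
have Fn0 : (0 < `|F x y|)%N by rewrite absz_gt0 F_neq0.
have FX : (`|F x y| <= C * X ^ t)%N.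
  by apply: F_le; [apply: le_trans xM _|apply: le_trans yM _]; rewrite lez_nat.
have CX0 : (0 < C * X ^ t)%N by apply: leq_trans FX.
have C0 : (0 < C)%N by move: CX0; rewrite muln_gt0 => /andP[].
have lF : lnn `|F x y|%N <= lnn C + t%:R * lnn X.
  by rewrite -lnnX // -lnnM ?expn_gt0 ?X0 // lnn_le.
rewrite -mulrA -invfM -exprMn [_ * M%:R]mulrC ler_pdivlMr // mulr_suml.
apply: le_trans lF.
apply: le_trans (_ : \sum_(0 <= p < z.+1 | prime p && is_short_hit p u) lnn p <= _); last first.
  by apply: sum_lnn_dvd => // p /andP[-> /and3P[_ dp _]].
rewrite (@big_nat_widenl _ _ _ P0.+1 0%N) // big_mkcond [leRHS]big_mkcond.
apply: ler_sum => p _; case: (boolP (prime p)) => //= p_pr.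
case: (boolP (is_short_hit p u)) => [/and3P[_ _ Mp]|_]; last by case: ifP; rewrite ?mul0r.
case: ifP => _; last exact: lnn_ge0.
rewrite mul1r mulrAC ler_pdivrMr ?ltr0n ?prime_gt0 // ler_wpM2l ?lnn_ge0 //.
by rewrite -natrM -natrX ler_nat.
Qed.

(** With a short vector the left side is not positive. Without one, A <= X / Q costs 8 / Q, and the
    pairs divisible by p in both coordinates are a proportion 1 / p < 1 / P0 of the main term. *)
Lemma good_count_real_ge p (r : int) : prime p -> (P0 < p)%N -> (0 < P0)%N ->
  (p * Q ^ 4 <= X ^ 2)%N ->
  (X ^ 2)%:R / p%:R * (1 - 8%:R / Q%:R - P0%:R^-1 - (has_short p r)%:R) <=
    (good_count p r)%:R :> R.
Proof.
move=> p_pr Pp P00 pX.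
have pR : 0 < p%:R :> R by rewrite ltr0n prime_gt0.
have QR : 0 < Q%:R :> R by rewrite ltr0n.
have PR : 0 < P0%:R :> R by rewrite ltr0n.
have Q8 : 0 <= 8%:R / Q%:R :> R by rewrite divr_ge0.
have Pi : 0 <= P0%:R^-1 :> R by rewrite invr_ge0 ler0n.
case: (boolP (has_short p r)) => hs.
  apply: le_trans (ler0n _ _); rewrite mulr_ge0_le0 ?divr_ge0 ?ler0n //=; lra.
have [A AQ hA] := good_count_ge p_pr Pp pX hs; rewrite subr0.
rewrite mulrAC ler_pdivrMr //.
have A4 : (4 * A <= X)%N by apply: leq_trans AQ; rewrite mulnC leq_mul2l Q4 orbT.
have XR : 0 < X%:R :> R by rewrite ltr0n.
have AR : A%:R * Q%:R <= X%:R :> R by rewrite -natrM ler_nat.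
have h1 : (X%:R - 4%:R * A%:R) ^+ 2 <= (good_count p r)%:R * p%:R + (X %/ p)%:R ^+ 2 * p%:R :> R.
  have <- : (X - 4 * A)%:R = X%:R - 4%:R * A%:R :> R by rewrite natrB // natrM.
  by rewrite -mulrDl -!natrX -natrD -natrM ler_nat.
have h2 : (X %/ p)%:R ^+ 2 * p%:R <= X%:R ^+ 2 * P0%:R^-1 :> R.
  have h3 : (X %/ p)%:R <= X%:R / p%:R :> R by rewrite ler_pdivlMr // -natrM ler_nat leq_trunc_div.
  apply: (@le_trans _ _ ((X%:R / p%:R) ^+ 2 * p%:R)).
    by rewrite ler_pM2r // lerXn2r // ?nnegrE ?ler0n ?divr_ge0 ?ler0n.
  have -> : (X%:R / p%:R) ^+ 2 * p%:R = X%:R ^+ 2 * p%:R^-1 :> R by field; rewrite lt0r_neq0.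
  by rewrite ler_pM2l ?exprn_gt0 // lef_pV2 ?posrE // ler_nat ltnW.
have h4 : A%:R <= X%:R / Q%:R :> R by rewrite ler_pdivlMr.
have h5 : X%:R ^+ 2 * (1 - 8%:R / Q%:R) <= (X%:R - 4%:R * A%:R) ^+ 2 :> R.
  have -> : X%:R ^+ 2 * (1 - 8%:R / Q%:R) = X%:R ^+ 2 - 8%:R * X%:R * (X%:R / Q%:R) :> R.
    by field; rewrite lt0r_neq0.
  have : X%:R * A%:R <= X%:R * (X%:R / Q%:R) :> R by rewrite ler_pM2l.
  have : 0 <= A%:R ^+ 2 :> R by rewrite exprn_ge0.
  move: (X%:R / Q%:R) => w; lra.
rewrite natrX mulrBr lerBlDr; apply: le_trans h5 (le_trans h1 _).
by rewrite lerD2l.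
Qed.

Lemma pair_hits_sum_ge z : (0 < P0)%N -> (z * Q ^ 4 <= X ^ 2)%N ->
  (X ^ 2)%:R * ((1 - 8%:R / Q%:R - P0%:R^-1) * root_log_sum R g P0 z -
     (lnn C + t%:R * lnn X) * (3%:R + 2%:R * lnn X) ^+ 2 / Q%:R ^+ 2) <=
  \sum_(P0.+1 <= p < z.+1 | prime p) lnn p * (pair_hits p)%:R.
Proof.
move=> P00 zX; set e := (1 - _ - _).
apply: le_trans (_ : (X ^ 2)%:R * (e * root_log_sum R g P0 z -
  \sum_(P0.+1 <= p < z.+1 | prime p) \sum_(r in root_set g p)
     (has_short p (r : nat)%:Z)%:R * (lnn p / p%:R)) <= _).
  by rewrite ler_wpM2l ?ler0n // lerD2l lerN2 short_sum_le.
have -> : root_log_sum R g P0 z = \sum_(P0.+1 <= p < z.+1 | prime p)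
    \sum_(r in root_set g p) (lnn p / p%:R).
  by apply: eq_bigr => p _; rewrite sumr_const -mulrA mulr_natl.
rewrite mulr_sumr -sumrB mulr_sumr big_nat_cond [leRHS]big_nat_cond.
apply: ler_sum => p /andP[/andP[Pp pz] p_pr].
have pX : (p * Q ^ 4 <= X ^ 2)%N by apply: leq_trans zX; rewrite leq_mul2r -ltnS pz orbT.
have := sum_good_count_le p_pr Pp; rewrite -(ler_nat R) natr_sum.
move=> /(ler_wpM2l (lnn_ge0 R p)); apply: le_trans.
rewrite mulr_sumr -sumrB !mulr_sumr; apply: ler_sum => r _.
have := good_count_real_ge (r : nat)%:Z p_pr Pp P00 pX.
move=> /(ler_wpM2l (lnn_ge0 R p)); apply: le_trans; rewrite -/e le_eqVlt; apply/orP; left;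
  apply/eqP.
by rewrite -mulrBl; ring.
Qed.

End PairCounts.

(** * Logarithmic parameters and the sum over primes up to X^2 *)

Section LogLog.
Variable R : realType.
Local Notation lnn := (@natln R).

Lemma lnn2_bounds : 2%:R^-1 <= lnn 2 <= 1.
Proof.
apply/andP; split.
  have : ln (1 + - 2%:R^-1) <= - 2%:R^-1 :> R by apply: le_ln1Dx; rewrite ltrN2 invf_lt1 // ltr1n.
  have -> : 1 + - 2%:R^-1 = 2%:R^-1 :> R by field.
  by rewrite lnV ?posrE ?ltr0n // lerN2.
rewrite /natln (_ : 2%:R = 1 + 1) //; apply: le_ln1Dx; lra.
Qed.

(** A positive integer of the order of log X, from which the integer [Q] is built. *)
Definition log2S (X : nat) : nat := (trunc_log 2 X).+1.

Lemma lnn_le_log2S X : (0 < X)%N -> lnn X <= (log2S X)%:R.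
Proof.
move=> X0; have /andP[_ l1] := lnn2_bounds.
have XS : (X <= 2 ^ log2S X)%N by rewrite ltnW // trunc_log_ltn.
apply: le_trans (lnn_le R X0 XS) _.
by rewrite lnnX // ler_piMr ?ler0n.
Qed.

Lemma log2S_le X : (0 < X)%N -> (log2S X)%:R <= 2%:R * lnn X + 1.
Proof.
move=> X0; have /andP[l0 _] := lnn2_bounds.
have : lnn (2 ^ trunc_log 2 X) <= lnn X.
  by apply: lnn_le; rewrite ?expn_gt0 // trunc_logP.
rewrite lnnX // /log2S -natr1 lerD2r => h.
have : (trunc_log 2 X)%:R * 2%:R^-1 <= (trunc_log 2 X)%:R * lnn 2 by rewrite ler_wpM2l.
by move: (_ * lnn 2) h => w; lra.
Qed.

Lemma lnn_log2S_le (eta : R) : 0 < eta -> exists K, forall X, (0 < X)%N ->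
  lnn (log2S X) <= eta * lnn X + K.
Proof.
move=> eta0; have [k k0 hk] := exists_nat_ge (2%:R / eta).
have kR : 0 < k%:R :> R by rewrite ltr0n.
exists (k%:R^-1 + lnn k) => X X0.
have lR : 0 < (log2S X)%:R :> R by rewrite ltr0n.
have -> : lnn (log2S X) = ln ((log2S X)%:R / k%:R) + lnn k.
  by rewrite ln_div ?posrE // /natln subrK.
rewrite addrA lerD2r; apply: le_trans (ltW (ln_sublinear _)) _; first by rewrite divr_gt0.
rewrite ler_pdivrMr //; apply: le_trans (log2S_le X0) _.
rewrite [leRHS]mulrDl mulVf ?lt0r_neq0 // lerD2r mulrAC ler_wpM2r ?lnn_ge0 //.
by rewrite mulrC -ler_pdivrMr.
Qed.
End LogLog.

Section PairAsymptotics.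
Variables (R : realType) (n : nat) (g : {poly int}).
Hypotheses (gm : g \is monic) (sg : size g = n.+3).
Hypothesis irr_g : forall q : {poly rat}, q != 0 -> (size q <= n.+2)%N ->
  coprimep (map_poly intr g) q.
Local Notation t := n.+2.
Variables (c : int) (F : int -> int -> int) (C P1 : nat).
Hypotheses (F_neq0 : forall a b : int, (a != 0) || (b != 0) -> F a b != 0)
  (F_le : forall (M : nat) (a b : int), `|a| <= M%:Z -> `|b| <= M%:Z -> (`|F a b|%N <= C * M ^ t)%N)
  (F_dvd : forall (p : nat) (s a b : int), prime p -> (P1 < p)%N -> (p %| g.[s])%Z ->
     (p %| c * a - s * b)%Z -> (p %| F a b)%Z)
  (c_coprime : forall p, prime p -> (P1 < p)%N -> coprimez c p).
Local Notation lnn := (@natln R).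

(** With l of the order of log X and Q = l^2, the short vectors cost O(log^3 X / l^4), which is
    bounded, and the restriction z Q^4 <= X^2 costs only O(log l). As [mertens_lower] concerns sums
    up to t-th powers, z is taken as the largest admissible Y^t. *)
Lemma pair_hits_asymptotic (eps : R) : 0 < eps -> exists X0, forall X, (X0 <= X)%N ->
  (X ^ 2)%:R * ((2%:R - eps) * lnn X) <=
  \sum_(0 <= p < (X ^ 2).+1 | prime p) lnn p * (pair_hits F X p)%:R.
Proof.
move=> eps0; pose d := Num.min eps 1 / 16%:R.
have m0 : 0 < Num.min eps 1 by rewrite lt_min eps0 ltr01.
have d0 : 0 < d by rewrite divr_gt0.
have d1 : d <= 1 / 16%:R by rewrite /d ler_wpM2r ?invr_ge0 ?ler0n // ge_min lexx orbT.
have deps : 8%:R * d <= eps.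
  have : Num.min eps 1 <= eps by rewrite ge_min lexx.
  rewrite /d; lra.
have [P2 hP2] := mertens_lower gm sg irr_g d0.
have [P3 P30 hP3] := exists_nat_ge d^-1.
pose P0 := maxn (maxn P1 P2) P3.
have P01 : (P1 <= P0)%N by rewrite /P0 !leq_max leqnn.
have P03 : (P3 <= P0)%N by rewrite /P0 !leq_max leqnn !orbT.
have P00 : (0 < P0)%N by apply: leq_trans P03.
have [Y0 hY0] := hP2 P0 (leq_trans (leq_maxr P1 P2) (leq_maxl _ _)).
(* Q^4 = l^8 will cost 8 log l, hence the d / 8. *)
have [K1 hK1] := lnn_log2S_le (divr_gt0 d0 (ltr0Sn R 7)).
pose K2 : R := 8%:R * K1 + t%:R.
pose K3 : R := 25%:R * (lnn C + t%:R).
(* [X1] forces Y beyond [Y0], [X2] gives 8 / Q <= d, and [X3] absorbs the constants. *)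
have [X1 hX1] := lnn_unbounded (8%:R * K1 + t%:R * lnn Y0.+2 + 1).
have [X2 hX2] := lnn_unbounded (8%:R / d).
have [X3 hX3] := lnn_unbounded ((K2 + 2%:R * K3) / d).
exists (maxn 2 (maxn X1 (maxn X2 X3))) => X.
rewrite !geq_max => /and4P[X2' /hX1{}hX1 /hX2{}hX2 /hX3{}hX3].
have X0 : (0 < X)%N by apply: leq_trans X2'.
pose l := log2S X; pose Q := (l ^ 2)%N.
have l0 : (0 < l)%N by [].
have l2 : (2 <= l)%N by rewrite /l /log2S ltnS; apply: (@leq_trans (trunc_log 2 2)) => //;
  apply: leq_trunc_log.
have Q4 : (4 <= Q)%N by rewrite /Q -[4%N]/(2 ^ 2)%N leq_sqr.
have [Y YQ Ymax] : exists2 Y, (Y ^ t * Q ^ 4 <= X ^ 2)%N & (X ^ 2 < Y.+1 ^ t * Q ^ 4)%N.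
  have ex0 : exists Y, (Y ^ t * Q ^ 4 <= X ^ 2)%N by exists 0%N; rewrite exp0n.
  have bnd Y : (Y ^ t * Q ^ 4 <= X ^ 2)%N -> (Y <= X ^ 2)%N.
    apply: leq_trans; apply: leq_trans (leq_pmulr _ _); last by rewrite !expn_gt0 l0.
    by case: (posnP Y) => [->|Yp] //; rewrite -[X in (X <= _)%N]expn1 leq_pexp2l.
  case: (ex_maxnP ex0 bnd) => Y h1 h2; exists Y => //.
  by rewrite ltnNge; apply/negP => /h2; rewrite ltnn.
have L0 : 0 <= lnn X by exact: lnn_ge0.
have lnY1 : (2%:R - d) * lnn X - 8%:R * K1 <= t%:R * lnn Y.+1.
  have : lnn (X ^ 2) <= lnn (Y.+1 ^ t * Q ^ 4).
    by apply: lnn_le; rewrite ?expn_gt0 ?X0 // ltnW.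
  have -> : lnn (Y.+1 ^ t * Q ^ 4) = t%:R * lnn Y.+1 + 8%:R * lnn l.
    by rewrite lnnM ?expn_gt0 ?l0 // lnnX // /Q -expnM lnnX.
  rewrite lnnX //.
  have := hK1 X X0; rewrite -/l; set u := lnn l; set v := lnn Y.+1; set w := lnn X.
  by set T := t%:R * v => h1 h2; clearbody u w T d; lra.
have dL : d * lnn X <= lnn X.
  by rewrite ler_piMl //; apply: le_trans d1 _; lra.
have YY0 : (Y0 <= Y)%N /\ (0 < Y)%N.
  suff : (Y0 < Y)%N by move=> h; split; [exact: ltnW|exact: leq_ltn_trans h].
  rewrite ltnNge; apply/negP => YY.
  have : t%:R * lnn Y.+1 <= t%:R * lnn Y0.+2.
    by rewrite ler_wpM2l ?ler0n // lnn_le // !ltnS ltnW // ltnS.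
  move: hX1 lnY1 dL; set v := t%:R * lnn Y.+1; set v' := t%:R * lnn Y0.+2; set w := lnn X.
  by clearbody v v' w d; lra.
have [YY Yp] := YY0.
have lnY : (2%:R - d) * lnn X - K2 <= t%:R * lnn Y.
  have h : lnn Y.+1 <= lnn Y + 1.
    apply: le_trans (_ : lnn (2 * Y) <= _); first by apply: lnn_le => //;
      rewrite mul2n -addnn -addn1 leq_add2l.
    by rewrite lnnM // addrC lerD2l; have /andP[] := lnn2_bounds R.
  have : t%:R * lnn Y.+1 <= t%:R * (lnn Y + 1) by rewrite ler_wpM2l.
  rewrite mulrDr mulr1 /K2; move: lnY1;
    move: (t%:R * lnn Y.+1) (t%:R * lnn Y) (t%:R : R) (lnn X) => a b e w.
  by clearbody d; lra.
have lL : lnn X <= l%:R by exact: lnn_le_log2S.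
have l1R : 1 <= l%:R :> R by rewrite ler1n.
have lR : 0 < l%:R :> R by rewrite ltr0n.
have Q8 : 8%:R / Q%:R <= d.
  rewrite ler_pdivrMr ?ltr0n ?expn_gt0 // mulrC -ler_pdivrMr //.
  apply: le_trans hX2 (le_trans lL _).
  by rewrite ler_nat /Q -mulnn leq_pmulr.
have P0i : P0%:R^-1 <= d.
  rewrite invf_ple ?posrE ?ltr0n //; apply: le_trans hP3 _.
  by rewrite ler_nat.
have lC0 : 0 <= lnn C by exact: lnn_ge0.
have bad : (lnn C + t%:R * lnn X) * (3%:R + 2%:R * lnn X) ^+ 2 / Q%:R ^+ 2 <= K3.
  rewrite ler_pdivrMr ?exprn_gt0 ?ltr0n ?expn_gt0 //.
  have h1 : lnn C + t%:R * lnn X <= (lnn C + t%:R) * l%:R.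
    by rewrite [leRHS]mulrDl lerD // ?ler_peMr // ler_wpM2l.
  have h2 : (3%:R + 2%:R * lnn X) ^+ 2 <= 25%:R * l%:R ^+ 2.
    have -> : 25%:R * l%:R ^+ 2 = (5%:R * l%:R) ^+ 2 :> R by rewrite exprMn; congr (_ * _);
      rewrite -natrX.
    rewrite lerXn2r ?nnegrE ?addr_ge0 ?mulr_ge0 //.
    by move: lL l1R; move: (lnn X) (l%:R : R) => w v; lra.
  apply: le_trans (_ : ((lnn C + t%:R) * l%:R) * (25%:R * l%:R ^+ 2) <= _).
    apply: ler_pM h1 h2; first by rewrite addr_ge0 ?mulr_ge0.
    by rewrite exprn_ge0 // addr_ge0 // mulr_ge0.
  have -> : Q%:R ^+ 2 = l%:R ^+ 4 :> R by rewrite /Q natrX -exprM.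
  rewrite /K3.
  have -> : (lnn C + t%:R) * l%:R * (25%:R * l%:R ^+ 2) = 25%:R * (lnn C + t%:R) * l%:R ^+ 3.
    by ring.
  rewrite ler_wpM2l ?ler_weXn2l //.
  by apply: mulr_ge0 => //; apply: addr_ge0 => //; exact: ler0n.
have S_ge := hY0 Y YY.
pose S := root_log_sum R g P0 (Y ^ t).
have zX : (Y ^ t * Q ^ 4 <= X ^ 2)%N by exact: YQ.
have main := pair_hits_sum_ge F_neq0 F_le
  (fun p s a b pp Pp => F_dvd pp (leq_ltn_trans P01 Pp))
  (fun p pp Pp => c_coprime pp (leq_ltn_trans P01 Pp)) X0 Q4 R P00 zX.
apply: (@le_trans _ _ (\sum_(P0.+1 <= p < (Y ^ t).+1 | prime p) lnn p * (pair_hits F X p)%:R));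
  last first.
  have YX : (Y ^ t <= X ^ 2)%N by apply: leq_trans YQ; rewrite leq_pmulr // !expn_gt0 l0.
  rewrite (@big_nat_widenl _ _ _ P0.+1 0%N) // (@big_nat_widen _ _ _ _ (Y ^ t).+1 (X ^ 2).+1) //.
  rewrite big_mkcond [leRHS]big_mkcond; apply: ler_sum => p _.
  by case: (prime p) => //=; case: ifP => // _; rewrite mulr_ge0 ?lnn_ge0.
apply: le_trans main; rewrite ler_wpM2l ?ler0n //.
have S0 : 0 <= S by exact: root_log_sum_ge0.
have e1 : (1 - 2%:R * d) * S <= (1 - 8%:R / Q%:R - P0%:R^-1) * S.
  rewrite ler_wpM2r //; move: Q8 P0i; move: (8%:R / Q%:R) (P0%:R^-1) => a b; clearbody d; lra.
rewrite -/S in S_ge *; rewrite lerBrDr; apply: le_trans e1.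
have e2 : (1 - 2%:R * d) * ((1 - d) * (t%:R * lnn Y)) <= (1 - 2%:R * d) * S.
  by rewrite ler_wpM2l // subr_ge0; clearbody d; lra.
apply: le_trans e2; rewrite mulrA.
have d1' : 0 <= (1 - 2%:R * d) * (1 - d).
  by clearbody d; apply: mulr_ge0; lra.
apply: le_trans (ler_wpM2l d1' lnY).
have hX3' : K2 + 2%:R * K3 <= d * lnn X by rewrite [leRHS]mulrC -ler_pdivrMr.
have epsL : 8%:R * d * lnn X <= eps * lnn X by rewrite ler_wpM2r.
have d0' := ltW d0.
have K30 : 0 <= K3.
  by apply: mulr_ge0 => //; apply: addr_ge0 => //; exact: ler0n.
move: bad hX3' epsL L0 K30; set B := (_ / _); set L := lnn X.
clearbody B L K2 K3; clear -d0 d0' d1 => bad hX3 epsL L0 K30.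
(* On the left (1 - 3 d)(2 - 2 d) >= 2 - 8 d >= 2 - eps, and 2 (1 - 3 d) K3 >= K3 leaves room for
   the short vectors [B]. *)
have q1 : (1 - 3%:R * d) * ((2%:R - 2%:R * d) * L + 2%:R * K3) <=
    (1 - 2%:R * d) * (1 - d) * ((2%:R - d) * L - K2).
  apply: ler_pM; first lra.
  - have : 0 <= (2%:R - 2%:R * d) * L by apply: mulr_ge0 => //; lra.
    by set w := _ * L; lra.
  - by have : 0 <= d * d; [apply: mulr_ge0; lra | lra].
  - by lra.
apply: le_trans q1.
have h1 : 0 <= d * d * L by rewrite mulr_ge0 // mulr_ge0.
have h2 : d * K3 <= (1 / 16%:R) * K3 by rewrite ler_wpM2r.
by lra.
Qed.
End PairAsymptotics.

(** * Binary forms and their monic models *)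

Section Homogenization.
Variable A : comNzRingType.
Implicit Types q r : {poly A}.

Definition bimon i j : 'X_{1..2} := [multinom nth 0%N [:: i; j] k | k < 2].

Definition homogenize q d : {mpoly A[2]} := \sum_(i < d.+1) q`_i *: 'X_[bimon i (d - i)].

Lemma bimonD i j i' j' : (bimon i j + bimon i' j')%MM = bimon (i + i') (j + j').
Proof. by apply/mnmP => -[[|[|//]] ?]; rewrite mnmDE !mnmE. Qed.

Lemma mdeg_bimon i j : mdeg (bimon i j) = (i + j)%N.
Proof. by rewrite mdegE !big_ord_recl big_ord0 !mnmE addn0. Qed.

Lemma homogenize_sum I (s : seq I) (P : pred I) (G : I -> {poly A}) d :
  homogenize (\sum_(i <- s | P i) G i) d = \sum_(i <- s | P i) homogenize (G i) d.
Proof.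
rewrite /homogenize exchange_big /=; apply: eq_bigr => k _.
by rewrite coef_sum scaler_suml.
Qed.

Lemma homogenizeZ a q d : homogenize (a *: q) d = a *: homogenize q d.
Proof. by rewrite scaler_sumr; apply: eq_bigr => k _; rewrite coefZ scalerA. Qed.

Lemma homogenizeXn i d : (i <= d)%N -> homogenize 'X^i d = 'X_[bimon i (d - i)].
Proof.
move=> id; have id' : (i < d.+1)%N by [].
rewrite /homogenize (bigD1 (Ordinal id')) //= coefXn eqxx scale1r big1 ?addr0 // => k ne.
rewrite coefXn (_ : (k == i :> nat) = false) ?scale0r //.
by apply/negbTE; move: ne; rewrite -val_eqE.
Qed.

Lemma poly_widen q d : (size q <= d.+1)%N -> q = \sum_(i < d.+1) q`_i *: 'X^i.
Proof.
move=> sq; rewrite -poly_def; apply/polyP => k; rewrite coef_poly; case: ltnP => // kd.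
by rewrite nth_default // (leq_trans sq).
Qed.

Lemma homogenizeM q r d e : (size q <= d.+1)%N -> (size r <= e.+1)%N ->
  homogenize q d * homogenize r e = homogenize (q * r) (d + e).
Proof.
move=> sq sr.
have -> : q * r = \sum_(i < d.+1) \sum_(j < e.+1) (q`_i * r`_j) *: 'X^(i + j).
  rewrite {1}(poly_widen sq) {1}(poly_widen sr) mulr_suml; apply: eq_bigr => i _.
  rewrite mulr_sumr; apply: eq_bigr => j _.
  by rewrite -scalerAl -scalerAr scalerA exprD.
rewrite homogenize_sum {1 2}/homogenize mulr_suml; apply: eq_bigr => i _.
rewrite homogenize_sum mulr_sumr; apply: eq_bigr => j _.
have id := leq_ord i; have je := leq_ord j.
rewrite homogenizeZ homogenizeXn ?leq_add // -scalerAl -scalerAr scalerA.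
rewrite -mpolyXD bimonD; congr (_ *: 'X_[bimon _ _]); lia.
Qed.

Lemma meval_homogenize q d (v : 'I_2 -> A) :
  (homogenize q d).@[v] = \sum_(i < d.+1) q`_i * (v 0 ^+ i * v 1 ^+ (d - i)).
Proof.
rewrite raddf_sum /=; apply: eq_bigr => i _.
rewrite mevalZ mevalX !big_ord_recl big_ord0 !mnmE mulr1 /=; congr (_ * (_ * v _ ^+ _)).
exact/val_inj.
Qed.

End Homogenization.

Section BinaryForm.
Variables (t : nat) (F : {mpoly int[2]}).
Hypotheses (homF : F \is t.-homog) (irrF : irreducible_form F) (t2 : (2 <= t)%N).

Definition dehomogenize : {poly int} := \poly_(i < t.+1) F@_(bimon i (t - i)).
Let f := dehomogenize.

Lemma homogenize_dehomogenize : F = homogenize f t.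
Proof.
apply/mpolyP => m; rewrite /homogenize raddf_sum /=.
have [dm|dm] := eqVneq (mdeg m) t; last first.
  rewrite big1 => [|i _].
    by apply/eqP; rewrite mcoeff_eq0; apply: contra dm => mF; have /dhomogP/(_ _ mF) -> := homF.
  rewrite mcoeffZ mcoeffX (_ : (bimon i (t - i) == m) = false) ?mulr0 //.
  by apply: contraNF dm => /eqP <-; rewrite mdeg_bimon subnKC // -ltnS.
have mE : m = bimon (m 0) (m 1).
  apply/mnmP => -[[|[|//]] k2]; rewrite mnmE /=; congr (m _); exact/val_inj.
have dE : (m 0%R + m 1%R)%N = t by rewrite -dm {3}mE mdeg_bimon.
have m0 : (m 0%R < t.+1)%N by rewrite ltnS -dE leq_addr.
rewrite (bigD1 (Ordinal m0)) //= mcoeffZ mcoeffX coef_poly m0.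
rewrite (_ : (t - m 0%R)%N = m 1%R) -?mE ?eqxx ?mulr1; last by rewrite -dE addKn.
rewrite big1 ?addr0 // => i ne; rewrite mcoeffZ mcoeffX.
rewrite (_ : (_ == m) = false) ?mulr0 //; apply: contraNF ne => /eqP /mnmP/(_ 0).
by rewrite mnmE /= => E; apply/eqP/val_inj.
Qed.

Lemma form_evalE a b : form_eval F a b = \sum_(i < t.+1) f`_i * (a ^+ i * b ^+ (t - i)).
Proof. by rewrite /form_eval {1}homogenize_dehomogenize meval_homogenize. Qed.

Let fQ : {poly rat} := map_poly intr f.

(** Homogenizing the factors would factor [F], and a form of positive degree vanishes at the origin,
    so it is no unit. [d] and [e] may exceed the degrees of the factors, which allows for powers of
    Y. *)
Lemma dehomogenize_no_factor (q r : {poly rat}) d e : fQ = q * r ->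
  (0 < d)%N -> (0 < e)%N -> (d + e)%N = t -> (size q <= d.+1)%N -> (size r <= e.+1)%N -> False.
Proof.
move=> E d0 e0 de sq sr; case: irrF => _ _ /(_ (homogenize q d) (homogenize r e)).
have nu (s : {poly rat}) k : (0 < k)%N -> ~~ (homogenize s k \is a GRing.unit).
  move=> k0; apply/negP => /(rmorph_unit (meval (fun _ : 'I_2 => 0 : rat))).
  rewrite /= meval_homogenize big1 ?unitr0 // => i _; rewrite !expr0n subn_eq0.
  case: (posnP i) => [->|i0]; first by rewrite leqNgt k0 /= !mulr0.
  by rewrite mul0r mulr0.
case; last by move=> u; have := nu r e e0; rewrite u.
  rewrite homogenizeM // de -E {1}homogenize_dehomogenize raddf_sum /=.
  apply: eq_bigr => i _; rewrite coef_map /= -mul_mpolyC rmorphM /= map_mpolyC map_mpolyX.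
  by rewrite mul_mpolyC.
by move=> u; have := nu q d d0; rewrite u.
Qed.

(** If the coefficient of X^t vanished, Y, which is 1 homogenized in degree 1, would divide [F]. *)
Lemma size_dehomogenize : size f = t.+1.
Proof.
apply/eqP; rewrite eqn_leq size_poly /= ltnNge; apply/negP => sf.
apply: (@dehomogenize_no_factor 1 fQ 1 t.-1); rewrite ?mul1r ?size_poly1 //; try lia.
rewrite prednK; first exact: leq_trans (size_poly _ _) sf.
by apply: leq_trans t2.
Qed.

Let c := lead_coef f.

Let f_neq0 : f != 0. Proof. by rewrite -size_poly_gt0 size_dehomogenize. Qed.
Let c_neq0 : c != 0. Proof. by rewrite lead_coef_eq0. Qed.
Let size_fQ : size fQ = t.+1.
Proof. by rewrite size_map_inj_poly ?size_dehomogenize //; exact: intr_inj. Qed.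

Lemma dehomogenize_coprime (q : {poly rat}) : q != 0 -> (size q <= t)%N -> coprimep fQ q.
Proof.
move=> q0 sq; rewrite /coprimep; set h := gcdp fQ q.
have h0 : h != 0 by rewrite gcdp_eq0 (negPf q0) andbF.
have sh : (size h <= t)%N by apply: leq_trans sq; rewrite dvdp_leq // dvdp_gcdr.
have sh0 : (0 < size h)%N by rewrite size_poly_gt0.
rewrite eqn_leq sh0 andbT leqNgt; apply/negP => h2.
have /dvdpP[k E] := dvdp_gcdl fQ q; rewrite -/h in E.
have k0 : k != 0.
  by apply/eqP => k0; have := size_fQ; rewrite E k0 mul0r size_poly0.
have sk : (0 < size k)%N by rewrite size_poly_gt0.
have := size_fQ; rewrite E size_mul // => sE.
by apply: (@dehomogenize_no_factor k h (size k).-1 (size h).-1 E); move: sE sh h2 sk sh0;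
  case: (size k) (size h) => [|a] [|b]; rewrite ?addnS ?addSn /=; lia.
Qed.

(** For b = 0 the value is c a^t; otherwise a zero would make a / b a rational root of F(S, 1). *)
Lemma form_eval_neq0 a b : (a != 0) || (b != 0) -> form_eval F a b != 0.
Proof.
rewrite form_evalE => ab; apply/negP => /eqP E.
have [b0|b0] := eqVneq b 0.
  move: ab; rewrite b0 eqxx orbF => a0; move: E.
  rewrite (bigD1 ord_max) //= subnn expr0 mulr1 big1 => [|i ne].
    move/eqP; rewrite addr0 mulf_eq0 expf_eq0 (negPf a0) andbF orbF.
    by have := c_neq0; rewrite /c lead_coefE size_dehomogenize /= => /negPf ->.
  rewrite b0 expr0n (_ : (t - i == 0)%N = false) ?mulr0 //.
  by apply/negbTE; move: ne; rewrite -val_eqE /=; have := ltn_ord i; lia.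
have : coprimep fQ ('X - (a%:~R / b%:~R)%:P).
  by apply: dehomogenize_coprime; rewrite ?polyXsubC_eq0 ?size_XsubC.
rewrite coprimep_XsubC => /negP; apply.
have bQ : b%:~R != 0 :> rat by rewrite intr_eq0.
rewrite /root -(inj_eq (mulIf (expf_neq0 t bQ))) mul0r horner_coef size_fQ mulr_suml.
have := congr1 (intr : int -> rat) E; rewrite rmorph_sum /= => E'; apply/eqP.
transitivity ((0 : int)%:~R : rat) => //; rewrite -E'.
apply: eq_bigr => i _; rewrite coef_map /= !intrM !rmorphXn /= -mulrA; congr (_ * _).
have it : (i <= t)%N by rewrite -ltnS.
have -> : b%:~R ^+ t = b%:~R ^+ (t - i) * b%:~R ^+ i :> rat by rewrite -exprD subnK.
by rewrite mulrCA -exprMn divfK // mulrC.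
Qed.

Lemma form_eval_le (M : nat) (a b : int) : `|a| <= M%:Z -> `|b| <= M%:Z ->
  (`|form_eval F a b|%N <= (\sum_(i < t.+1) `|(f`_i)%R|) * M ^ t)%N.
Proof.
move=> aM bM; rewrite -lez_nat abszE form_evalE; apply: le_trans (ler_norm_sum _ _ _) _.
rewrite -natz natrM natr_sum mulr_suml; apply: ler_sum => i _.
rewrite normrM natz abszE ler_wpM2l // normrM !normrX natrX natz.
have it : (i <= t)%N by rewrite -ltnS.
have -> : M%:Z ^+ t = M%:Z ^+ i * M%:Z ^+ (t - i) by rewrite -exprD subnKC.
by rewrite ler_pM ?exprn_ge0 // lerXn2r ?nnegrE.
Qed.

(* [c ^+ t.-1 * F(X / c, 1)] where [c] is the leading coefficient of [F(X, 1)]. *)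
Definition monicize : {poly int} := 'X^t + \poly_(i < t) (f`_i * c ^+ (t.-1 - i)).
Let g := monicize.

Lemma coef_monicize i : g`_i = if (i < t)%N then f`_i * c ^+ (t.-1 - i) else (i == t)%:R.
Proof.
rewrite coefD coefXn coef_poly; case: ltnP => it; last by rewrite addr0.
by rewrite ltn_eqF // add0r.
Qed.

Lemma size_monicize : size g = t.+1.
Proof.
apply/eqP; rewrite eqn_leq; apply/andP; split.
  by apply/leq_sizeP => i ti; rewrite coef_monicize ltnNge (ltnW ti) /= gtn_eqF.
rewrite ltnNge; apply/negP => /leq_sizeP/(_ t (leqnn t)).
by rewrite coef_monicize ltnn eqxx.
Qed.

Lemma monicize_monic : g \is monic.
Proof. by rewrite monicE lead_coefE size_monicize /= coef_monicize ltnn eqxx. Qed.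

(** Over the rationals X -> X / c is an invertible substitution, so coprimality passes from F(X, 1)
    to its monic model. *)
Lemma monicize_coprime (q : {poly rat}) : q != 0 -> (size q <= t)%N ->
  coprimep (map_poly intr g) q.
Proof.
move=> q0 sq; have cQ : c%:~R != 0 :> rat by rewrite intr_eq0.
pose r1 : {poly rat} := c%:~R^-1 *: 'X.
have s1 : size (c%:~R *: 'X : {poly rat}) = 2 by rewrite size_scale // size_polyX.
have E : map_poly intr g = c%:~R ^+ t.-1 *: (fQ \Po r1).
  apply/polyP => i; rewrite coefZ coef_map /= coef_monicize comp_polyE size_fQ coef_sum.
  under eq_bigr do rewrite /r1 exprZn !coefZ coefXn coef_map /=.
  have [it|it] := ltnP i t.
    have it' : (i < t.+1)%N by apply: ltnW.
    rewrite (bigD1 (Ordinal it')) //= eqxx mulr1 big1 ?addr0 => [|k ne].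
      rewrite intrM rmorphXn /= mulrCA; congr (_ * _).
      have -> : c%:~R ^+ t.-1 = c%:~R ^+ (t.-1 - i) * c%:~R ^+ i :> rat.
        by rewrite -exprD subnK // -ltnS prednK // ltnW.
      by rewrite exprVn mulfK ?expf_neq0.
    by rewrite (_ : (i == k) = false) ?mulr0 //; apply/negbTE; rewrite eq_sym; move: ne;
      rewrite -val_eqE.
  have [->|ne] := eqVneq i t.
    rewrite (bigD1 ord_max) //= eqxx mulr1 big1 ?addr0 => [|k ne].
      rewrite (_ : f`_t = c); last by rewrite /c lead_coefE size_dehomogenize.
      have E : c%:~R ^+ t = c%:~R ^+ t.-1 * c%:~R :> rat by rewrite -exprSr prednK // ltnW.
      by rewrite exprVn E mulrA mulfV // mulf_neq0 ?expf_neq0.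
    by rewrite (_ : (t == k) = false) ?mulr0 //; apply/negbTE; rewrite eq_sym; move: ne;
      rewrite -val_eqE.
  rewrite big1 ?mulr0 // => k _; rewrite (_ : (i == k) = false) ?mulr0 //.
  by apply/negbTE; have := leq_ord k; lia.
rewrite E coprimepZl ?expf_neq0 //.
have -> : q = (q \Po (c%:~R *: 'X)) \Po r1.
  rewrite -comp_polyA comp_polyZ comp_polyX /r1 scalerA mulfV // scale1r comp_polyXr.
  by [].
apply: coprimep_comp_poly; apply: dehomogenize_coprime; last by rewrite size_comp_poly2.
by rewrite -size_poly_gt0 size_comp_poly2 // size_poly_gt0.
Qed.

Lemma monicize_form a b :
  c ^+ t.-1 * form_eval F a b = \sum_(i < t.+1) g`_i * ((c * a) ^+ i * b ^+ (t - i)).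
Proof.
rewrite form_evalE mulr_sumr; apply: eq_bigr => i _; rewrite coef_monicize exprMn.
case: ltnP => it.
  have -> : c ^+ t.-1 = c ^+ (t.-1 - i) * c ^+ i by rewrite -exprD subnK //; lia.
  by ring.
have -> : i = t :> nat by apply/eqP; rewrite eqn_leq it -ltnS ltn_ord.
rewrite eqxx mul1r (_ : f`_t = c); last by rewrite /c lead_coefE size_dehomogenize.
by rewrite !mulrA -exprSr prednK //; lia.
Qed.

(** Replacing c a by s b in the monic model gives c^(t-1) F(a, b) = g(s) b^t modulo p, and c is
    invertible there. *)
Lemma form_eval_dvd p s a b : prime p -> (`|c|%N < p)%N -> (p %| g.[s])%Z ->
  (p %| c * a - s * b)%Z -> (p %| form_eval F a b)%Z.
Proof.
move=> p_pr cp gs l.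
have nc : ~~ (p %| c)%Z by rewrite dvdzE /= gtnNdvd // absz_gt0.
have : (p %| c ^+ t.-1 * form_eval F a b)%Z.
  have E : (c * a)%:~R = (s * b)%:~R :> 'F_p.
    by apply/eqP; rewrite -subr_eq0 -intrB -(dvdz_pcharf (pchar_Fp p_pr)).
  rewrite monicize_form (dvdz_pcharf (pchar_Fp p_pr)) rmorph_sum /=.
  have -> : \sum_(i < t.+1) (g`_i * ((c * a) ^+ i * b ^+ (t - i)))%:~R =
      (g.[s] * b ^+ t)%:~R :> 'F_p.
    rewrite horner_coef size_monicize mulr_suml rmorph_sum /=; apply: eq_bigr => i _.
    rewrite !intrM ![(_ ^+ _)%:~R]rmorphXn /= E -mulrA; congr (_ * _).
    by rewrite intrM exprMn -mulrA -exprD subnKC // -ltnS.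
  by rewrite -(dvdz_pcharf (pchar_Fp p_pr)) dvdz_mulr.
rewrite !dvdzE /= abszM Euclid_dvdM // abszX Euclid_dvdX //.
by move: nc; rewrite dvdzE /= => /negPf ->.
Qed.

Lemma lead_coprime p : prime p -> (`|c|%N < p)%N -> coprimez c p.
Proof.
move=> p_pr cp; rewrite coprimezE /= coprime_sym prime_coprime // gtnNdvd //.
by rewrite absz_gt0.
Qed.

End BinaryForm.

(** * Friable values *)

Lemma card_le_fset_set (T : finType) (K : choiceType) (A : classical_sets.set K) (E : {set T})
  (h : T -> K) :
  cardinality.finite_set A -> injective h -> (forall x, x \in E -> A (h x)) ->
  (#|E| <= #|` cardinality.fset_set A|%fset)%N.
Proof.
move=> fA hinj hA; rewrite cardE -(size_map h); apply: uniq_leq_size.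
  by rewrite map_inj_uniq // enum_uniq.
move=> _ /mapP[x xE ->]; rewrite mem_enum in xE.
by rewrite cardinality.in_fset_set // classical_sets.mem_set //; apply: hA.
Qed.

Section SmoothPairs.
Variables (R : realType) (n : nat) (F : {mpoly int[2]}).
Local Notation t := n.+2.
Hypotheses (homF : F \is t.-homog) (irrF : irreducible_form F).
Local Notation lnn := (@natln R).
Let f := dehomogenize t F.
Let C := (\sum_(i < t.+1) `|(f`_i)%R|)%N.

Definition pair_value X (B : {ffun 'I_2 -> 'I_X}) : nat :=
  `|form_eval F (B 0%R).+1 (B 1%R).+1|%N.

Definition rough_pairs X (y : R) :=
  [set B : {ffun 'I_2 -> 'I_X} | (y < (max_pdiv (pair_value B))%:R)%R].

Lemma pair_value_gt0 X (B : {ffun 'I_2 -> 'I_X}) : (0 < pair_value B)%N.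
Proof. by rewrite absz_gt0 (form_eval_neq0 homF irrF). Qed.

Lemma lnn_pair_value_le X (B : {ffun 'I_2 -> 'I_X}) :
  lnn (pair_value B) <= lnn C + t%:R * lnn X.
Proof.
have h : (pair_value B <= C * X ^ t)%N.
  by apply: (form_eval_le homF) => //; rewrite ger0_norm // lez_nat ltn_ord.
have CX : (0 < C * X ^ t)%N by apply: leq_trans h; exact: pair_value_gt0.
have /andP[C0 X0] : (0 < C)%N && (0 < X ^ t)%N by rewrite -muln_gt0.
have X0' : (0 < X)%N by move: X0; rewrite expn_gt0 orbF.
by rewrite -lnnX // -lnnM // lnn_le // pair_value_gt0.
Qed.

(** For a rough pair the largest prime factor exceeds y >= X^2, so it is distinct from all primes of
    the first sum and contributes at least log y more. *)
Lemma rough_pair_log X (y : R) (B : {ffun 'I_2 -> 'I_X}) : (0 < X)%N -> (X ^ 2)%:R <= y ->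
  \sum_(0 <= p < (X ^ 2).+1 | prime p) (p %| pair_value B)%N%:R * lnn p +
    (B \in rough_pairs X y)%:R * ln y <= lnn (pair_value B).
Proof.
move=> X0 Xy; set v := pair_value B; have v0 : (0 < v)%N by exact: pair_value_gt0.
have -> : \sum_(0 <= p < (X ^ 2).+1 | prime p) (p %| v)%N%:R * lnn p =
    \sum_(0 <= p < (X ^ 2).+1 | prime p && (p %| v)%N) lnn p.
  rewrite big_mkcondr; apply: eq_bigr => p _.
  by case: (p %| v)%N; rewrite ?mul1r ?mul0r.
have [yB|yB] := boolP (B \in rough_pairs X y); last first.
  by rewrite mul0r addr0; apply: sum_lnn_dvd.
move: yB; rewrite inE -/v mul1r; set q := max_pdiv v => yq.
have Xq : (X ^ 2 < q)%N by rewrite -(ltr_nat R) (le_lt_trans Xy).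
(* The value 1 must be excluded before [max_pdiv] is known to be prime; there it equals 1, which is
   not above X^2. *)
have v1 : (1 < v)%N.
  rewrite ltnNge; apply/negP => v1; have E : v = 1%N by lia.
  by move: Xq; rewrite /q E ltnNge expn_gt0 X0.
have q_pr : prime q by exact: max_pdiv_prime.
have y0 : 0 < y by apply: lt_le_trans Xy; rewrite ltr0n expn_gt0 X0.
apply: le_trans (_ : \sum_(0 <= p < q.+1 | prime p && (p %| v)%N) lnn p <= _); last first.
  by apply: sum_lnn_dvd.
rewrite [leRHS]big_mkcond big_nat_recr //= q_pr max_pdiv_dvd /= lerD //.
  rewrite -big_mkcond; apply: sum_widen_le => // p; exact: lnn_ge0.
by rewrite /natln ler_ln ?posrE // ?ltW // (lt_trans y0).
Qed.

(** Summing [rough_pair_log] over the box and removing the part of the primes up to X^2, of size (2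
    - eps) X^2 log X at least. *)
Lemma rough_pairs_bound (eps : R) : 0 < eps -> exists X0, forall X, (X0 <= X)%N ->
  forall y, (X ^ 2)%:R <= y ->
  #|rough_pairs X y|%:R * ln y <=
    (X ^ 2)%:R * (lnn C + (t%:R - 2%:R + eps) * lnn X).
Proof.
move=> eps0.
have t2 : (2 <= t)%N by [].
have [X0 hX0] := @pair_hits_asymptotic R n (monicize t F) (monicize_monic t F)
  (size_monicize t F) (monicize_coprime homF irrF t2)
  (lead_coef f) (form_eval F) C `|lead_coef f|%N
  (form_eval_neq0 homF irrF t2) (form_eval_le homF) (form_eval_dvd homF irrF t2)
  (lead_coprime homF irrF t2) eps eps0.
exists (maxn 1 X0) => X; rewrite geq_max => /andP[X1 XX0] y Xy.
have hits := hX0 X XX0.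
pose S1 := \sum_(B : {ffun 'I_2 -> 'I_X})
  \sum_(0 <= p < (X ^ 2).+1 | prime p) (p %| pair_value B)%N%:R * lnn p.
have total : S1 + #|rough_pairs X y|%:R * ln y <= (X ^ 2)%:R * (lnn C + t%:R * lnn X).
  have -> : #|rough_pairs X y|%:R * ln y =
      \sum_(B : {ffun 'I_2 -> 'I_X}) (B \in rough_pairs X y)%:R * ln y.
    rewrite -mulr_suml; congr (_ * _); rewrite -sum1_card natr_sum big_mkcond.
    by apply: eq_bigr => B _; case: (B \in _).
  rewrite -big_split /=.
  apply: le_trans (_ : \sum_(B : {ffun 'I_2 -> 'I_X}) (lnn C + t%:R * lnn X) <= _).
    apply: ler_sum => B _; apply: le_trans (rough_pair_log _ _ _) (lnn_pair_value_le B) => //.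
  by rewrite sumr_const card_ffun !card_ord -[_ *+ (X ^ 2)]mulr_natl.
have S1E : S1 = \sum_(0 <= p < (X ^ 2).+1 | prime p) lnn p * (pair_hits (form_eval F) X p)%:R.
  rewrite /S1 exchange_big /=; apply: eq_bigr => p _.
  rewrite -mulr_suml mulrC; congr (_ * _); rewrite /pair_hits -sum1_card natr_sum big_mkcond /=.
  by rewrite [RHS]big_mkcond; apply: eq_bigr => B _; rewrite inE dvdzE /=; case: (_ %| _)%N.
rewrite -S1E in hits.
have -> : (X ^ 2)%:R * (lnn C + (t%:R - 2%:R + eps) * lnn X) =
  (X ^ 2)%:R * (lnn C + t%:R * lnn X) - (X ^ 2)%:R * ((2%:R - eps) * lnn X) by ring.
by rewrite lerBrDr; apply: le_trans total; rewrite addrC lerD2r.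
Qed.

Lemma Psi_ge (x y : R) : 1 <= x ->
  (let X := Num.truncn x in (X ^ 2)%:R - #|rough_pairs X y|%:R) <= (Psi F x y)%:R :> R.
Proof.
move=> x1 /=; set X := Num.truncn x.
have x0 : 0 <= x by apply: le_trans x1.
have Xx : X%:R <= x by rewrite truncn_le.
apply: (@le_trans _ _ (#|~: rough_pairs X y|)%:R).
  have -> : (X ^ 2)%N = #|{: {ffun 'I_2 -> 'I_X}}| by rewrite card_ffun !card_ord.
  by rewrite -(cardsC (rough_pairs X y)) natrD addrAC subrr add0r.
rewrite ler_nat /Psi.
apply: (@card_le_fset_set _ _ _ _
  (fun B : {ffun 'I_2 -> 'I_X} => ((B 0%R).+1%:Z, (B 1%R).+1%:Z))).
- exact: finite_friable_pairs.
- move=> B B' [E0 E1]; apply/ffunP => i; apply/val_inj => /=.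
  have -> : i = if i == 0 then 0 else 1 by case: i => -[|[|//]] ?; apply/val_inj.
  by case: ifP.
move=> B; rewrite !inE -leNgt => yB.
have le_x (i : 'I_2) : ((B i).+1%:Z)%:~R <= x.
  by apply: le_trans Xx; rewrite ler_nat ltn_ord.
by split => //=; apply: (form_eval_neq0 homF irrF).
Qed.

End SmoothPairs.

(* The term o(1) is uniform in y over the stated domain. *)
Theorem mainTheorem5 (R : realType) (t : nat) (F : {mpoly int[2]})
    (t_ge4 : (4 <= t)%N) (homF : F \is t.-homog) (irrF : irreducible_form F) :
  forall eps : R, 0 < eps ->
  exists x0 : R, forall x y : R, x0 <= x -> x ^+ (t - 2) <= y ->
    let u := ln x / ln y in
    (1 - (t - 2)%:R * u - eps) * x ^+ 2 <= (Psi F x y)%:R.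
Proof.
move=> eps eps0.
case: t t_ge4 homF => [|[|n]] // t4 homF.
pose C := (\sum_(i < n.+3) `|((dehomogenize n.+2 F)`_i)%R|)%N.
have d0 : 0 < eps / 4%:R by rewrite divr_gt0.
set d := eps / 4%:R in d0.
have [X0 hX0] := rough_pairs_bound homF irrF d0.
(* 2 / d is what makes the truncation of x cost at most d x^2, and the exponential gives log C <= d
   log x. *)
exists (Num.max (Num.max (X0.+2)%:R (2%:R / d)) (expR (natln R C / d))) => x y.
rewrite !ge_max => /andP[/andP[xX0 xd] xC] xy.
set u := ln x / ln y; rewrite -/u /=.
have n2 : (n.+2 - 2 = n)%N by rewrite subn2.
rewrite n2 in xy *.
have x2 : 2%:R <= x by apply: le_trans xX0; rewrite ler_nat.
have x1 : 1 <= x by apply: le_trans x2; rewrite ler1n.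
have x0 : 0 < x by apply: lt_le_trans x1.
set X := Num.truncn x.
have XX0 : (X0 <= X)%N.
  by rewrite /X truncn_ge_nat ?(ltW x0) //; apply: le_trans xX0; rewrite ler_nat ltnW // ltnW.
have Xx : X%:R <= x by rewrite truncn_le ltW.
have xX : x < X%:R + 1 by rewrite natr1 truncnS_gt.
have X2x : (X ^ 2)%:R <= x ^+ 2 by rewrite natrX lerXn2r ?nnegrE ?ler0n // ltW.
(* Here n stands for t - 2, and t >= 4 yields X^2 <= x^n <= y. *)
have n_ge2 : (2 <= n)%N by exact: t4.
have t1 := ltnW n_ge2.
have Xy : (X ^ 2)%:R <= y.
  apply: le_trans X2x (le_trans _ xy).
  exact: ler_weXn2l.
have lx : 0 < ln x by rewrite ln_gt0 // (lt_le_trans _ x2) // ltr1n.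
have lxy : n%:R * ln x <= ln y.
  rewrite mulr_natl -lnXn //.
  by rewrite ler_ln ?posrE ?exprn_gt0 // (lt_le_trans _ xy) ?exprn_gt0.
have ly : ln x <= ln y by apply: le_trans lxy; rewrite ler_peMl ?ler1n // ltW.
have ly0 : 0 < ln y by apply: lt_le_trans ly.
have bad := hX0 X XX0 y Xy.
set N : R := #|rough_pairs F X y|%:R in bad.
have lX : natln R X <= ln x.
  by rewrite /natln ler_ln ?posrE // ltr0n /X truncn_gt0.
have lC : natln R C <= d * ln x.
  rewrite mulrC -ler_pdivrMr // -[leLHS]expRK ler_ln ?posrE ?expR_gt0 //.
(* One d comes from log C and one from [rough_pairs_bound]; both multiply log x, which is at most
   log y. *)
have N_le : N <= x ^+ 2 * (n%:R * u + 2%:R * d).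
  rewrite -(ler_pM2r ly0); apply: le_trans bad _.
  apply: (@le_trans _ _ (x ^+ 2 * (d * ln x + (n%:R + d) * ln x))).
    have E : n.+2%:R - 2%:R + d = n%:R + d by rewrite -addn2 natrD addrK.
    rewrite E; apply: ler_pM => //.
      by rewrite addr_ge0 ?lnn_ge0 // mulr_ge0 ?lnn_ge0 // addr_ge0 ?ler0n // ltW.
    by rewrite lerD // ler_wpM2l // addr_ge0 ?ler0n // ltW.
  rewrite -[leRHS]mulrA ler_pM2l ?exprn_gt0 //.
  have uy : u * ln y = ln x by rewrite /u mulfVK ?lt0r_neq0.
  rewrite [leRHS]mulrDl -[n%:R * u * _]mulrA uy.
  have : d * ln x <= d * ln y by rewrite ler_pM2l.
  by move: (ln x) (ln y) (n%:R : R) => a b e; clearbody d; lra.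
have X2_ge : x ^+ 2 - d * x ^+ 2 <= (X ^ 2)%:R.
  have h : 2%:R * x <= d * x ^+ 2.
    by rewrite expr2 mulrA ler_pM2r // mulrC -ler_pdivrMr.
  have h2 : (x - 1) ^+ 2 <= X%:R ^+ 2.
    by rewrite lerXn2r ?nnegrE ?ler0n ?subr_ge0 // lerBlDr ltW.
  rewrite natrX; apply: le_trans h2; move: h; move: (d * x ^+ 2) => w; rewrite sqrrB1.
  by rewrite -mulr_natl; lra.
apply: le_trans (_ : (X ^ 2)%:R - N <= _); last exact: (Psi_ge homF irrF y x1).
(* Of eps = 4 d, the truncation of x takes d and the rough pairs 2 d; the last d is spare. *)
have -> : (1 - n%:R * u - eps) * x ^+ 2 =
  (x ^+ 2 - d * x ^+ 2) - x ^+ 2 * (n%:R * u + 2%:R * d) - d * x ^+ 2.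
  by rewrite /d; field.
have dx : 0 <= d * x ^+ 2 by rewrite mulr_ge0 ?exprn_ge0 // ltW.
by rewrite lerBlDr; apply: le_trans (lerB X2_ge N_le) _; rewrite lerDl.
Qed.
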